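(* Let $k$ be a field with center $\mathbf{c}$, $\sigma$ an automorphism of $k$ and $\delta$ a $\sigma$-derivation of $k$. Let $\mathbf{c}_{cte(\delta)}=\{x\in\mathbf{c}:\delta(x)=0\}$ and let $\mathbf{c}_0=\{x\in\mathbf{c}_{cte(\delta)}:\sigma(x)=x\}$. Suppose there exists an integer $n\ge1$ such that $t^n$ lies in the center of $k(t,\sigma,\delta)$, and that $\mathbf{c}_0$ contains an ample field. Then $\mathrm{RIGP}_{k(t,\sigma,\delta)/k}$ holds.
   Context: ''Field'' means a not necessarily commutative division ring. A $\sigma$-derivation is an additive map $\delta:k\to k$ with $\delta(ab)=\sigma(a)\delta(b)+\delta(a)b$; $k(t,\sigma,\delta)$ is the field of fractions of the Ore domain $k[t;\sigma,\delta]$ of polynomials $\sum a_it^i$ with $ta=\sigma(a)t+\delta(a)$. For a field extension $h/k$ and $x\in h$, $x$ is algebraic over $k$ if the subfield $k(x)$ is finite-dimensional both as a left and a right $k$-vector space; $h/k$ is regular if every element algebraic over $k$ lies in $k$; $h/k$ is outer if the only inner automorphism of $h$ fixing $k$ pointwise is the identity; $\mathrm{Gal}(h/k)$ is the group of automorphisms of $h$ fixing $k$ pointwise and $h/k$ is Galois if its fixed field is $k$. For a field extension $K/k$, $\mathrm{RIGP}_{K/k}$ holds if for every finite group $G$ there is an outer Galois extension $L/K$ with $L/k$ regular and $\mathrm{Gal}(L/K)\cong G$. A commutative field is ample if every absolutely irreducible curve over it having a smooth rational point has infinitely many rational points. *)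

(* Defs.v *)
From HB Require Import structures.
From mathcomp Require Import all_boot all_order all_algebra all_fingroup.
Set Implicit Arguments. Unset Strict Implicit. Unset Printing Implicit Defensive.
Import GRing.Theory.
Local Open Scope ring_scope.

(* "Field" = (not necessarily commutative) division ring:
   a unitRingType (hence 1 <> 0) in which every nonzero element is a unit. *)
Definition is_divring (R : unitRingType) : Prop :=
  forall x : R, x != 0 -> x \is a GRing.unit.

Definition ring_aut (R : unitRingType) (f : R -> R) : Prop :=
  [/\ forall x y, f (x + y) = f x + f y,
      forall x y, f (x * y) = f x * f y,
      f 1 = 1 & bijective f].

Definition sigma_derivation (k : unitRingType) (s d : k -> k) : Prop :=
  (forall a b, d (a + b) = d a + d b) /\
  (forall a b, d (a * b) = s a * d b + d a * b).

(* element of k[t;s,d] mapped into K: sum_i iota(p_i) t^i *)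
Definition ore_eval (k K : unitRingType) (iota : k -> K) (t : K) (p : {poly k}) : K :=
  \sum_(i < size p) iota p`_i * t ^+ i.

(* (K, iota, t) is (a model of) k(t,s,d): the classical (right) ring of
   fractions of the Ore domain k[t;s,d]: K is a division ring, iota an
   embedding of k, t satisfies t a = s(a) t + d(a), the powers of t are
   left-linearly independent over k (so the subring generated by k and t is
   k[t;s,d]) and every element of K is of the form P Q^-1 with P,Q in k[t;s,d]. *)
Definition is_ore_fraction_field (k K : unitRingType) (s d : k -> k)
    (iota : {rmorphism k -> K}) (t : K) : Prop :=
  [/\ is_divring K,
      forall a : k, t * iota a = iota (s a) * t + iota (d a),
      forall p : {poly k}, ore_eval iota t p = 0 -> p = 0 &
      forall x : K, exists p q : {poly k},
        q != 0 /\ x = ore_eval iota t p * (ore_eval iota t q)^-1].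

Definition in_subfield_gen (k L : unitRingType) (e : k -> L) (x y : L) : Prop :=
  forall S : L -> Prop,
    (forall a, S (e a)) -> S x ->
    (forall u v, S u -> S v -> S (u + v)) ->
    (forall u, S u -> S (- u)) ->
    (forall u v, S u -> S v -> S (u * v)) ->
    (forall u, S u -> u != 0 -> S (u^-1)) ->
    S y.

Definition algebraic_over (k L : unitRingType) (e : k -> L) (x : L) : Prop :=
  (exists s : seq L, (forall z, z \in s -> in_subfield_gen e x z) /\
     forall y, in_subfield_gen e x y ->
       exists c : 'I_(size s) -> k, y = \sum_(i < size s) e (c i) * s`_i) /\
  (exists s : seq L, (forall z, z \in s -> in_subfield_gen e x z) /\
     forall y, in_subfield_gen e x y ->
       exists c : 'I_(size s) -> k, y = \sum_(i < size s) s`_i * e (c i)).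

Definition regular_ext (k L : unitRingType) (e : k -> L) : Prop :=
  forall x : L, algebraic_over e x -> exists a : k, x = e a.

Definition in_Gal (K L : unitRingType) (j : K -> L) (f : L -> L) : Prop :=
  ring_aut f /\ forall y : K, f (j y) = j y.

Definition galois_ext (K L : unitRingType) (j : K -> L) : Prop :=
  forall x : L, (forall f, in_Gal j f -> f x = x) -> exists y : K, x = j y.

Definition outer_ext (K L : unitRingType) (j : K -> L) : Prop :=
  forall u : L, u \is a GRing.unit ->
    (forall y : K, u * j y * u^-1 = j y) -> forall x : L, u * x * u^-1 = x.

Definition Gal_isom (gT : finGroupType) (K L : unitRingType) (j : K -> L) : Prop :=
  exists phi : gT -> L -> L,
    [/\ forall g, in_Gal j (phi g),
        forall g h x, phi (g * h)%g x = phi g (phi h x),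
        forall g h, phi g =1 phi h -> g = h &
        forall f, in_Gal j f -> exists g, f =1 phi g].

Definition RIGP (k K : unitRingType) (iota : k -> K) : Prop :=
  forall gT : finGroupType,
    exists (L : unitRingType) (j : {rmorphism K -> L}),
      [/\ is_divring L, outer_ext j, galois_ext j,
          regular_ext (j \o iota) & Gal_isom gT j].

(* Ampleness, via plane curves f(X,Y) = 0, f in F[X][Y]. *)
Definition eval2 (F : fieldType) (f : {poly {poly F}}) (a b : F) : F :=
  (f.[b%:P]).[a].

Definition abs_irreducible2 (F : fieldType) (f : {poly {poly F}}) : Prop :=
  forall (E : fieldType) (e : {rmorphism F -> E}),
    let fE := map_poly (map_poly e) f in
    [/\ fE != 0, fE \isn't a GRing.unit &
        forall g h : {poly {poly E}}, fE = g * h ->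
          g \is a GRing.unit \/ h \is a GRing.unit].

Definition ample (F : fieldType) : Prop :=
  forall f : {poly {poly F}}, abs_irreducible2 f ->
    forall a b : F, eval2 f a b = 0 ->
      (eval2 (map_poly (@deriv F) f) a b != 0 \/ eval2 (f^`()) a b != 0) ->
      forall s : seq (F * F), exists a' b' : F,
        (a', b') \notin s /\ eval2 f a' b' = 0.

Definition in_c0 (k : unitRingType) (s d : k -> k) (x : k) : Prop :=
  (forall y, x * y = y * x) /\ d x = 0 /\ s x = x.

(* Main.v *)
(** Let T = t^-n, which is central in K = k(t,s,d), and let F be the ample field in c_0.

    A finite group G is realized over F(T) by functions y : G -> F[[T]] whose values are the conjugates
    of one algebraic element, i.e. by a G-cover of the line split completely at T = 0.  Cyclic groups of
    prime power order are treated by Artin-Schreier towers and by Kummer theory with descent from a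
    cyclotomic extension.  If G is generated by H1 and H2, covers for H1 and H2 over F are patched
    over F[[x]] by solving a factorization problem with power series in two variables, and ampleness
    of F allows one to specialize the result from F[[x]] to F.

    Put L = K[X] / {P : P(y(1)) = 0}, where y(1) is evaluated at T = t^-n in the completion of K for the
    valuation - deg_t.  A basis of k over F reduces a relation between powers of y(1) over K to relations
    over F(T), so L is a division ring of dimension |G| over K, with Galois group G generated by the
    substitutions y(1) |-> y(g).  It is outer as the y(g) are central, and L/k is regular because the
    valuation of K extends to L with the same residue field k. *)

Require Import Defs.
From HB Require Import structures.
From mathcomp Require Import all_boot all_order all_algebra all_fingroup.
From mathcomp Require Import all_solvable all_field.
From mathcomp Require Import boolp zify ring.
Set Implicit Arguments. Unset Strict Implicit. Unset Printing Implicit Defensive.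
Import GRing.Theory.
Local Open Scope ring_scope.

(** Splitting at T = 0 ties the two halves together: it puts all conjugates y(g) into F[[T]], and as
    T = t^-n has positive valuation, each y(g) becomes a limit of central elements of K. Covers are
    used in two forms. [split_cover], a ring of functions on G, is the form that can be glued;
    [split_gen], a generator with polynomial identities, is the form that can be specialized. The
    induction on |G| alternates between them. Specialization may destroy the irreducibility of the
    generating polynomial; this is prevented by keeping nonzero some coefficients of too high degree
    in T to occur in a polynomial factor. In characteristic p the elements of F[[x]] to be
    specialized need not be separable over the polynomial ring chosen below them; so their q-th
    powers are specialized, for a power q of p. The resulting homomorphism to F need not fix F,
    which is harmless since only the existence of a cover over F is wanted. The completion of K is
    never built: null sequences and sequences of eventually constant valuation stand for it. *)

Lemma strong_rec (T : Type) (Phi : (nat -> T) -> nat -> T) (t0 : T) :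
  (forall c c' n, (forall i, (i < n)%N -> c i = c' i) -> Phi c n = Phi c' n) ->
  exists c, forall n, c n = Phi c n.
Proof.
move=> ext.
pose fix L n : seq T := if n is m.+1 then rcons (L m) (Phi (nth t0 (L m)) m) else [::].
have szL n : size (L n) = n by elim: n => //= n IH; rewrite size_rcons IH.
have nthL n m i : (i < n)%N -> (n <= m)%N -> nth t0 (L m) i = nth t0 (L n) i.
  move=> lin; elim: m => [|m IH]; first by rewrite leqn0 => /eqP n0; rewrite n0 in lin.
  rewrite leq_eqVlt => /predU1P[<-//|]; rewrite ltnS => lenm /=.
  by rewrite nth_rcons szL (leq_trans lin lenm) IH.
exists (fun n => nth t0 (L n.+1) n) => n /=.
rewrite nth_rcons szL ltnn eqxx; apply: ext => i lin.
by rewrite (nthL i.+1 n i).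
Qed.

(** * Formal power series *)

Record fps (R : nzRingType) := Fps { cf : nat -> R }.

Lemma fpsP (R : nzRingType) (a b : fps R) : (forall n, cf a n = cf b n) -> a = b.
Proof. by case: a => a; case: b => b /= /funext ->. Qed.

HB.instance Definition _ (R : nzRingType) := gen_eqMixin (fps R).
HB.instance Definition _ (R : nzRingType) := gen_choiceMixin (fps R).

Section Zmod.
Variable R : nzRingType.
Implicit Types a b : fps R.
Definition fps_add a b := Fps (fun n => cf a n + cf b n).
Definition fps_opp a := Fps (fun n => - cf a n).
Definition fps_zero : fps R := Fps (fun=> 0).
Lemma fps_addA : associative fps_add.
Proof. by move=> a b c; apply: fpsP => n /=; rewrite addrA. Qed.
Lemma fps_addC : commutative fps_add.
Proof. by move=> a b; apply: fpsP => n /=; rewrite addrC. Qed.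
Lemma fps_add0 : left_id fps_zero fps_add.
Proof. by move=> a; apply: fpsP => n /=; rewrite add0r. Qed.
Lemma fps_addN : left_inverse fps_zero fps_opp fps_add.
Proof. by move=> a; apply: fpsP => n /=; rewrite addNr. Qed.
HB.instance Definition _ :=
  GRing.isZmodule.Build (fps R) fps_addA fps_addC fps_add0 fps_addN.
Definition fps_one : fps R := Fps (fun n => (n == 0)%:R).
Definition trunc N a : {poly R} := \poly_(i < N) cf a i.
Lemma coef_trunc N a n : (n < N)%N -> (trunc N a)`_n = cf a n.
Proof. by move=> lt; rewrite coef_poly lt. Qed.
Definition fps_mul a b := Fps (fun n => (trunc n.+1 a * trunc n.+1 b)`_n).
Lemma cf_mulE a b n : cf (fps_mul a b) n = \sum_(i < n.+1) cf a i * cf b (n - i).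
Proof.
rewrite /= coefM; apply: eq_bigr => i _; rewrite !coef_trunc ?ltnS ?leq_subr //.
by rewrite -ltnS.
Qed.
Lemma cf_mul_poly a b n (p q : {poly R}) :
  (forall i, (i <= n)%N -> p`_i = cf a i) -> (forall i, (i <= n)%N -> q`_i = cf b i) ->
  cf (fps_mul a b) n = (p * q)`_n.
Proof.
move=> hp hq; rewrite cf_mulE coefM; apply: eq_bigr => i _.
by rewrite hp ?hq ?leq_subr // -ltnS.
Qed.
Lemma fps_mulA : associative fps_mul.
Proof.
move=> a b c; apply: fpsP => n.
have tr d i : (i <= n)%N -> (trunc n.+1 d)`_i = cf d i by move=> ?; rewrite coef_trunc.
have tr2 d e i : (i <= n)%N -> (trunc n.+1 d * trunc n.+1 e)`_i = cf (fps_mul d e) i.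
  by move=> lei; apply/esym/cf_mul_poly => j leji; apply: tr; apply: leq_trans lei.
rewrite (cf_mul_poly (tr a) (tr2 b c)) (cf_mul_poly (tr2 a b) (tr c)).
by rewrite mulrA.
Qed.
Lemma fps_mul1 : left_id fps_one fps_mul.
Proof.
move=> a; apply: fpsP => n; rewrite cf_mulE big_ord_recl /= subn0 mul1r big1 ?addr0 //.
by move=> i _; rewrite mul0r.
Qed.
Lemma fps_1mul : right_id fps_one fps_mul.
Proof.
move=> a; apply: fpsP => n; rewrite cf_mulE big_ord_recr /= subnn mulr1 big1 ?add0r //.
by move=> i _; rewrite subn_eq0 leqNgt ltn_ord mulr0.
Qed.
Lemma fps_mulDl : left_distributive fps_mul fps_add.
Proof.
move=> a b c; apply: fpsP => n; transitivity (cf (fps_mul a c) n + cf (fps_mul b c) n) => //.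
rewrite !cf_mulE -big_split.
by apply: eq_bigr => i _; rewrite mulrDl.
Qed.
Lemma fps_mulDr : right_distributive fps_mul fps_add.
Proof.
move=> a b c; apply: fpsP => n; transitivity (cf (fps_mul a b) n + cf (fps_mul a c) n) => //.
rewrite !cf_mulE -big_split.
by apply: eq_bigr => i _; rewrite mulrDr.
Qed.
Lemma fps_1neq0 : fps_one != 0.
Proof.
apply/eqP => /(congr1 (fun a => cf a 0)) /= /eqP.
by rewrite (negbTE (oner_neq0 R)).
Qed.
HB.instance Definition _ := GRing.Zmodule_isNzRing.Build (fps R)
  fps_mulA fps_mul1 fps_1mul fps_mulDl fps_mulDr fps_1neq0.

Lemma cfM a b n : cf (a * b) n = \sum_(i < n.+1) cf a i * cf b (n - i).
Proof. exact: cf_mulE. Qed.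
Lemma cf1 n : cf (1 : fps R) n = (n == 0)%:R. Proof. by []. Qed.
Lemma cfD a b n : cf (a + b) n = cf a n + cf b n. Proof. by []. Qed.
Lemma cfB a b n : cf (a - b) n = cf a n - cf b n. Proof. by []. Qed.
Lemma cf0 n : cf (0 : fps R) n = 0. Proof. by []. Qed.
Lemma cf_sum (I : Type) (r : seq I) (P : pred I) (f : I -> fps R) n :
  cf (\sum_(i <- r | P i) f i) n = \sum_(i <- r | P i) cf (f i) n.
Proof. by apply: (big_morph (fun a => cf a n)). Qed.
Lemma cf0M a b : cf (a * b) 0 = cf a 0 * cf b 0.
Proof. by rewrite cfM big_ord1. Qed.

Definition hd a := cf a 0.
Lemma hd_zmod : zmod_morphism hd. Proof. by []. Qed.
Lemma hd_mon : monoid_morphism hd. Proof. by split => // a b; apply: cf0M. Qed.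
HB.instance Definition _ := GRing.isZmodMorphism.Build (fps R) R hd hd_zmod.
HB.instance Definition _ := GRing.isMonoidMorphism.Build (fps R) R hd hd_mon.

Definition p2s (p : {poly R}) : fps R := Fps (fun n => p`_n).
Lemma p2s_zmod : zmod_morphism p2s.
Proof. by move=> p q; apply: fpsP => n /=; rewrite coefB. Qed.
Lemma p2s_mon : monoid_morphism p2s.
Proof.
split=> [|p q]; first by apply: fpsP => n /=; rewrite coef1.
by apply: fpsP => n; rewrite cfM /= coefM.
Qed.
HB.instance Definition _ := GRing.isZmodMorphism.Build {poly R} (fps R) p2s p2s_zmod.
HB.instance Definition _ := GRing.isMonoidMorphism.Build {poly R} (fps R) p2s p2s_mon.
Lemma cf_p2s p n : cf (p2s p) n = p`_n. Proof. by []. Qed.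
Lemma p2s_inj : injective p2s.
Proof. by move=> p q e; apply/polyP => i; rewrite -!cf_p2s e. Qed.
Lemma hd_p2s p : hd (p2s p) = p`_0. Proof. by []. Qed.

Lemma cf_CM c a n : cf (p2s c%:P * a) n = c * cf a n.
Proof.
rewrite cfM big_ord_recl /= coefC /= subn0 big1 ?addr0 // => i _.
by rewrite coefC mul0r.
Qed.
Lemma cf_XnM k a n : cf (p2s 'X^k * a) n = if (n < k)%N then 0 else cf a (n - k).
Proof.
rewrite cfM; case: ltnP => [ltnk|lekn].
  rewrite big1 // => i _; rewrite /= coefXn; case: eqP => [ik|]; last by rewrite mul0r.
  by have:= ltn_ord i; rewrite ik ltnS leqNgt ltnk.
have lt : (k < n.+1)%N by [].
rewrite (bigD1 (Ordinal lt)) //= coefXn eqxx mul1r big1 ?addr0 // => i.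
rewrite -val_eqE /= => /negbTE; rewrite coefXn => ->; exact: mul0r.
Qed.
End Zmod.
Arguments cf1 {R} n.

Section ComRing.
Variable R : comNzRingType.
Lemma fps_mulC : @commutative (fps R) (fps R) *%R.
Proof.
move=> a b; apply: fpsP => n; rewrite !cfM (reindex_inj rev_ord_inj) /=.
by apply: eq_bigr => i _; rewrite mulrC subSS subKn // -ltnS.
Qed.
HB.instance Definition _ := GRing.PzRing_hasCommutativeMul.Build (fps R) fps_mulC.

Definition fps_unit : pred (fps R) := fun a => `[< exists b, b * a = 1 >].
Definition fps_inv (a : fps R) : fps R :=
  if pselect (exists b, b * a = 1) is left e then projT1 (cid e) else a.
Lemma fps_mulVr : {in fps_unit, left_inverse 1 fps_inv *%R}.
Proof.
move=> a /asboolP ha; rewrite /fps_inv; case: pselect => // e.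
by case: cid.
Qed.
Lemma fps_unitP (a b : fps R) : b * a = 1 -> fps_unit a.
Proof. by move=> h; apply/asboolP; exists b. Qed.
Lemma fps_inv_out : {in [predC fps_unit], fps_inv =1 id}.
Proof. by move=> a /asboolP ha; rewrite /fps_inv; case: pselect. Qed.
HB.instance Definition _ := GRing.ComNzRing_hasMulInverse.Build (fps R)
  fps_mulVr fps_unitP fps_inv_out.

Lemma fps_invertible (a : fps R) c : c * cf a 0 = 1 -> exists b, b * a = 1.
Proof.
move=> hc.
pose Phi (b : nat -> R) n := ((n == 0)%:R - \sum_(i < n) b i * cf a (n - i)) * c.
have [|b hb] := @strong_rec R Phi 0.
  move=> d d' n e; rewrite /Phi; congr ((_ - _) * _).
  by apply: eq_bigr => i _; rewrite e.
exists (Fps b); apply: fpsP => n; rewrite cfM cf1 big_ord_recr /= subnn.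
by rewrite hb /Phi -mulrA hc mulr1 addrC subrK.
Qed.
Lemma fps_unit_hd (a : fps R) : hd a = 1 -> a \is a GRing.unit.
Proof.
move=> h; have [|b hb] := @fps_invertible a 1; first by rewrite mul1r.
by apply/unitrPr; exists b; rewrite mulrC.
Qed.
End ComRing.

Lemma lowest_term (R : nzRingType) (a : fps R) : a <> 0 ->
  exists n, cf a n != 0 /\ forall i, (i < n)%N -> cf a i = 0.
Proof.
move=> na; have ex : exists n, cf a n != 0.
  apply: contrapT => h; apply: na; apply: fpsP => n.
  by apply/eqP/negP => /negP hn; apply: h; exists n.
case: (ex_minnP ex) => n hn min; exists n; split=> // i lt; apply/eqP/negP => /negP h.
by have:= min _ h; rewrite leqNgt lt.
Qed.

Section IDom.
Variable R : idomainType.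
Lemma fps_idom : GRing.integral_domain_axiom (fps R).
Proof.
move=> a b ab; case: (eqVneq a 0) => //= /eqP na; case: (eqVneq b 0) => //= /eqP nb; exfalso.
have [m [am mm]] := lowest_term na; have [n [bn mn]] := lowest_term nb.
have := congr1 (fun c => cf c (m + n)) ab; rewrite cfM cf0.
have lt : (m < (m + n).+1)%N by rewrite ltnS leq_addr.
rewrite (bigD1 (Ordinal lt)) //= addKn big1 ?addr0.
  by move/eqP; rewrite mulf_eq0 (negbTE am) (negbTE bn).
move=> i; rewrite -val_eqE /= neq_ltn => /orP[h|h]; first by rewrite mm ?mul0r.
by rewrite (mn (m + n - i)%N) ?mulr0 //; have := ltn_ord i; lia.
Qed.
HB.instance Definition _ := GRing.ComUnitRing_isIntegral.Build (fps R) fps_idom.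
End IDom.

(* [sub h w f] is the substitution of [w x] for the variable of [f], with coefficients mapped by [h]. *)
Section Sub.
Variables (R S : comNzRingType) (h : {rmorphism R -> S}) (w : S).
Definition sub (f : fps R) : fps S := Fps (fun n => h (cf f n) * w ^+ n).
Lemma sub_zmod : zmod_morphism sub.
Proof. by move=> f g; apply: fpsP => n /=; rewrite rmorphB mulrBl. Qed.
Lemma sub_mon : monoid_morphism sub.
Proof.
split=> [|f g]; apply: fpsP => n.
  by case: n => [|n]; rewrite /= ?rmorph1 ?rmorph0 ?mul0r ?expr0 ?mulr1.
transitivity (h (cf (f * g) n) * w ^+ n) => //; rewrite !cfM rmorph_sum mulr_suml; apply: eq_bigr => i _ /=.
by rewrite rmorphM mulrACA -exprD subnKC // -ltnS.
Qed.
HB.instance Definition _ := GRing.isZmodMorphism.Build (fps R) (fps S) sub sub_zmod.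
HB.instance Definition _ := GRing.isMonoidMorphism.Build (fps R) (fps S) sub sub_mon.
End Sub.

Section Map.
Variables (R S : comNzRingType) (h : {rmorphism R -> S}).
Definition fmap (f : fps R) : fps S := Fps (fun n => h (cf f n)).
Lemma fmap_zmod : zmod_morphism fmap.
Proof. by move=> f g; apply: fpsP => n /=; rewrite rmorphB. Qed.
Lemma fmap_mon : monoid_morphism fmap.
Proof.
split=> [|f g]; apply: fpsP => n; first by rewrite /= rmorph_nat.
transitivity (h (cf (f * g) n)) => //; rewrite !cfM rmorph_sum; apply: eq_bigr => i _ /=.
by rewrite rmorphM.
Qed.
HB.instance Definition _ := GRing.isZmodMorphism.Build (fps R) (fps S) fmap fmap_zmod.
HB.instance Definition _ := GRing.isMonoidMorphism.Build (fps R) (fps S) fmap fmap_mon.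
Lemma fmap_p2s p : fmap (p2s p) = p2s (map_poly h p).
Proof. by apply: fpsP => n; rewrite /= coef_map. Qed.
Lemma fmap_inj : injective h -> injective fmap.
Proof. by move=> hi f g e; apply: fpsP => n; apply: hi; rewrite -[h _]/(cf (fmap f) n) e. Qed.
End Map.

Section Swap.
Variable R : comNzRingType.
Definition swap (f : fps (fps R)) : fps (fps R) := Fps (fun n => Fps (fun m => cf (cf f m) n)).
Lemma swap_zmod : zmod_morphism swap.
Proof. by move=> f g; apply: fpsP => n; apply: fpsP => m. Qed.
Lemma swap_mon : monoid_morphism swap.
Proof.
split=> [|f g]; apply: fpsP => n; apply: fpsP => m.
  by case: n; case: m.
transitivity (cf (cf (f * g) m) n) => //; rewrite cfM cf_sum cfM cf_sum.
under eq_bigr do rewrite cfM; under [RHS]eq_bigr do rewrite cfM.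
by rewrite exchange_big.
Qed.
HB.instance Definition _ := GRing.isZmodMorphism.Build (fps (fps R)) (fps (fps R)) swap swap_zmod.
HB.instance Definition _ := GRing.isMonoidMorphism.Build (fps (fps R)) (fps (fps R)) swap swap_mon.
Lemma swapK : involutive swap.
Proof. by move=> f; apply: fpsP => n; apply: fpsP. Qed.
End Swap.
Arguments fps_mul {R} a b : simpl never.
Arguments hd {R} a : simpl never.
Arguments p2s {R} p : simpl never.
Arguments sub {R S} h w f : simpl never.
Arguments fmap {R S} h f : simpl never.
Arguments swap {R} f : simpl never.

Lemma cf_sub (R S : comNzRingType) (h : {rmorphism R -> S}) w f n :
  cf (sub h w f) n = h (cf f n) * w ^+ n.
Proof. by []. Qed.
Lemma cf_fmap (R S : comNzRingType) (h : {rmorphism R -> S}) f n :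
  cf (fmap h f) n = h (cf f n).
Proof. by []. Qed.
Lemma cf_swap (R : comNzRingType) (f : fps (fps R)) n m : cf (cf (swap f) n) m = cf (cf f m) n.
Proof. by []. Qed.

(** * Rational power series and evaluation at a series *)

Section Rat.
Variable R : idomainType.
Implicit Types c d : fps R.

(** The localization of R[T] at the polynomials with constant term 1, inside R[[T]]. Over a field it
    is the local ring of the line at T = 0. *)
Definition ratl c := exists e p : {poly R}, e`_0 = 1 /\ p2s e * c = p2s p.

Lemma p2s_neq0 (e : {poly R}) : e`_0 = 1 -> p2s e != 0.
Proof.
move=> e0; apply/eqP => /(congr1 (@hd R)) /eqP.
by rewrite hd_p2s e0 rmorph0 (negbTE (oner_neq0 _)).
Qed.
Lemma rat_poly p : ratl (p2s p).
Proof. by exists 1, p; rewrite coef1 (rmorph1 (@p2s R)) mul1r. Qed.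
Lemma coef0M (p q : {poly R}) : (p * q)`_0 = p`_0 * q`_0.
Proof. by rewrite coefM big_ord1. Qed.
Lemma ratD c d : ratl c -> ratl d -> ratl (c + d).
Proof.
move=> [e [p [e0 ec]]] [f [q [f0 fd]]]; exists (e * f), (p * f + q * e).
rewrite coef0M e0 f0 mulr1; split=> //.
by rewrite rmorphD !rmorphM mulrDr /= -ec -fd; ring.
Qed.
Lemma ratM c d : ratl c -> ratl d -> ratl (c * d).
Proof.
move=> [e [p [e0 ec]]] [f [q [f0 fd]]]; exists (e * f), (p * q).
rewrite coef0M e0 f0 mulr1; split=> //.
by rewrite !rmorphM /= -ec -fd; ring.
Qed.
Lemma rat_unit c (e p : {poly R}) :
  e`_0 \is a GRing.unit -> p2s e * c = p2s p -> ratl c.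
Proof.
move=> u h; exists ((e`_0)^-1 *: e), ((e`_0)^-1 *: p); rewrite coefZ mulVr //; split=> //.
by rewrite -!mul_polyC !rmorphM -mulrA /= h.
Qed.

Lemma rat_common (I : eqType) (s : seq I) (f : I -> fps R) :
  (forall i, i \in s -> ratl (f i)) ->
  exists e : {poly R}, e`_0 = 1 /\ forall i, i \in s -> exists p, p2s e * f i = p2s p.
Proof.
elim: s => [|i s IH] h; first by exists 1; rewrite coef1.
have [|e [e0 he]] := IH; first by move=> j js; apply: h; rewrite inE js orbT.
have [d [p [d0 dp]]] := h i (mem_head _ _).
exists (e * d); rewrite coef0M e0 d0 mulr1; split=> // j.
rewrite inE => /predU1P[->|/he [q hq]].
  by exists (e * p); rewrite !rmorphM -mulrA /= dp.
by exists (q * d); rewrite !rmorphM mulrAC /= hq.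
Qed.
End Rat.

Lemma lift_poly (A B : nzRingType) (f : {rmorphism A -> B}) (P : {poly B}) :
  (forall i, exists q, f q = P`_i) -> exists p, map_poly f p = P.
Proof.
move=> h; have [q hq] := choice h.
exists (\poly_(i < size P) q i); apply/polyP => i; rewrite coef_map coef_poly.
by case: ltnP => [_|le]; [exact: hq | rewrite /= rmorph0 nth_default].
Qed.

Section Ev.
Variable R : comNzRingType.
Definition ev (y : fps R) (r : {poly {poly R}}) : fps R := (map_poly (@p2s R) r).[y].
Lemma ev_zmod y : zmod_morphism (ev y).
Proof. by move=> p q; rewrite /ev rmorphB hornerD hornerN. Qed.
Lemma ev_mon y : monoid_morphism (ev y).
Proof. by split=> [|p q]; rewrite /ev ?rmorph1 ?hornerC // rmorphM hornerM. Qed.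
HB.instance Definition _ y := GRing.isZmodMorphism.Build {poly {poly R}} (fps R) (ev y) (ev_zmod y).
HB.instance Definition _ y := GRing.isMonoidMorphism.Build {poly {poly R}} (fps R) (ev y) (ev_mon y).
Lemma evC y c : ev y c%:P = p2s c. Proof. by rewrite /ev map_polyC hornerC. Qed.
Lemma evX y : ev y 'X = y. Proof. by rewrite /ev map_polyX hornerX. Qed.
Lemma evE y r : ev y r = \sum_(i < size r) p2s r`_i * y ^+ i.
Proof.
rewrite /ev (@horner_coef_wide _ (size r)); last exact: size_poly.
by apply: eq_bigr => i _; rewrite coef_map.
Qed.
End Ev.

Arguments ev {R} y r : simpl never.

(** * Two forms of a G-cover split at T = 0 *)

Section Forms.
Variables (gT : finGroupType) (G : {group gT}).

(** [A] plays the ring of functions on a G-cover near T = 0. The fibre over T = 0 consists of |G|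
    rational points, and a function is recorded by its expansions at them. The last three conditions
    say that invariant functions come from the base, that some function is 1 at one point of the
    fibre and 0 at the others, and that the cover is connected: the expansion at one point
    determines the function. *)
Definition split_cover (R : idomainType) := exists A : (gT -> fps R) -> Prop,
  [/\ forall a b, A a -> A b -> A (fun g => a g + b g),
      forall a b, A a -> A b -> A (fun g => a g * b g),
      forall a u, u \in G -> A a -> A (fun g => a (u * g)%g) &
   [/\ forall p, A (fun=> p2s p),
      forall a c, A a -> (forall g, g \in G -> a g = c) -> ratl c,
      exists2 a, A a & forall g, g \in G -> hd (a g) = (g == 1%g)%:R &
      forall a, A a -> a 1%g = 0 -> forall g, g \in G -> a g = 0]].

(** The cover by a primitive element with equation [p] over R[T]. The third condition makes each
    conjugate rational in [y g]; its denominators [e] and p' are those that Lagrange interpolation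
    produces. The last one is the irreducibility of [p] over the fractions of R[T]. Only finitely
    many elements of R enter, apart from the series [y], which Hensel's lemma recovers from their
    constant terms. *)
Definition split_gen (R : idomainType) := exists (y : gT -> fps R) (p : {poly {poly R}}),
  [/\ map_poly (@p2s R) p = \prod_(g in G) ('X - (y g)%:P),
      forall g h, g \in G -> h \in G -> g != h -> hd (y g) - hd (y h) \is a GRing.unit,
      exists2 e : {poly R}, e`_0 = 1 & forall u, u \in G -> exists Q, forall g, g \in G ->
        p2s e * y (u * g)%g * ev (y g) p^`() = ev (y g) Q &
      forall r : {poly {poly R}}, (size r <= #|G|)%N -> ev (y 1%g) r = 0 -> r = 0].

Section Roots.
Variables (R : idomainType) (y : gT -> fps R).
Hypothesis ydist : forall g h, g \in G -> h \in G -> g != h -> hd (y g) - hd (y h) \is a GRing.unit.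

Lemma y_inj : {in G &, injective y}.
Proof.
move=> g h Gg Gh e; apply/eqP; apply/negP => /negP/(ydist Gg Gh).
by rewrite e subrr unitr0.
Qed.
Lemma roots_poly0 (q : {poly fps R}) : (size q <= #|G|)%N ->
  (forall g, g \in G -> q.[y g] = 0) -> q = 0.
Proof.
move=> sq hq; apply/eqP; apply: contraTT sq => nq; rewrite -ltnNge.
have := @max_poly_roots _ q [seq y g | g in G] nq.
rewrite size_image; apply.
  by apply/allP => _ /imageP[g Gg ->]; rewrite /root hq.
rewrite map_inj_in_uniq ?enum_uniq // => g h; rewrite !mem_enum; exact: y_inj.
Qed.
Lemma ev_roots0 (r : {poly {poly R}}) : (size r <= #|G|)%N ->
  (forall g, g \in G -> ev (y g) r = 0) -> r = 0.
Proof.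
move=> sr hr; apply: (map_inj_poly (@p2s_inj R) (rmorph0 _)).
rewrite rmorph0; apply: roots_poly0 => //; exact: leq_trans (size_poly _ _) sr.
Qed.

Variable p : {poly {poly R}}.
Hypothesis py : map_poly (@p2s R) p = \prod_(g in G) ('X - (y g)%:P).

Lemma p_monic : p \is monic.
Proof.
have := monic_prod_XsubC (enum G) (fun=> true) y.
rewrite big_enum -py !monicE lead_coef_map_inj ?rmorph0 //; last exact: p2s_inj.
by move/eqP=> h; apply/eqP/(@p2s_inj R); rewrite h rmorph1.
Qed.
Lemma size_p : size p = #|G|.+1.
Proof.
rewrite -(size_map_inj_poly (@p2s_inj R) (rmorph0 _)) py.
by rewrite -big_enum size_prod_XsubC -cardE.
Qed.
Lemma ev_p g : g \in G -> ev (y g) p = 0.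
Proof.
by move=> Gg; rewrite /ev py (bigD1 g) //= hornerM hornerXsubC subrr mul0r.
Qed.
Lemma ev_mod (r : {poly {poly R}}) : exists2 r' : {poly {poly R}}, (size r' <= #|G|)%N &
  (exists q : {poly {poly R}}, r = q * p + r').
Proof.
exists (Pdiv.Ring.rmodp r p).
  by rewrite -ltnS -size_p Pdiv.Ring.ltn_rmodp monic_neq0 // p_monic.
by exists (Pdiv.Ring.rdivp r p); rewrite -Pdiv.RingMonic.rdivp_eq ?p_monic.
Qed.
Lemma ev_p_deriv g : g \in G -> ev (y g) p^`() = \prod_(h in G | h != g) (y g - y h).
Proof.
move=> Gg; rewrite /ev -deriv_map py (bigD1 g) //= derivM derivXsubC mul1r hornerD.
rewrite hornerM hornerXsubC subrr mul0r addr0 horner_prod.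
by apply: eq_bigr => h _; rewrite hornerXsubC.
Qed.
Lemma hd_ev_deriv_unit g : g \in G -> hd (ev (y g) p^`()) \is a GRing.unit.
Proof.
move=> Gg; rewrite ev_p_deriv // rmorph_prod; apply: rpred_prod => h /andP[Gh ne].
by rewrite rmorphB ydist // eq_sym.
Qed.
End Roots.

Section GenCover.
Variable R : idomainType.
(** The ring is the localization of F[T, y] at the elements with nonzero residue at every point of
    the fibre. It is stable under translation because the denominators e p'(y) of the Galois action
    are of this kind. *)
Lemma gen_cover (F : fieldType) : split_gen F -> split_cover F.
Proof.
move=> [y [p [py ydist [e e0 act] dom]]].
pose den (S : {poly {poly F}}) := forall g, g \in G -> hd (ev (y g) S) != 0.
pose A (a : gT -> fps F) := exists S T, den S /\
  forall g, g \in G -> ev (y g) S * a g = ev (y g) T.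
have denM S T : den S -> den T -> den (S * T).
  by move=> hS hT g Gg; rewrite !rmorphM mulf_neq0 ?hS ?hT.
have den1 : den 1 by move=> g _; rewrite !rmorph1 oner_neq0.
have den0 S g : den S -> g \in G -> ev (y g) S != 0.
  by move=> h Gg; apply: contra_neq (h g Gg) => ->; rewrite rmorph0.
have evmod r : exists2 r' : {poly {poly F}}, (size r' <= #|G|)%N & forall g, g \in G -> ev (y g) r = ev (y g) r'.
  have [r' sr [q ->]] := ev_mod py r; exists r' => // g Gg.
  by rewrite rmorphD rmorphM /= (ev_p py Gg) mulr0 add0r.
exists A; split; [| | | split].
- move=> a b [S [T [dS hS]]] [S' [T' [dS' hS']]].
  exists (S * S'), (T * S' + S * T'); split; first exact: denM.
  by move=> g Gg; rewrite rmorphD !rmorphM /= -hS // -hS' //; ring.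
- move=> a b [S [T [dS hS]]] [S' [T' [dS' hS']]].
  exists (S * S'), (T * T'); split; first exact: denM.
  by move=> g Gg; rewrite !rmorphM /= -hS // -hS' //; ring.
- move=> a u Gu [S [T [dS hS]]]; have [Q hQ] := act u Gu.
  pose D := e%:P * p^`().
  have hD g : g \in G -> ev (y g) D * y (u * g)%g = ev (y g) Q.
    by move=> Gg; rewrite -hQ // rmorphM /= evC; ring.
  have dD : den D.
    move=> g Gg; rewrite !rmorphM /= evC mulf_neq0 //; first by rewrite hd_p2s e0 oner_neq0.
    by rewrite -unitfE (hd_ev_deriv_unit ydist py).
  (* r(y(ug)) is a polynomial in y(g) up to a power of D *)
  have tr r : exists2 r', true & exists N, forall g, g \in G ->
      ev (y g) (D ^+ N) * ev (y (u * g)%g) r = ev (y g) r'.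
    exists (\sum_(i < size r) (r`_i)%:P * Q ^+ i * D ^+ (size r - i)) => //.
    exists (size r) => g Gg; rewrite (evE (y (u * g)%g)) rmorph_sum mulr_sumr; apply: eq_bigr => i _.
    rewrite !rmorphM !rmorphXn /= evC -hD // exprMn.
    have -> : ev (y g) D ^+ size r = ev (y g) D ^+ i * ev (y g) D ^+ (size r - i).
      by rewrite -exprD subnKC // ltnW.
    by rewrite /=; ring.
  have [S' _ [N hN]] := tr S; have [T' _ [M hM]] := tr T.
  exists (S' * D ^+ M), (T' * D ^+ N); split.
    move=> g Gg; rewrite rmorphM /= -hN // !rmorphM !rmorphXn !mulf_neq0 ?expf_neq0 ?dD //.
    by rewrite dS ?groupM.
  move=> g Gg; rewrite 2!rmorphM /= -hN // -hM // -hS ?groupM //; ring.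
- move=> q; exists 1, q%:P; split=> // g _; by rewrite rmorph1 mul1r evC.
- move=> a c [S [T [dS hS]]] ac.
  (* If the fraction T/S is a constant c on G, then S' c - T' has degree below |G| and |G| roots, so
     it is zero. A coefficient of S' with nonzero constant term then exhibits c as rational. *)
  have [S' sS eS] := evmod S; have [T' sT eT] := evmod T.
  have eqST : map_poly (@p2s F) S' * c%:P - map_poly (@p2s F) T' = 0.
    apply: (roots_poly0 ydist) => [|g Gg].
      rewrite (leq_trans (size_polyD _ _)) // size_polyN geq_max.
      rewrite (leq_trans (size_poly _ _)) // andbT mulrC mul_polyC.
      by rewrite (leq_trans (size_scale_leq _ _)) // (leq_trans (size_poly _ _)).
    by rewrite hornerD hornerN hornerM hornerC -/(ev (y g) S') -/(ev (y g) T') -eS // -eT // -hS // ac // subrr.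
  have [i hi] : exists i, (S'`_i)`_0 != 0.
    apply: contrapT => h; have := dS 1%g (group1 G); rewrite eS // evE rmorph_sum big1 ?eqxx //.
    move=> i _; rewrite rmorphM /= hd_p2s; case: (eqVneq (S'`_i)`_0 0) => [->|ne]; first by rewrite mul0r.
    by case: h; exists i.
  apply: (@rat_unit _ _ (S'`_i) (T'`_i)); first by rewrite unitfE.
  have := congr1 (fun q : {poly fps F} => q`_i) eqST; rewrite coefB coefMC !coef_map coef0 => /eqP.
  by rewrite subr_eq0 => /eqP.
(* Lagrange interpolation at the residues [l g], which are constants: only the values at T = 0 are
   prescribed. *)
- pose l g := hd (y g).
  pose c := \prod_(h in G | h != 1%g) (l 1%g - l h).
  have c0 : c != 0.
    by apply/prodf_neq0 => h /andP[Gh ne]; rewrite -unitfE ydist ?group1 // eq_sym.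
  pose r : {poly {poly F}} := (c^-1)%:P%:P * \prod_(h in G | h != 1%g) ('X - (l h)%:P%:P).
  exists (fun g => ev (y g) r); first by exists 1, r; split=> // g _; rewrite rmorph1 mul1r.
  move=> g Gg; rewrite /r !rmorphM !rmorph_prod /= evC.
  have -> : \prod_(h in G | h != 1%g) hd (ev (y g) ('X - (l h)%:P%:P)) =
            \prod_(h in G | h != 1%g) (l g - l h).
    by apply: eq_bigr => h _; rewrite !rmorphB /= evX evC /= hd_p2s coefC eqxx.
  rewrite hd_p2s coefC eqxx; case: eqVneq => [->|ne]; first by rewrite mulVf.
  by rewrite (bigD1 g) ?Gg //= subrr mul0r mulr0.
- move=> a [S [T [dS hS]]] a1 g Gg.
  have [T' sT eT] := evmod T.
  have T'0 : T' = 0 by apply: dom => //; rewrite -eT ?group1 // -hS ?group1 // a1 mulr0.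
  have := hS g Gg; rewrite eT // T'0 rmorph0 => /eqP; rewrite mulf_eq0.
  by rewrite (negbTE (den0 _ _ dS Gg)) => /eqP.
Qed.
End GenCover.
End Forms.

Section CoverGen.
Variables (gT : finGroupType) (G : {group gT}) (R : idomainType).
Variables (A : (gT -> fps R) -> Prop).
Hypothesis Aadd : forall a b, A a -> A b -> A (fun g => a g + b g).
Hypothesis Amul : forall a b, A a -> A b -> A (fun g => a g * b g).
Hypothesis Atr : forall a u, u \in G -> A a -> A (fun g => a (u * g)%g).
Hypothesis Apol : forall p, A (fun=> p2s p).
Hypothesis Arat : forall a c, A a -> (forall g, g \in G -> a g = c) -> ratl c.

Lemma cover_ext a b : a =1 b -> A a -> A b.
Proof. by move=> /funext ->. Qed.
Lemma cover0 : A (fun=> 0).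
Proof. by apply: cover_ext (Apol 0) => g; rewrite rmorph0. Qed.
Lemma cover1 : A (fun=> 1).
Proof. by apply: cover_ext (Apol 1) => g; rewrite rmorph1. Qed.
Lemma coverN a : A a -> A (fun g => - a g).
Proof.
move=> Aa; apply: cover_ext (Amul (Apol (-1)) Aa) => g.
by rewrite rmorphN1 mulN1r.
Qed.
Lemma cover_sum (I : Type) (r : seq I) (P : pred I) (f : I -> gT -> fps R) :
  (forall i, P i -> A (f i)) -> A (fun g => \sum_(i <- r | P i) f i g).
Proof.
move=> h; elim: r => [|i r IH].
  by apply: cover_ext cover0 => g; rewrite big_nil.
case Pi: (P i); last by apply: cover_ext IH => g; rewrite big_cons Pi.
by apply: cover_ext (Aadd (h i Pi) IH) => g; rewrite big_cons Pi.
Qed.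
Lemma coverX a n : A a -> A (fun g => a g ^+ n).
Proof.
move=> Aa; elim: n => [|n IH]; first exact: cover_ext cover1.
by apply: cover_ext (Amul Aa IH) => g; rewrite exprS.
Qed.
Lemma cover_ev a r : A a -> A (fun g => ev (a g) r).
Proof.
move=> Aa; apply: cover_ext (@cover_sum _ (index_enum 'I_(size r)) predT
  (fun i g => p2s r`_i * a g ^+ i) _) => [g|i _]; first by rewrite evE.
by apply: Amul => //; apply: coverX.
Qed.

Definition cover_poly (P : gT -> {poly fps R}) := forall i, A (fun g => (P g)`_i).
Lemma cover_polyM P Q : cover_poly P -> cover_poly Q -> cover_poly (fun g => P g * Q g).
Proof.
move=> hP hQ i; apply: cover_ext (@cover_sum _ (index_enum 'I_i.+1) predT
  (fun j g => (P g)`_j * (Q g)`_(i - j)) _) => [g|j _]; first by rewrite coefM.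
by apply: Amul.
Qed.
Lemma cover_polyC a : A a -> cover_poly (fun g => (a g)%:P).
Proof.
move=> Aa [|i]; first by apply: cover_ext Aa => g; rewrite coefC.
by apply: cover_ext cover0 => g; rewrite coefC.
Qed.
Lemma cover_poly_XsubC a : A a -> cover_poly (fun g => 'X - (a g)%:P).
Proof.
move=> Aa i; apply: cover_ext (Aadd (Apol (i == 1)%:R) (coverN (cover_polyC Aa i))) => g.
by rewrite coefB coefX rmorph_nat.
Qed.
Lemma cover_poly_prod (I : Type) (r : seq I) (P : pred I) (f : I -> gT -> {poly fps R}) :
  (forall i, P i -> cover_poly (f i)) -> cover_poly (fun g => \prod_(i <- r | P i) f i g).
Proof.
move=> h; elim: r => [|i r IH].
  move=> i; apply: cover_ext (cover_polyC cover1 i) => g; by rewrite big_nil.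
case Pi: (P i); last by move=> j; apply: cover_ext (IH j) => g; rewrite big_cons Pi.
by move=> j; apply: cover_ext (cover_polyM (h i Pi) IH j) => g; rewrite big_cons Pi.
Qed.
Lemma cover_poly_sum (I : Type) (r : seq I) (P : pred I) (f : I -> gT -> {poly fps R}) :
  (forall i, P i -> cover_poly (f i)) -> cover_poly (fun g => \sum_(i <- r | P i) f i g).
Proof.
move=> h i; apply: cover_ext (@cover_sum _ r P (fun j g => (f j g)`_i) _) => [g|j Pj].
  by rewrite coef_sum.
exact: h.
Qed.

(* Lagrange interpolation of a at the values of y; its coefficients are invariant under translation. *)
Definition lagrange (a y : gT -> fps R) : {poly fps R} :=
  \sum_(g in G) (a g)%:P * \prod_(h in G | h != g) ('X - (y h)%:P).
(** The translation by [k] is written inside the sum, so that the coefficient is a member of [A] as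
    a function of [k]; reindexing by [k] shows that it is constant, hence rational. *)
Lemma lagrange_rat a y i : A a -> A y -> ratl (lagrange a y)`_i.
Proof.
move=> Aa Ay.
apply: (@Arat (fun k => (\sum_(g in G) (a (g * k)%g)%:P *
   \prod_(h in G | h != g) ('X - (y (h * k)%g)%:P))`_i)).
  apply: cover_poly_sum => g Gg; apply: cover_polyM; first by apply: cover_polyC; apply: Atr.
  by apply: cover_poly_prod => h /andP[Gh _]; apply: cover_poly_XsubC; apply: Atr.
move=> k Gk; congr ((_ : {poly fps R})`_i); rewrite /lagrange.
rewrite (reindex_inj (mulIg k^-1%g)) /=; apply: eq_big => g; first by rewrite groupMr ?groupV.
move=> _; rewrite mulgKV; congr (_ * _).
rewrite (reindex_inj (mulIg k^-1%g)) /=; apply: eq_big => h.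
  by rewrite groupMr ?groupV // (can_eq (mulgK _)).
by rewrite mulgKV.
Qed.
Lemma charpoly_rat y i : A y -> ratl (\prod_(g in G) ('X - (y g)%:P))`_i.
Proof.
move=> Ay.
apply: (@Arat (fun k => (\prod_(g in G) ('X - (y (g * k)%g)%:P))`_i)).
  by apply: cover_poly_prod => h Gh; apply: cover_poly_XsubC; apply: Atr.
move=> k Gk; congr ((_ : {poly fps R})`_i).
rewrite (reindex_inj (mulIg k^-1%g)) /=; apply: eq_big => g; first by rewrite groupMr ?groupV.
by rewrite mulgKV.
Qed.
Lemma lagrangeE a y g : g \in G ->
  (lagrange a y).[y g] = a g * \prod_(h in G | h != g) (y g - y h).
Proof.
move=> Gg; rewrite /lagrange horner_sum (bigD1 g) //= [X in _ + X]big1 ?addr0.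
  by rewrite hornerM hornerC horner_prod; congr (_ * _); apply: eq_bigr => h _; rewrite hornerXsubC.
move=> k /andP[Gk ne]; rewrite hornerM horner_prod (bigD1 g) /= ?Gg 1?eq_sym //.
by rewrite hornerXsubC subrr mul0r mulr0.
Qed.
End CoverGen.

(** Serves to clear denominators: with [c] a common denominator, scaling the roots by [c] gives
    every coefficient below the leading one at least one factor [c]. *)
Lemma coef_prod_scale (R : comNzRingType) (c : R) (s : seq R) i :
  c ^+ i * (\prod_(a <- s) ('X - (c * a)%:P))`_i = c ^+ size s * (\prod_(a <- s) ('X - a%:P))`_i.
Proof.
elim: s i => [|a s IH] i; first by rewrite !big_nil !coef1; case: i => [|i] //; rewrite mulr0 expr0 mulr0.
rewrite !big_cons !mulrBl !coefB !coefXM !coefCM /= !mulrBr.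
have -> : c ^+ i * (c * a * (\prod_(j <- s) ('X - (c * j)%:P))`_i)
  = c ^+ (size s).+1 * (a * (\prod_(j <- s) ('X - j%:P))`_i).
  by rewrite exprS; transitivity (c * a * (c ^+ i * (\prod_(j <- s) ('X - (c * j)%:P))`_i));
     [ring | rewrite IH; ring].
congr (_ - _); case: i => [|i] /=; first by rewrite !mulr0.
by rewrite !exprS -!mulrA IH.
Qed.

(** Translates of [eps] allow one to prescribe the residues at all points of the fibre. Residues
    [lam g] with unit differences give a generator, also over a base such as F[[x]] that is not a
    field. *)
Lemma cover_gen (gT : finGroupType) (G : {group gT}) (R : idomainType) (lam : gT -> R) :
  (forall g h, g != h -> lam g - lam h \is a GRing.unit) ->
  split_cover G R -> split_gen G R.
Proof.
move=> hlam [A [Aadd Amul Atr [Apol Arat [eps Aeps heps] Adom]]].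
pose y0 g := \sum_(k in G) p2s (lam k)%:P * eps (k^-1 * g)%g.
have Ay0 : A y0 by apply: cover_sum => // k Gk; apply: Amul => //; apply: Atr; rewrite ?groupV.
have hy0 g : g \in G -> hd (y0 g) = lam g.
  move=> Gg; rewrite rmorph_sum (bigD1 g) //= rmorphM /= mulVg heps // eqxx mulr1 hd_p2s coefC.
  rewrite big1 ?addr0 // => k /andP[Gk ne]; rewrite rmorphM /= heps ?groupM ?groupV //.
  by rewrite eq_mulVg1 in ne; rewrite (negbTE ne) mulr0.
have [e [e0 he]] := @rat_common R _ (iota 0 #|G|.+1)
  (fun i => (\prod_(g in G) ('X - (y0 g)%:P))`_i) (fun i _ => charpoly_rat Aadd Amul Atr Apol Arat i Ay0).
pose y g := p2s e * y0 g.
have Ay : A y by apply: Amul.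
have hy g : g \in G -> hd (y g) = lam g.
  by move=> Gg; rewrite rmorphM /= hd_p2s e0 mul1r hy0.
have ydist g h : g \in G -> h \in G -> g != h -> hd (y g) - hd (y h) \is a GRing.unit.
  by move=> Gg Gh ne; rewrite !hy ?hlam.
have szP : size (\prod_(g in G) ('X - (y g)%:P)) = #|G|.+1.
  by rewrite -big_enum size_prod_XsubC -cardE.
have [p py] : exists p : {poly {poly R}}, map_poly (@p2s R) p = \prod_(g in G) ('X - (y g)%:P).
  apply: lift_poly => i.
  case: (ltngtP i #|G|) => [lt|gt|->].
  - have [|q hq] := he i; first by rewrite mem_iota /= add0n ltnS ltnW.
    (* One of the |G| - i factors [e] is spent on the denominator of the coefficient, whence the
       predecessor. *)
    exists (e ^+ (#|G| - i).-1 * q).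
    have := @coef_prod_scale _ (p2s e) [seq y0 g | g in G] i.
    have -> : p2s e ^+ size [seq y0 g | g in G] = p2s e ^+ i * p2s e ^+ (#|G| - i).
      by rewrite size_image -exprD subnKC // ltnW.
    rewrite !big_image /= -mulrA.
    move/(mulfI (expf_neq0 _ (p2s_neq0 e0))) => ->.
    by rewrite rmorphM rmorphXn /= -hq mulrA -exprSr prednK // subn_gt0.
  - by exists 0; rewrite rmorph0 nth_default // szP.
  - exists 1; rewrite rmorph1.
    have := monic_prod_XsubC (enum G) (fun=> true) y.
    by rewrite big_enum monicE lead_coefE szP => /eqP.
exists y, p; split=> //.
- have cQ u : exists Q : {poly R} * {poly {poly R}}, u \in G -> Q.1`_0 = 1 /\ forall g, g \in G ->
      p2s Q.1 * y (u * g)%g * ev (y g) p^`() = ev (y g) Q.2.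
    case Gu: (u \in G); last by exists (0, 0).
    pose L := lagrange G (fun g => y (u * g)%g) y.
    have [d [d0 hd]] := @rat_common R _ (iota 0 (size L)) (fun i => L`_i)
       (fun i _ => lagrange_rat Aadd Amul Atr Apol Arat i (Atr _ _ Gu Ay) Ay).
    have [Q hQ] : exists Q : {poly {poly R}}, map_poly (@p2s R) Q = (p2s d)%:P * L.
      apply: lift_poly => i; rewrite coefCM; case: (ltnP i (size L)) => [lt|ge].
        by have [|q hq] := hd i; [rewrite mem_iota add0n|exists q].
      by exists 0; rewrite rmorph0 nth_default ?mulr0.
    exists (d, Q) => _ /=; split=> // g Gg.
    rewrite /ev hQ hornerM hornerC lagrangeE // -/(ev _ _) (ev_p_deriv py) //; ring.
  have [Q hQ] := choice cQ.
  (* A single denominator has to serve all [u]. *)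
  exists (\prod_(u in G) (Q u).1).
    rewrite -hd_p2s !rmorph_prod big1 // => u Gu /=; rewrite hd_p2s; by case: (hQ u Gu).
  move=> u Gu; exists ((\prod_(v in G | v != u) (Q v).1)%:P * (Q u).2) => g Gg.
  rewrite rmorphM /= evC (bigD1 u) //= rmorphM /=.
  by case: (hQ u Gu) => _ <- //; ring.
- move=> r sr r1; apply: (ev_roots0 ydist sr) => g Gg.
  exact: (Adom (fun g => ev (y g) r) (cover_ev Aadd Amul Apol _ Ay) r1).
Qed.

(** * Patching two covers over F[[x]] *)

Section Const.
Variable R : comNzRingType.
Definition kc (c : R) : fps R := p2s c%:P.
Lemma kc_zmod : zmod_morphism kc.
Proof. by move=> a b; rewrite /kc polyCB rmorphB. Qed.
Lemma kc_mon : monoid_morphism kc.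
Proof. by split=> [|a b]; rewrite /kc ?polyC1 ?rmorph1 // polyCM rmorphM. Qed.
HB.instance Definition _ := GRing.isZmodMorphism.Build R (fps R) kc kc_zmod.
HB.instance Definition _ := GRing.isMonoidMorphism.Build R (fps R) kc kc_mon.
Lemma hd_kc c : hd (kc c) = c. Proof. by rewrite hd_p2s coefC. Qed.
Lemma cf_kcM c a n : cf (kc c * a) n = c * cf a n. Proof. exact: cf_CM. Qed.

Variable w : fps R.
Definition pv (p : {poly R}) : fps R := (map_poly kc p).[w].
Lemma pv_zmod : zmod_morphism pv.
Proof. by move=> p q; rewrite /pv rmorphB hornerD hornerN. Qed.
Lemma pv_mon : monoid_morphism pv.
Proof. by split=> [|p q]; rewrite /pv ?rmorph1 ?hornerC // rmorphM hornerM. Qed.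
HB.instance Definition _ := GRing.isZmodMorphism.Build {poly R} (fps R) pv pv_zmod.
HB.instance Definition _ := GRing.isMonoidMorphism.Build {poly R} (fps R) pv pv_mon.
Lemma pvC c : pv c%:P = kc c. Proof. by rewrite /pv map_polyC hornerC. Qed.
Lemma pvX : pv 'X = w. Proof. by rewrite /pv map_polyX hornerX. Qed.
Lemma pvE p : pv p = \sum_(i < size p) kc p`_i * w ^+ i.
Proof.
rewrite /pv (@horner_coef_wide _ (size p)); last exact: size_poly.
by apply: eq_bigr => i _; rewrite coef_map.
Qed.
End Const.
Arguments kc {R} c : simpl never.
Arguments pv {R} w p : simpl never.
(** The substitution T = x w from F[[T]] to F[[z]][[x]]: the outer variable is x, the inner one z is
    a local coordinate on the w-line. *)
Notation dil w := (sub kc w).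

Section Piece.
Variables (F : fieldType) (w w' : fps F).
Hypothesis ww : w * w' = 1.

Lemma expKw D k : (k <= D)%N -> w ^+ D * w' ^+ k = w ^+ (D - k).
Proof.
by move=> le; rewrite -{1}(subnK le) exprD -mulrA -exprMn ww expr1n mulr1.
Qed.
Lemma w'_neq0 k : w' ^+ k != 0.
Proof.
apply: expf_neq0; apply/eqP => w0; move: ww; rewrite w0 mulr0 => /esym/eqP.
by rewrite oner_eq0.
Qed.

(** The set w^D F[w^-1] of Laurent polynomials in w of degree at most D. Exchanging [w] and [w']
    bounds the degree from below instead. *)
Definition inO D (u : fps F) := exists p, u = w ^+ D * pv w' p.
Lemma inO_mono D E u : (D <= E)%N -> inO D u -> inO E u.
Proof.
move=> le [p ->]; exists ('X^(E - D) * p).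
rewrite rmorphM rmorphXn /= pvX mulrA expKw ?leq_subr //; congr (_ ^+ _ * _); lia.
Qed.
Lemma inO0 D : inO D 0. Proof. by exists 0; rewrite rmorph0 mulr0. Qed.
Lemma inOD D u v : inO D u -> inO D v -> inO D (u + v).
Proof. by move=> [p ->] [q ->]; exists (p + q); rewrite rmorphD mulrDr. Qed.
Lemma inOM D E u v : inO D u -> inO E v -> inO (D + E) (u * v).
Proof.
move=> [p ->] [q ->]; exists (p * q); rewrite rmorphM exprD /=; ring.
Qed.
Lemma inO_sum D (I : Type) (r : seq I) (P : pred I) (f : I -> fps F) :
  (forall i, P i -> inO D (f i)) -> inO D (\sum_(i <- r | P i) f i).
Proof. move=> h; apply: big_ind => //; [exact: inO0 | exact: inOD]. Qed.
Lemma inO_w c k : inO k (kc c * w ^+ k).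
Proof. by exists c%:P; rewrite pvC mulrC. Qed.
Lemma inO_w' c k : inO 0 (kc c * w' ^+ k).
Proof. by exists (c%:P * 'X^k); rewrite expr0 mul1r rmorphM rmorphXn /= pvC pvX. Qed.

(** The formal counterpart of functions on the disc |w| >= 1 with a pole of order at most D at
    infinity; one D serves all coefficients. *)
Definition bdd D (v : fps (fps F)) := forall n, inO D (cf v n).
Lemma bdd_mono D E v : (D <= E)%N -> bdd D v -> bdd E v.
Proof. by move=> le h n; apply: inO_mono (h n). Qed.
Lemma bddD D u v : bdd D u -> bdd D v -> bdd D (u + v).
Proof. by move=> hu hv n; apply: inOD. Qed.
Lemma bddM D E u v : bdd D u -> bdd E v -> bdd (D + E) (u * v).
Proof. by move=> hu hv n; rewrite cfM; apply: inO_sum => i _; apply: inOM. Qed.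
Lemma bdd0 D : bdd D 0. Proof. by move=> n; apply: inO0. Qed.
Lemma bdd_dil (p : {poly F}) : bdd (size p) (dil w (p2s p)).
Proof.
move=> n; have [lt|ge] := ltnP n (size p).
  exact: inO_mono (ltnW lt) (inO_w _ _).
by rewrite cf_sub cf_p2s nth_default // rmorph0 mul0r; apply: inO0.
Qed.
Lemma bdd_dil' f : bdd 0 (dil w' f).
Proof. by move=> n; apply: inO_w'. Qed.

Variables (gT : finGroupType) (H : {group gT}) (A : (gT -> fps F) -> Prop).
Hypothesis Aadd : forall a b, A a -> A b -> A (fun g => a g + b g).
Hypothesis Amul : forall a b, A a -> A b -> A (fun g => a g * b g).
Hypothesis Atr : forall a u, u \in H -> A a -> A (fun g => a (u * g)%g).
Hypothesis Apol : forall p, A (fun=> p2s p).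
Hypothesis Arat : forall a c, A a -> (forall g, g \in H -> a g = c) -> ratl c.

(** The cover [A], pulled back along T = x w, over the disc around w = infinity: combinations of the
    functions b(x w) with coefficients in the union of the [bdd D], which do not depend on the point
    h. *)
Inductive pspan : (gT -> fps (fps F)) -> Prop :=
| Span0 a : (forall h, h \in H -> a h = 0) -> pspan a
| SpanS a a' b v D : A b -> bdd D v -> pspan a' ->
    (forall h, h \in H -> a h = v * dil w (b h) + a' h) -> pspan a.

Lemma span_ext a b : (forall h, h \in H -> a h = b h) -> pspan a -> pspan b.
Proof.
move=> e s; case: s e => [a0 h0|a0 a' b0 v D Ab hv s h0] e.
  by apply: Span0 => h Hh; rewrite -e // h0.
by apply: (SpanS Ab hv s) => h Hh; rewrite -e // h0.
Qed.
Lemma span_add a b : pspan a -> pspan b -> pspan (fun h => a h + b h).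
Proof.
move=> sa sb; elim: sa => {a} [a h0|a a' b0 v D Ab hv _ IH h0].
  by apply: span_ext sb => h Hh; rewrite h0 // add0r.
by apply: (SpanS Ab hv IH) => h Hh; rewrite h0 // addrA.
Qed.
Lemma span_scale a b v D : A b -> bdd D v -> pspan a -> pspan (fun h => v * dil w (b h) * a h).
Proof.
move=> Ab hv; elim=> {a} [a h0|a a' b0 v0 D0 Ab0 hv0 _ IH h0].
  by apply: Span0 => h Hh; rewrite h0 // mulr0.
apply: (SpanS (Amul Ab Ab0) (bddM hv hv0) IH) => h Hh; rewrite h0 // rmorphM /=; ring.
Qed.
Lemma span_mul a b : pspan a -> pspan b -> pspan (fun h => a h * b h).
Proof.
move=> sa sb; elim: sa => {a} [a h0|a a' b0 v D Ab hv _ IH h0].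
  by apply: Span0 => h Hh; rewrite h0 // mul0r.
apply: span_ext (span_add (span_scale Ab hv sb) IH) => h Hh; rewrite h0 //; ring.
Qed.
Lemma span1 v D b : A b -> bdd D v -> pspan (fun h => v * dil w (b h)).
Proof.
move=> Ab hv; apply: (SpanS Ab hv (Span0 (a:=fun=> 0) _)) => // h Hh; by rewrite addr0.
Qed.
Lemma span_const v D : bdd D v -> pspan (fun=> v).
Proof.
move=> hv; apply: span_ext (span1 (Apol 1) hv) => h Hh; by rewrite !rmorph1 mulr1.
Qed.
Lemma span_sum (I : Type) (r : seq I) (P : pred I) (f : I -> gT -> fps (fps F)) :
  (forall i, P i -> pspan (f i)) -> pspan (fun h => \sum_(i <- r | P i) f i h).
Proof.
move=> hf; elim: r => [|i r IH]; first by apply: Span0 => h _; rewrite big_nil.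
case Pi: (P i); last by apply: span_ext IH => h _; rewrite big_cons Pi.
by apply: span_ext (span_add (hf i Pi) IH) => h _; rewrite big_cons Pi.
Qed.

Lemma trace_rat f : A f -> ratl (\sum_(h in H) f h).
Proof.
move=> Af; apply: (@Arat (fun k => \sum_(h in H) f (h * k)%g)).
  by apply: cover_sum => // h Hh; apply: Atr.
move=> k Hk; rewrite (reindex_inj (mulIg k^-1%g)) /=.
by apply: eq_big => g; rewrite ?groupMr ?groupV // mulgKV.
Qed.

Variable eps : gT -> fps F.
Hypothesis Aeps : A eps.
Hypothesis heps : forall g, g \in H -> hd (eps g) = (g == 1%g)%:R.

(** Traces of members of [A] are rational in T = x w. The weight [eps] makes the trace of a constant
    c equal to c times a rational function with value 1 at T = 0, whereas the plain trace |H| c may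
    vanish. *)
Lemma span_trace a : pspan a -> exists (e : {poly F}) D, e`_0 = 1 /\
  bdd D (dil w (p2s e) * \sum_(h in H) a h * dil w (eps h)).
Proof.
elim=> {a} [a h0|a a' b v D Ab hv _ [e [E [e0 he]]] h0].
  exists 1, 0%N; rewrite coef1; split=> //; rewrite big1 ?mulr0; first exact: bdd0.
  by move=> h Hh; rewrite h0 ?mul0r.
have [f [p [f0 hf]]] := trace_rat (Amul Ab Aeps).
exists (e * f), (maxn (D + (size e + size p)) (size f + E)); rewrite coef0M e0 f0 mulr1; split=> //.
have -> : dil w (p2s (e * f)) * (\sum_(h in H) a h * dil w (eps h)) =
   v * (dil w (p2s e) * dil w (p2s p)) +
   dil w (p2s f) * (dil w (p2s e) * (\sum_(h in H) a' h * dil w (eps h))).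
  rewrite -hf !rmorphM rmorph_sum /=.
  have -> : \sum_(h in H) a h * dil w (eps h) =
      v * \sum_(h in H) dil w (b h * eps h) + \sum_(h in H) a' h * dil w (eps h).
    rewrite mulr_sumr -big_split; apply: eq_bigr => h Hh; rewrite h0 // rmorphM /=; ring.
  ring.
apply: bddD.
  by apply: bdd_mono (leq_maxl _ _) _; do 2!apply: bddM => //; apply: bdd_dil.
by apply: bdd_mono (leq_maxr _ _) _; apply: bddM => //; apply: bdd_dil.
Qed.
Lemma span_constant a c : pspan a -> (forall h, h \in H -> a h = c) ->
  exists (P : {poly F}) D, P`_0 = 1 /\ bdd D (dil w (p2s P) * c).
Proof.
move=> sa ac; have [e [D [e0 he]]] := span_trace sa.
have [f [p [f0 hf]]] := trace_rat Aeps.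
have p0 : p`_0 = 1.
  rewrite -hd_p2s -hf rmorphM rmorph_sum /= hd_p2s f0 mul1r.
  rewrite (bigD1 1%g) //= heps // eqxx big1 ?addr0 // => h /andP[Hh ne].
  by rewrite heps // (negbTE ne).
exists (e * p), (size f + D)%N; rewrite coef0M e0 p0 mulr1; split=> //.
have -> : dil w (p2s (e * p)) * c =
    dil w (p2s f) * (dil w (p2s e) * \sum_(h in H) a h * dil w (eps h)).
  rewrite !rmorphM /= -hf rmorphM rmorph_sum /=.
  have -> : \sum_(h in H) a h * dil w (eps h) = c * \sum_(h in H) dil w (eps h).
    by rewrite mulr_sumr; apply: eq_bigr => h Hh; rewrite ac.
  ring.
by apply: bddM => //; apply: bdd_dil.
Qed.

Hypothesis Adom : forall a, A a -> a 1%g = 0 -> forall g, g \in H -> a g = 0.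
Hypothesis w'_transc : injective (pv w').

(* Regrading: a monomial [x^i w'^e] is [(x w)^i w'^(e+i)], so collecting powers of [w'] turns a
   combination with coefficients [v] into combinations with coefficients polynomial in [T = x w]. *)
Lemma span_regrade a : pspan a -> exists D (beta : nat -> gT -> fps F),
  (forall e, A (beta e)) /\ forall h n, h \in H -> exists q : {poly F},
    (forall e, q`_e = cf (beta e h) n) /\ cf (a h) n * w' ^+ (n + D) = pv w' q.
Proof.
elim=> {a} [a h0|a a' b v D Ab hv _ [E [beta [Abeta hbeta]]] h0].
  exists 0%N, (fun _ _ => 0); split=> [e|h n Hh]; first exact: cover0.
  by exists 0; split=> [e|]; rewrite ?coef0 // h0 // mul0r rmorph0.
have [p hp] := choice hv.
pose Pe e : {poly F} := \poly_(i < e.+1) (p i)`_(e - i).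
pose sh k e (f : nat -> gT -> fps F) := if (e < k)%N then fun=> 0 else f (e - k)%N.
exists (D + E)%N, (fun e g => sh E e (fun e g => p2s (Pe e) * b g) g + sh D e beta g).
split=> [e|h n Hh].
  apply: Aadd; rewrite /sh; case: ifP => // _; try exact: cover0; exact: Amul.
have [q [hq eq]] := hbeta h n Hh.
exists (\sum_(i < n.+1) p i * 'X^i * (cf (b h) (n - i))%:P * 'X^E + q * 'X^D); split.
  move=> e; rewrite coefD cfD coefMXn /sh; congr (_ + _); last by case: ifP.
  rewrite coef_sum; case: ltnP => [lt|le].
    by rewrite cf0 big1 // => i _; rewrite coefMXn lt.
  rewrite cfM; apply: eq_bigr => i _.
  rewrite coefMXn ltnNge le /= coefMC coefMXn ?cf_p2s coef_poly ltnS.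
  by case: ltnP => //; rewrite ?mul0r.
rewrite h0 // cfD mulrDl cfM rmorphD rmorph_sum /= mulr_suml; congr (_ + _).
  apply: eq_bigr => i _; rewrite hp ?cf_sub !rmorphM !rmorphXn /= !pvX pvC.
  have lein : (i <= n)%N by rewrite -ltnS.
  have -> : w' ^+ (n + (D + E)) = w' ^+ (n - i) * w' ^+ i * w' ^+ D * w' ^+ E.
    by rewrite -!exprD; congr (_ ^+ _); lia.
  transitivity ((w * w') ^+ D * (w * w') ^+ (n - i) *
     (pv w' (p i) * w' ^+ i * kc (cf (b h) (n - i)) * w' ^+ E)); first by rewrite !exprMn; ring.
  by rewrite ww !expr1n !mul1r.
by rewrite rmorphM rmorphXn /= pvX -eq -mulrA -exprD; congr (_ * _ ^+ _); lia.
Qed.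
(** As w' is transcendental over F, a(1) = 0 annihilates the coefficient of each power of w' in the
    regraded form, and the connectedness of [A] applies to every [beta e]. *)
Lemma span_dom a : pspan a -> a 1%g = 0 -> forall h, h \in H -> a h = 0.
Proof.
move=> sa a1 h Hh; have [D [beta [Ab hb]]] := span_regrade sa.
have b1 e : beta e 1%g = 0.
  apply: fpsP => n; have [q [hq eq]] := hb 1%g n (group1 H).
  rewrite a1 cf0 mul0r in eq.
  have q0 : 0 = q by apply: w'_transc; rewrite rmorph0.
  by rewrite -hq -q0 coef0.
apply: fpsP => n; have [q [hq eq]] := hb h n Hh.
have q0 : q = 0 by apply/polyP => e; rewrite hq (Adom (Ab e)) // coef0.
move: eq; rewrite q0 rmorph0 => /eqP; rewrite mulf_eq0 (negbTE (w'_neq0 _)) orbF.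
by move/eqP.
Qed.
End Piece.

Section Flip.
Variable F : fieldType.
(** The reciprocal polynomial X^N p(1/X). *)
Definition flip N (p : {poly F}) : {poly F} := \poly_(j < N.+1) p`_(N - j).
Lemma pv_flip (w w' : fps F) N (p : {poly F}) : w * w' = 1 -> (size p <= N.+1)%N -> w ^+ N * pv w' p = pv w (flip N p).
Proof.
move=> ww sp; rewrite /pv (@horner_coef_wide _ N.+1); last exact: leq_trans (size_poly _ _) sp.
rewrite (@horner_coef_wide _ N.+1 (map_poly kc (flip N p))); last first.
  by apply: leq_trans (size_poly _ _) (size_poly _ _).
rewrite (reindex_inj rev_ord_inj) /= mulr_sumr; apply: eq_bigr => i _.
have le : (i <= N)%N by rewrite -ltnS.
rewrite !coef_map /= coef_poly ltn_ord subSS mulrCA (expKw ww) ?leq_subr //.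
by rewrite subKn.
Qed.

Variables (w w' : fps F).
Hypothesis ww : w * w' = 1.
Lemma transc_inv : injective (pv w) -> injective (pv w').
Proof.
move=> inj p q e; apply/eqP; rewrite -subr_eq0; apply/eqP.
set r := p - q; have r0 : pv w' r = 0 by rewrite rmorphB /= e subrr.
have f0 : flip (size r) r = 0.
  by apply: inj; rewrite -(pv_flip ww) // r0 mulr0 rmorph0.
apply/polyP => i; rewrite coef0; have [lt|ge] := ltnP i (size r); last by rewrite nth_default.
have := congr1 (fun p : {poly F} => p`_(size r - i)) f0.
by rewrite coef_poly ltnS leq_subr subKn ?(ltnW lt) // coef0.
Qed.
Lemma inO_flip E u : inO w' w E u -> exists D, inO w w' D u.
Proof.
have ww' : w' * w = 1 by rewrite mulrC.
move=> [p ->]; exists (size p); exists ('X^E * flip (size p) p).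
rewrite rmorphM rmorphXn /= pvX.
have -> : pv w p = w ^+ size p * (w' ^+ size p * pv w p).
  by rewrite mulrA -exprMn ww expr1n mul1r.
by rewrite (pv_flip ww') //; ring.
Qed.
(** A Laurent polynomial with degrees between -E and D. The bound on the size of q, uniform in u, is
    the point. *)
Lemma inO_both D E u : injective (pv w) -> inO w w' D u -> inO w' w E u ->
  exists2 q : {poly F}, (size q <= (D + E).+1)%N & w ^+ E * u = pv w q.
Proof.
move=> inj [p up] [q uq]; have eq : w ^+ E * u = pv w q.
  by rewrite uq mulrA -exprMn ww expr1n mul1r.
exists q => //; pose N := maxn (size p) (D + E).
have le : (D + E <= N)%N by apply: leq_maxr.
have : 'X^(N - (D + E)) * q = flip N p.
  apply: inj; rewrite rmorphM rmorphXn /= pvX -eq up.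
  rewrite -(pv_flip ww); last by rewrite ltnW // ltnS leq_maxl.
  by rewrite !mulrA -!exprD; congr (_ ^+ _ * _); lia.
move=> h; have : (size (flip N p) <= N.+1)%N by apply: size_poly.
have [->|q0] := eqVneq q 0; first by rewrite size_poly0.
rewrite -h mulrC size_Mmonic ?monicXn // size_polyXn; lia.
Qed.
End Flip.

Section Patch.
Variables (F : fieldType) (gT : finGroupType) (H1 H2 G : {group gT}).
Hypothesis defG : G :=: (H1 <*> H2)%g.
Notation W := (fps (fps F)).

(** The coordinate w = 1 + z of the line is expanded at w = 1, where both w and 1/w are power series
    in z. *)
Definition zz : fps F := p2s ('X + 1%:P).
Definition zi : fps F := zz^-1.
Lemma zz_unit : zz \is a GRing.unit.
Proof. by apply: fps_unit_hd; rewrite hd_p2s coefD coefX coefC add0r. Qed.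
Lemma zzi : zz * zi = 1. Proof. exact: mulrV zz_unit. Qed.
Lemma ziz : zi * zz = 1. Proof. exact: mulVr zz_unit. Qed.
Lemma pv_zz p : pv zz p = p2s (p \Po ('X + 1%:P)).
Proof.
rewrite pvE comp_polyE rmorph_sum; apply: eq_bigr => i _ /=.
by rewrite -mul_polyC rmorphM rmorphXn.
Qed.
Lemma size_comp1 (p : {poly F}) : size (p \Po ('X + 1%:P)) = size p.
Proof. by apply: size_comp_poly2; rewrite size_XaddC. Qed.
Lemma pv_zz_inj : injective (pv zz).
Proof.
move=> p q; rewrite !pv_zz => /p2s_inj/eqP; rewrite -subr_eq0 -comp_polyB => /eqP e.
apply/eqP; rewrite -subr_eq0 -size_poly_eq0 -size_comp1 e; by rewrite size_poly0.
Qed.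
Lemma pv_zi_inj : injective (pv zi).
Proof. exact: transc_inv zzi pv_zz_inj. Qed.

(** The bound N is uniform in n: a series in x over F[z] with bounded degree in z is a polynomial in
    z over F[[x]]. *)
Lemma swap_p2s (V : W) N : (forall n, exists2 r : {poly F}, cf V n = p2s r & (size r <= N)%N) ->
  exists P : {poly (fps F)}, swap V = p2s P.
Proof.
move=> h; exists (\poly_(i < N) cf (swap V) i); apply: fpsP => i; rewrite cf_p2s coef_poly.
case: ltnP => // le; apply: fpsP => n; rewrite cf_swap cf0.
by have [r -> sr] := h n; rewrite cf_p2s nth_default // (leq_trans sr).
Qed.

(** The parts of nonpositive and of positive degree are separated, or of negative and nonnegative
    degree: the vanishing of H^1 of the structure sheaf of the projective line. *)
Lemma zz_split D u : inO zz zi D u -> exists x : fps F * fps F,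
  [/\ u = x.1 + x.2, inO zz zi 0 x.1 & inO zi zz 0 x.2].
Proof.
move=> [p ->]; rewrite pvE mulr_sumr; apply: (big_ind (fun u => exists x : fps F * fps F,
  [/\ u = x.1 + x.2, inO zz zi 0 x.1 & inO zi zz 0 x.2])).
- by exists (0, 0); split; rewrite /= ?addr0 //; apply: inO0.
- move=> u1 u2 [x [-> h1 h2]] [y [-> h3 h4]]; exists (x.1 + y.1, x.2 + y.2).
  by split=> /=; [ring | apply: inOD | apply: inOD].
- move=> i _; have [le|/ltnW gt] := leqP i D.
    exists (0, kc p`_i * zz ^+ (D - i)); split; [|exact: inO0|exact: inO_w'].
    by rewrite /= add0r mulrCA (expKw zzi).
  exists (kc p`_i * zi ^+ (i - D), 0); split; [|exact: inO_w'|exact: inO0].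
  rewrite /= addr0 mulrCA; congr (_ * _); rewrite -{1}(subnKC gt) exprD mulrA.
  by rewrite -exprMn zzi expr1n mul1r.
Qed.

Section Birkhoff.
Variables e1 e2 : gT -> fps F.
Hypothesis he1 : forall g, g \in H1 -> hd (e1 g) = (g == 1%g)%:R.
Hypothesis he2 : forall g, g \in H2 -> hd (e2 g) = (g == 1%g)%:R.

(** Row k is the function [e] on the H-cover, extended by zero to G and moved to the coset k H. The
    matrix is the identity modulo x. *)
Definition blk (H : {group gT}) (w : fps F) (e : gT -> fps F) k g : W :=
  if (k^-1 * g)%g \in H then dil w (e (k^-1 * g)%g) else 0.
Lemma blk0 (H : {group gT}) w e k g : (forall g, g \in H -> hd (e g) = (g == 1%g)%:R) ->
  cf (blk H w e k g) 0 = (k == g)%:R.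
Proof.
move=> he; rewrite /blk; case: ifP => Hk.
  by rewrite cf_sub expr0 mulr1 -[cf _ 0]/(hd _) he // -eq_mulVg1 rmorph_nat.
by case: eqP => // e'; rewrite e' mulVg group1 in Hk.
Qed.

(** Birkhoff factorization for one row: [U1] is holomorphic at w = infinity, [U2] at w = 0. Both
    matrices being 1 modulo x, the coefficient of x^n in U1 - U2 is prescribed by the earlier
    coefficients, and [zz_split] distributes it over the two unknowns. *)
Lemma birkhoff : exists U1 U2 : gT -> W,
  [/\ forall k, bdd zz zi 0 (U1 k), forall k, bdd zi zz 0 (U2 k),
      forall k, cf (U1 k) 0 = (k == 1%g)%:R &
      forall g, g \in G -> \sum_(k in G) U1 k * blk H1 zz e1 k g
                         = \sum_(k in G) U2 k * blk H2 zi e2 k g].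
Proof.
have cspl u : exists x : fps F * fps F, (exists D, inO zz zi D u) ->
    [/\ u = x.1 + x.2, inO zz zi 0 x.1 & inO zi zz 0 x.2].
  case: (pselect (exists D, inO zz zi D u)) => [[D h]|n]; last by exists (0, 0).
  by have [x hx] := zz_split h; exists x.
have [spl hspl] := choice cspl.
pose r (c : nat -> gT -> fps F * fps F) n g := \sum_(i < n) \sum_(k in G)
  ((c i k).2 * cf (blk H2 zi e2 k g) (n - i) - (c i k).1 * cf (blk H1 zz e1 k g) (n - i)).
(* The pair holds the coefficients of x^n in [U1] and [U2]; the minus sign makes their difference
   equal to [r]. *)
pose Phi c n g := if n is 0 then ((g == 1%g)%:R, (g == 1%g)%:R) else
  ((spl (r c n g)).1, - (spl (r c n g)).2).
have [|c hc] := @strong_rec _ Phi (fun=> (0, 0)).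
  move=> c c' [|n] e //; apply: funext => g; rewrite /Phi.
  suff -> : r c n.+1 g = r c' n.+1 g by [].
  by apply: eq_bigr => i _; rewrite e.
pose ok n := forall g, inO zz zi 0 (c n g).1 /\ inO zi zz 0 (c n g).2.
have rL n : (forall i, (i < n)%N -> ok i) -> forall g, exists D, inO zz zi D (r c n g).
  move=> hok g.
  have Lsum (I : Type) (s : seq I) (P : pred I) (f : I -> fps F) :
      (forall i, P i -> exists D, inO zz zi D (f i)) ->
      exists D, inO zz zi D (\sum_(i <- s | P i) f i).
    move=> hf; apply: (big_ind (fun u => exists D, inO zz zi D u)); last exact: hf.
      by exists 0%N; apply: inO0.
    move=> u v [D hD] [E hE]; exists (maxn D E); apply: inOD.
      by apply: (inO_mono zzi) hD; apply: leq_maxl.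
    by apply: (inO_mono zzi) hE; apply: leq_maxr.
  apply: (Lsum) => i _; apply: (Lsum) => k _.
  have [h1 h2] := hok _ (ltn_ord i) k.
  have [D hD] := inO_flip zzi h2.
  exists (D + n)%N; apply: inOD.
    apply: (inO_mono zzi (D := D + 0)); first by lia.
    apply: inOM => //; rewrite /blk; case: ifP => _; last exact: inO0.
    exact: inO_w'.
  rewrite -mulNr; apply: (inO_mono zzi (D := 0 + (n - i))); first by lia.
  apply: inOM; first by have [p ->] := h1; exists (- p); rewrite rmorphN mulrN.
  by rewrite /blk; case: ifP => _; [exact: inO_w | exact: inO0].
have inv n : ok n.
  elim/ltn_ind: n => -[|n] IH g; rewrite hc /=.
    by split; exists (g == 1%g)%:R; rewrite expr0 mul1r rmorph_nat.
  have [_ h1 [p h2]] := hspl _ (rL _ IH g).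
  by split=> //; exists (- p); rewrite h2 rmorphN mulrN.
have eqc n g : (c n.+1 g).1 - (c n.+1 g).2 = r c n.+1 g.
  have [e _ _] := hspl _ (rL n.+1 (fun i _ => inv i) g).
  by rewrite hc /= opprK -e.
exists (fun k => Fps (fun n => (c n k).1)), (fun k => Fps (fun n => (c n k).2)); split.
- by move=> k n; case: (inv n k).
- by move=> k n; case: (inv n k).
- by move=> k /=; rewrite hc.
move=> g Gg; apply: fpsP => n; rewrite !cf_sum.
have top (H : {group gT}) (w : fps F) (e : gT -> fps F) (f : nat -> gT -> fps F) : (forall g, g \in H -> hd (e g) = (g == 1%g)%:R) ->
   \sum_(k in G) cf (Fps (f^~ k) * blk H w e k g) n =
   f n g + \sum_(i < n) \sum_(k in G) f i k * cf (blk H w e k g) (n - i).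
  move=> he; under eq_bigr do rewrite cfM.
  rewrite exchange_big big_ord_recr addrC /=; congr (_ + _); rewrite subnn.
  rewrite (bigD1 g) //= blk0 // eqxx mulr1 big1 ?addr0 // => k /andP[_ ne].
  by rewrite blk0 // (negbTE ne) mulr0.
rewrite (top _ _ _ (fun n k => (c n k).1)) // (top _ _ _ (fun n k => (c n k).2)) //.
case: n {top} => [|n]; first by rewrite !big_ord0 !hc.
apply/eqP; rewrite -subr_eq0 opprD addrACA eqc /r -!sumrB -big_split /= big1 // => i _.
by rewrite -!sumrB -big_split /= big1 // => k _; rewrite subrKA subrr.
Qed.
End Birkhoff.

(** The function given by [birkhoff] is an indicator only modulo x, whereas its residue at z = 0
    must be the indicator of 1 exactly. The convolution matrix of its residues is 1 modulo x, so it
    can be inverted over F[[x]]. *)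
Lemma const_recover (m : gT -> fps F) : (forall g, g \in G -> hd (m g) = (g == 1%g)%:R) ->
  exists c : gT -> fps F, forall g, g \in G ->
    \sum_(k in G) c k * m (k^-1 * g)%g = (g == 1%g)%:R.
Proof.
move=> hm.
pose Phi (c : nat -> gT -> F) n g := ((g == 1%g) && (n == 0))%:R -
  \sum_(i < n) \sum_(k in G) c i k * cf (m (k^-1 * g)%g) (n - i).
have [|c hc] := @strong_rec _ Phi (fun=> 0).
  move=> c c' n e; apply: funext => g; congr (_ - _); apply: eq_bigr => i _.
  by rewrite e.
exists (fun k => Fps (fun n => c n k)) => g Gg; apply: fpsP => n.
rewrite cf_sum; under eq_bigr do rewrite cfM.
rewrite exchange_big big_ord_recr /= subnn.
have -> : \sum_(k in G) c n k * cf (m (k^-1 * g)%g) 0 = c n g.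
  rewrite (bigD1 g) //= mulVg -[cf _ 0]/(hd _) hm // eqxx mulr1 big1 ?addr0 // => k /andP[Gk ne].
  rewrite -[cf _ 0]/(hd _) hm ?groupM ?groupV //.
  by rewrite eq_mulVg1 in ne; rewrite (negbTE ne) mulr0.
rewrite hc /Phi addrC subrK; case: (g == 1%g); rewrite /= ?cf1 //.
Qed.

(** A glued function is a family on G that extends over the disc at w = infinity on each coset of H1
    and over the disc at w = 0 on each coset of H2. Finally [swap] reads F[[z]][[x]] as F[[x]][[z]]:
    the base is F[[x]] and the variable of the new cover is z. *)
Theorem patch : split_cover H1 F -> split_cover H2 F -> split_cover G (fps F).
Proof.
move=> [A1 [add1 mul1 tr1 [pol1 rat1 [e1 Ae1 he1] dom1]]].
move=> [A2 [add2 mul2 tr2 [pol2 rat2 [e2 Ae2 he2] dom2]]].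
have sub1 : H1 \subset G by rewrite defG joing_subl.
have sub2 : H2 \subset G by rewrite defG joing_subr.
pose B (a : gT -> W) := forall k, k \in G -> pspan zz zi H1 A1 (fun h => a (k * h)%g) /\
                                 pspan zi zz H2 A2 (fun h => a (k * h)%g).
have Badd a b : B a -> B b -> B (fun g => a g + b g).
  move=> hA hB k Gk; have [s1 s2] := hA k Gk; have [s3 s4] := hB k Gk.
  by split; apply: span_add.
have Bmul a b : B a -> B b -> B (fun g => a g * b g).
  move=> hA hB k Gk; have [s1 s2] := hA k Gk; have [s3 s4] := hB k Gk.
  by split; [apply: (span_mul mul1) | apply: (span_mul mul2)].
have Bsum (I : Type) (r : seq I) (P : pred I) (f : I -> gT -> W) :
  (forall i, P i -> B (f i)) -> B (fun g => \sum_(i <- r | P i) f i g).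
  by move=> hf k Gk; split; apply: (@span_sum _ _ _ _ _ _ _ r P (fun i h => f i (k * h)%g)) => i Pi;
     case: (hf i Pi k Gk).
have Btr a u : u \in G -> B a -> B (fun g => a (u * g)%g).
  move=> Gu hA k Gk; case: (hA (u * k)%g); first by rewrite groupM.
  by move=> s1 s2; split; [apply: span_ext s1 | apply: span_ext s2] => h _; rewrite mulgA.
have pvO N (q : {poly F}) : (size q <= N)%N -> inO zz zi N (pv zz q).
  move=> sq; rewrite pvE; apply: inO_sum => i _; apply: (inO_mono zzi) (inO_w _ _ _ i).
  exact: leq_trans (ltnW (ltn_ord i)) sq.
have pvO' (q : {poly F}) : inO zi zz 0 (pv zz q) by exists q; rewrite expr0 mul1r.
have pzs (r : {poly F}) : p2s r = pv zz (r \Po ('X - 1%:P)).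
  by rewrite pv_zz -comp_polyA comp_polyB comp_polyX comp_polyC addrK comp_polyXr.
have Bpol (P : {poly (fps F)}) : B (fun=> swap (p2s P)).
  have hc n : cf (swap (p2s P)) n = p2s (\poly_(m < size P) cf P`_m n).
    apply: fpsP => m; rewrite cf_swap !cf_p2s coef_poly; case: ltnP => // le.
    by rewrite nth_default // cf0.
  move=> k Gk; split.
    apply: (span_const _ pol1 (D := size P)) => n; rewrite hc pzs; apply: pvO.
    by rewrite size_comp_poly2 ?size_XsubC // size_poly.
  by apply: (span_const _ pol2 (D := 0%N)) => n; rewrite hc pzs.
exists (fun a' => exists2 a, B a & forall g, a' g = swap (a g)); split; [| | |split].
- move=> a' b' [a Ba ha] [b Bb hb]; exists (fun g => a g + b g); first exact: Badd.
  by move=> g; rewrite ha hb rmorphD.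
- move=> a' b' [a Ba ha] [b Bb hb]; exists (fun g => a g * b g); first exact: Bmul.
  by move=> g; rewrite ha hb rmorphM.
- by move=> a' u Gu [a Ba ha]; exists (fun g => a (u * g)%g); first exact: Btr.
- by move=> P; exists (fun=> swap (p2s P)) => // g; rewrite swapK.
- move=> a' c' [a Ba ha] ac; set c := swap c'.
  have acc g : g \in G -> a g = c by move=> Gg; rewrite /c -(ac g Gg) ha swapK.
  have [s1 s2] := Ba 1%g (group1 G).
  have [|P1 [D1 [P10 b1]]] := span_constant zzi add1 mul1 tr1 pol1 rat1 Ae1 he1 s1 (c := c).
    by move=> h Hh; rewrite mul1g acc // (subsetP sub1).
  have [|P2 [D2 [P20 b2]]] := span_constant ziz add2 mul2 tr2 pol2 rat2 Ae2 he2 s2 (c := c).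
    by move=> h Hh; rewrite mul1g acc // (subsetP sub2).
  (* P1(x w) c has degree in w bounded above, P2(x/w) c has it bounded below. With both denominators
     and w^N as factors, all coefficients in x are polynomials in z of bounded degree. *)
  pose N := (D2 + size P2)%N.
  have topoly (V : W) D : bdd zz zi D V -> bdd zi zz N V ->
      exists P, swap (kc (zz ^+ N) * V) = p2s P.
    move=> h1 h2; apply: (@swap_p2s _ (D + N).+1) => n; rewrite cf_kcM.
    have [q sq ->] := inO_both zzi pv_zz_inj (h1 n) (h2 n).
    by exists (q \Po ('X + 1%:P)); rewrite ?pv_zz ?size_comp1.
  pose d := dil zz (p2s P1) * dil zi (p2s P2).
  have [e he] : exists P, swap (kc (zz ^+ N) * d) = p2s P.
    apply: (topoly _ (size P1 + 0)%N); first exact: bddM (bdd_dil zzi _) (bdd_dil' _ _ _).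
    apply: (bdd_mono ziz) (bddM (bdd_dil' zi zz _) (bdd_dil ziz _)); by rewrite /N; lia.
  have [p hp] : exists P, swap (kc (zz ^+ N) * (d * c)) = p2s P.
    apply: (topoly _ (0 + D1)%N).
      by rewrite /d [_ * dil zi _]mulrC -mulrA; apply: bddM b1; apply: bdd_dil'.
    apply: (bdd_mono ziz) (_ : bdd zi zz (0 + D2) _); first by rewrite /N; lia.
    by rewrite /d -mulrA; apply: bddM b2; apply: bdd_dil'.
  apply: (@rat_unit _ _ e p); last by rewrite -he -hp [in RHS]mulrA [RHS]rmorphM /= /c swapK.
  have -> : e`_0 = hd (swap (kc (zz ^+ N) * d)) by rewrite he hd_p2s.
  apply: fps_unit_hd; rewrite /hd cf_swap cf_kcM /d !cf0M.
  rewrite !expr0 !cf1 /=  P10 P20 !coefC eqxx !mulr1.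
  by rewrite -[cf _ 0]/(hd _) rmorphXn /= hd_p2s coefD coefX coefC add0r expr1n.
- have [U1 [U2 [hU1 hU2 U0 eqU]]] := birkhoff he1 he2.
  pose a g := \sum_(k in G) U1 k * blk H1 zz e1 k g.
  have spb (H : {group gT}) w w' (A : (gT -> fps F) -> Prop) e (U : W) k l : A e ->
     (forall a u, u \in H -> A a -> A (fun g => a (u * g)%g)) -> bdd w w' 0 U ->
     pspan w w' H A (fun h => U * blk H w e k (l * h)%g).
    move=> Ae tr hU; case Hk: ((k^-1 * l)%g \in H).
      apply: span_ext (span1 H (tr _ _ Hk Ae) hU) => h Hh.
      by rewrite /blk mulgA groupMr // Hk.
    by apply: Span0 => h Hh; rewrite /blk mulgA groupMr // Hk mulr0.
  have Ba : B a.
    move=> l Gl; split; first by apply: span_sum => k Gk; apply: spb.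
    apply: (@span_ext _ _ _ _ _ _ (fun h => \sum_(k in G) U2 k * blk H2 zi e2 k (l * h)%g)).
      by move=> h Hh; rewrite /a eqU // groupM // (subsetP sub2).
    by apply: span_sum => k Gk; apply: spb.
  have a0 g : g \in G -> hd (hd (swap (a g))) = (g == 1%g)%:R.
    move=> Gg; rewrite /hd cf_swap /a cf_sum cf_sum (bigD1 1%g) // cf0M U0 eqxx mul1r.
    rewrite blk0 // big1 ?addr0 => [|k /andP[Gk ne]].
      by rewrite /= addr0 eq_sym; case: (g == 1%g).
    by rewrite cf0M U0 (negbTE ne) mul0r cf0.
  have [c hc] := const_recover (m := fun g => hd (swap (a g))) a0.
  pose b g := \sum_(k in G) swap (kc (c k)) * a (k^-1 * g)%g.
  exists (fun g => swap (b g)).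
    exists b => //; apply: Bsum => k Gk; apply: Bmul; first exact: Bpol.
    by apply: Btr; rewrite ?groupV.
  move=> g Gg; rewrite -hc // /b !rmorph_sum; apply: eq_bigr => k _ /=.
  by rewrite !rmorphM /= swapK hd_kc.
- move=> a' [a Ba ha] a'1 g Gg; rewrite ha.
  have a1 : a 1%g = 0 by rewrite -[a _]swapK -ha a'1 rmorph0.
  have step (H : {group gT}) w w' (A : (gT -> fps F) -> Prop) k h :
      (forall b, pspan w w' H A b -> b 1%g = 0 -> forall h, h \in H -> b h = 0) ->
      pspan w w' H A (fun h => a (k * h)%g) -> a k = 0 -> h \in H -> a (k * h)%g = 0.
    by move=> dm sp ak Hh; apply: (dm _ sp _ _ Hh); rewrite mulg1.
  (* The k that carry a zero of [a] from any l to l k form a subgroup. It contains H1 and H2 because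
     the two given covers are connected, so it is G. *)
  pose K := [set k in G | [forall l in G, (a l == 0) ==> (a (l * k)%g == 0)]].
  have gK : group_set K.
    apply/group_setP; split.
      by rewrite inE group1; apply/forall_inP => l Gl; rewrite mulg1 implybb.
    move=> x y; rewrite !inE => /andP[Gx /forall_inP hx] /andP[Gy /forall_inP hy].
    rewrite groupM //; apply/forall_inP => l Gl; apply/implyP => al.
    rewrite mulgA; apply: (implyP (hy _ _)); first by rewrite groupM.
    exact: (implyP (hx _ Gl)).
  have : G \subset Group gK.
    rewrite defG join_subG; apply/andP; split; apply/subsetP => h Hh; rewrite inE.
      rewrite (subsetP sub1) //=; apply/forall_inP => k Gk; apply/implyP => /eqP ak; apply/eqP.
      have [s1 _] := Ba k Gk.
      apply: (step _ _ _ _ _ _ _ s1 ak Hh) => b0 sb b1 h' Hh'.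
      exact: (span_dom zzi add1 mul1 pol1 dom1 pv_zi_inj sb b1 Hh').
    rewrite (subsetP sub2) //=; apply/forall_inP => k Gk; apply/implyP => /eqP ak; apply/eqP.
    have [_ s2] := Ba k Gk.
    apply: (step _ _ _ _ _ _ _ s2 ak Hh) => b0 sb b1 h' Hh'.
    exact: (span_dom ziz add2 mul2 pol2 dom2 pv_zz_inj sb b1 Hh').
  move/subsetP/(_ g Gg); rewrite inE => /andP[_ /forall_inP/(_ 1%g (group1 G))].
  by rewrite a1 eqxx mul1g /= => /eqP ->; rewrite rmorph0.
Qed.
End Patch.

(** A minimal polynomial without a fraction field: by pseudo-division an annihilator of [y i0] of
    least degree divides [p] up to constants, hence splits over B with roots among the [y i], and it
    is of smaller degree than [p]. *)
Lemma min_factor (A B : idomainType) (f : {rmorphism A -> B}) (I : finType) (J : {set I})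
    (y : I -> B) (p r : {poly A}) (i0 : I) :
  injective f -> {in J &, injective y} -> i0 \in J ->
  map_poly f p = \prod_(i in J) ('X - (y i)%:P) ->
  r != 0 -> (size r < size p)%N -> (map_poly f r).[y i0] = 0 ->
  exists (S : {set I}) (c : A) (q : {poly A}),
    [/\ S \proper J, i0 \in S, c != 0 & map_poly f q = (f c)%:P * \prod_(i in S) ('X - (y i)%:P)].
Proof.
move=> injf injy Ji0 hp r0 sr ry.
have f0 := rmorph0 f.
have ex : exists n, `[< exists q : {poly A}, [/\ q != 0, size q = n & (map_poly f q).[y i0] = 0] >].
  by exists (size r); apply/asboolP; exists r.
case: (ex_minnP ex) => n /asboolP[q [q0 sq qy]] min {ex}.
have nq u : (map_poly f u).[y i0] = 0 -> (size u < size q)%N -> u = 0.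
  move=> uy su; apply/eqP/negP => /negP u0.
  have : (n <= size u)%N by apply: min; apply/asboolP; exists u.
  by rewrite -sq leqNgt su.
have le : (size q <= size r)%N by rewrite sq; apply: min; apply/asboolP; exists r.
set P := \prod_(i in J) ('X - (y i)%:P) in hp.
have py : (map_poly f p).[y i0] = 0.
  by rewrite hp /P (bigD1 i0) //= hornerM hornerXsubC subrr mul0r.
have pq : p %% q = 0.
  apply: nq; last by rewrite Pdiv.CommonIdomain.ltn_modpN0.
  have := congr1 (fun u => (map_poly f u).[y i0]) (Pdiv.WeakIdomain.divp_eq p q).
  rewrite rmorphD rmorphM /= -mul_polyC rmorphM /= hornerD !hornerM py qy !mulr0 add0r.
  by move=> <-.
have dv : map_poly f q %| P.
  have := Pdiv.WeakIdomain.divp_eq p q; rewrite pq addr0 => /(congr1 (map_poly f)).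
  rewrite rmorphM /= -mul_polyC rmorphM /= hp map_polyC /= mul_polyC => e.
  have c0 : f (lead_coef q ^+ scalp p q) != 0.
    by rewrite -f0 (inj_eq injf) expf_neq0 // lead_coef_eq0.
  by rewrite -(dvdpZr _ _ c0) e dvdp_mull.
rewrite /P -big_enum in dv.
have [m hm] := dvdp_prod_XsubC dv.
pose s := mask m (enum J).
have us : uniq s by rewrite mask_uniq // enum_uniq.
pose S := [set i in s].
have hS : \prod_(i <- s) ('X - (y i)%:P) = \prod_(i in S) ('X - (y i)%:P).
  by rewrite big_uniq //=; apply: eq_bigl => i; rewrite inE.
have SJ : S \subset J.
  by apply/subsetP => i; rewrite inE => /mem_mask; rewrite mem_enum.
have eq : map_poly f q = (f (lead_coef q))%:P * \prod_(i in S) ('X - (y i)%:P).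
  move/eqpP: hm => [[c1 c2] /= /andP[c10 c20]].
  rewrite -/s hS => e; apply: (@mulfI _ c1%:P); first by rewrite polyC_eq0.
  have := congr1 lead_coef e; rewrite !lead_coefZ lead_coef_map_inj //.
  have -> : lead_coef (\prod_(i in S) ('X - (y i)%:P)) = 1.
    by rewrite -hS lead_coef_prod_XsubC.
  by rewrite mulr1 => h; rewrite !mul_polyC e -h scalerA.
have szP (K : {set I}) : size (\prod_(i in K) ('X - (y i)%:P)) = #|K|.+1.
  by rewrite -big_enum size_prod_XsubC -cardE.
exists S, (lead_coef q), q; split=> //; last by rewrite lead_coef_eq0.
- rewrite properEcard SJ /=.
  have : size q = #|S|.+1.
    rewrite -(size_map_inj_poly injf f0) eq mul_polyC size_scale ?szP //.
    by rewrite -f0 (inj_eq injf) lead_coef_eq0.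
  have : size p = #|J|.+1 by rewrite -(size_map_inj_poly injf f0) hp szP.
  by move: sr le; lia.
- move: qy; rewrite eq hornerM hornerC => /eqP; rewrite mulf_eq0.
  rewrite -f0 (inj_eq injf) lead_coef_eq0 (negbTE q0) /= horner_prod f0 prodf_seq_eq0.
  case/hasP => i _ /andP[Si]; rewrite hornerXsubC subr_eq0 => /eqP e.
  by rewrite (injy _ _ Ji0 _ e) // (subsetP SJ).
Qed.

(** The rational root argument: in lowest terms the denominator divides a power of the numerator. *)
Lemma integral_ratl (F : fieldType) (c : fps F) (d n : {poly F}) : d != 0 ->
  p2s d * c = p2s n -> integralOver (@p2s F) c -> exists q, c = p2s q.
Proof.
move=> d0 dc [P monP rP].
have g0 : gcdp d n != 0 by rewrite gcdp_eq0 negb_and d0.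
pose d' := d %/ gcdp d n; pose n' := n %/ gcdp d n.
have ed : d = d' * gcdp d n by rewrite divpK // dvdp_gcdl.
have en : n = n' * gcdp d n by rewrite divpK // dvdp_gcdr.
have cop : coprimep d' n' by apply: coprimep_div_gcd; rewrite d0.
have dc' : p2s d' * c = p2s n'.
  have g0' : p2s (gcdp d n) != 0 by rewrite -(rmorph0 (@p2s F)) (inj_eq (@p2s_inj F)).
  by apply: (mulIf g0'); rewrite mulrAC -!rmorphM -ed -en /=.
pose m := (size P).-1.
have sP : size P = m.+1 by rewrite prednK // lt0n size_poly_eq0 monic_neq0.
have : \sum_(i < m.+1) P`_i * n' ^+ i * d' ^+ (m - i) = 0.
  apply: (@p2s_inj F); rewrite rmorph0 rmorph_sum /=.
  move/rootP: rP; rewrite (@horner_coef_wide _ m.+1); last by rewrite -sP; apply: size_poly.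
  move/(congr1 (fun u => u * p2s d' ^+ m)); rewrite mul0r => e; rewrite -[RHS]e.
  rewrite mulr_suml; apply: eq_bigr => i _; rewrite coef_map /= !rmorphM !rmorphXn /= -dc' exprMn.
  have -> : p2s d' ^+ m = p2s d' ^+ i * p2s d' ^+ (m - i) by rewrite -exprD subnKC // -ltnS.
  ring.
rewrite big_ord_recr /= subnn expr0 mulr1.
have -> : P`_m = 1 by move/monicP: monP; rewrite lead_coefE.
rewrite mul1r addrC => /eqP; rewrite addr_eq0 => /eqP h.
have dvd : d' %| n' ^+ m.
  rewrite h dvdpNr; apply: (big_ind (fun u => d' %| u)); [exact: dvdp0 | exact: dvdp_add | move=> i _].
  by rewrite -(subnSK (ltn_ord i)) exprS mulrCA dvdp_mulr.
have : size d' == 1%N.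
  by rewrite -dvdp1 -(Gauss_dvdpl _ (coprimep_expr m cop)) mul1r.
move/size_poly1P => [k k0 ek].
exists (k^-1 *: n'); rewrite -mul_polyC rmorphM /= -dc' ek mulrA -rmorphM -polyCM mulVf //.
by rewrite rmorph1 mul1r.
Qed.

Lemma horner_taylor2 (R : comNzRingType) (P : {poly R}) (a h : R) :
  exists r, P.[a + h] = P.[a] + P^`().[a] * h + h ^+ 2 * r.
Proof.
elim/poly_ind: P => [|P c [r hr]].
  by exists 0; rewrite deriv0 !horner0 mul0r mulr0 !addr0.
exists (r * (a + h) + P^`().[a]).
rewrite derivMXaddC !hornerMXaddC hornerD hornerMX hr; ring.
Qed.

(** * Specializing the base ring of a cover *)

Section MapEv.
Variables (R S : comNzRingType) (h : {rmorphism R -> S}).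
Lemma map_p2s (r : {poly {poly R}}) :
  map_poly (fmap h) (map_poly (@p2s R) r) = map_poly (@p2s S) (map_poly (map_poly h) r).
Proof. by apply/polyP => i; rewrite !coef_map /= fmap_p2s. Qed.
Lemma fmap_ev y r : fmap h (ev y r) = ev (fmap h y) (map_poly (map_poly h) r).
Proof. by rewrite /ev -map_p2s horner_map. Qed.
End MapEv.

(** The homomorphism [phi] is not asked to fix a copy of F, which leaves room for a twist by
    Frobenius in characteristic p. *)
Definition specializable (L : idomainType) (F : fieldType) :=
  forall (s : seq L) (rho : L), rho != 0 ->
  exists (S : comNzRingType) (i : {rmorphism S -> L}) (phi : {rmorphism S -> F}),
    [/\ injective i, forall x, x \in s -> exists y, i y = x &
        exists2 r, i r = rho & phi r != 0].

Section Descend.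
Variables (L : idomainType) (F : fieldType) (gT : finGroupType) (G : {group gT}).

Definition allcoef (R : nzRingType) (r : {poly {poly R}}) : seq R :=
  flatten [seq polyseq q | q <- polyseq r].
Lemma allcoefP (R : nzRingType) (r : {poly {poly R}}) j k :
  (r`_j)`_k = 0 \/ (r`_j)`_k \in allcoef r.
Proof.
have [lj|gj] := ltnP j (size r); last by left; rewrite [r`_j]nth_default // coef0.
have [lk|gk] := ltnP k (size r`_j); last by left; rewrite nth_default.
right; apply/flattenP; exists (polyseq r`_j); last exact: mem_nth.
by apply/mapP; exists r`_j => //; apply: mem_nth.
Qed.

(** Should the specialized [p] acquire a factor over a proper subset K of the conjugates, this
    factor would be a polynomial of degree below [D0] in T. Over L the corresponding product has a
    nonzero coefficient in some degree at least [D0]; the product [R0] of these coefficients is the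
    element kept nonzero. *)
Theorem descend : specializable L F -> split_gen G L -> split_gen G F.
Proof.
move=> spec [y [p [py ydist [e e0 act] dom]]].
have [Q hQ] : exists Q : gT -> {poly {poly L}}, forall u, u \in G -> forall g, g \in G ->
    p2s e * y (u * g)%g * ev (y g) p^`() = ev (y g) (Q u).
  have h u : exists Q, u \in G -> forall g, g \in G ->
      p2s e * y (u * g)%g * ev (y g) p^`() = ev (y g) Q.
    case Gu: (u \in G); last by exists 0.
    by have [Q hQ] := act u Gu; exists Q.
  by have [Q hQ] := choice h; exists Q.
pose D0 := size (swapXY p).
pose qS (S : {set gT}) : {poly fps L} := \prod_(g in S) ('X - (y g)%:P).
(* by irreducibility, the factor attached to a proper subset has a coefficient of large degree *)
have [rho hrho] : exists rho : {set gT} -> L, forall S : {set gT}, S \proper G -> 1%g \in S ->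
    rho S != 0 /\ exists j n, (D0 <= n)%N /\ rho S = cf (qS S)`_j n.
  have h (S : {set gT}) : exists r : L, S \proper G -> 1%g \in S ->
      r != 0 /\ exists j n, (D0 <= n)%N /\ r = cf (qS S)`_j n.
    case: (boolP (S \proper G)) => [SG|_]; last by exists 0.
    case S1: (1%g \in S); last by exists 0.
    apply: contrapT => hn.
    have small j n : (D0 <= n)%N -> cf (qS S)`_j n = 0.
      move=> le; apply/eqP/negP => /negP ne; apply: hn; exists (cf (qS S)`_j n) => _ _.
      by split=> //; exists j, n.
    have [q hq] : exists q : {poly {poly L}}, map_poly (@p2s L) q = qS S.
      apply: lift_poly => j; exists (\poly_(n < D0) cf (qS S)`_j n); apply: fpsP => n.
      by rewrite cf_p2s coef_poly; case: ltnP => // /small ->.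
    have sz : size (qS S) = #|S|.+1 by rewrite /qS -big_enum size_prod_XsubC -cardE.
    have q0 : q = 0.
      apply: dom.
        rewrite -(size_map_inj_poly (@p2s_inj L) (rmorph0 _)) hq sz.
        exact: proper_card.
      by rewrite /ev hq /qS (bigD1 1%g) //= hornerM hornerXsubC subrr mul0r.
    by move: sz; rewrite -hq q0 rmorph0 size_poly0.
  by have [rho hr] := choice h; exists rho.
pose R0 := \prod_(S in [pred S : {set gT} | (S \proper G) && (1%g \in S)]) rho S.
have R00 : R0 != 0.
  by apply/prodf_neq0 => S /andP[h1 h2]; case: (hrho S h1 h2).
pose s := allcoef p ++ (e : seq L) ++ flatten [seq allcoef (Q u) | u <- enum G]
  ++ [seq hd (y g) | g <- enum G]
  ++ [seq (hd (y gh.1) - hd (y gh.2))^-1 | gh <- enum [set: gT * gT]].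
have [S [i [phi [iinj hs [r0 ir0 phir0]]]]] := spec s R0 R00.
pose inS x := exists z, i z = x.
have inS0 : inS 0 by exists 0; rewrite rmorph0.
have inSM a b : inS a -> inS b -> inS (a * b).
  by move=> [u <-] [v <-]; exists (u * v); rewrite rmorphM.
have inSp (r : {poly {poly L}}) : (forall x, x \in allcoef r -> x \in s) ->
    exists r' : {poly {poly S}}, map_poly (map_poly i) r' = r.
  move=> h; apply: lift_poly => j; apply: lift_poly => k.
  by have [->|/h/hs] := allcoefP r j k.
have [pS hpS] := inSp p (fun x hx => ltac:(by rewrite mem_cat hx)).
have [eS heS] : exists e', map_poly i e' = e.
  apply: lift_poly => k; have [lk|gk] := ltnP k (size e); last by rewrite nth_default.
  by apply: hs; rewrite !mem_cat mem_nth // orbT.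
have hQS u : exists Q' : {poly {poly S}}, u \in G -> map_poly (map_poly i) Q' = Q u.
  case Gu: (u \in G); last by exists 0.
  have [|Q' hQ'] := inSp (Q u); last by exists Q'.
  move=> x hx; rewrite !mem_cat; suff -> : x \in flatten [seq allcoef (Q u) | u <- enum G] by rewrite !orbT.
  by apply/flattenP; exists (allcoef (Q u)) => //; apply/mapP; exists u; rewrite ?mem_enum.
have [QS hQS'] := choice hQS.
have hdS g : g \in G -> inS (hd (y g)).
  move=> Gg; apply: hs; rewrite !mem_cat.
  suff -> : hd (y g) \in [seq hd (y g) | g <- enum G] by rewrite !orbT.
  by apply/mapP; exists g; rewrite ?mem_enum.
have invS g h : inS (hd (y g) - hd (y h))^-1.
  apply: hs; rewrite !mem_cat.
  suff -> : (hd (y g) - hd (y h))^-1 \in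
    [seq (hd (y gh.1) - hd (y gh.2))^-1 | gh <- enum [set: gT * gT]] by rewrite !orbT.
  by apply/mapP; exists (g, h); rewrite ?mem_enum ?inE.
(* Hensel: the expansion of y has coefficients in S *)
have yS g : g \in G -> forall n, inS (cf (y g) n).
  move=> Gg n; elim/ltn_ind: n => -[|n] IH; first exact: hdS.
  set N := n.+1.
  have [aS haS] : exists aS : {poly S}, map_poly i aS = trunc N (y g).
    by apply: lift_poly => k; rewrite coef_poly; case: ltnP => // lt; apply: IH.
  pose a := p2s (trunc N (y g)); pose c := Fps (fun k => cf (y g) (N + k)).
  have eyg : y g = a + p2s 'X^N * c.
    apply: fpsP => k; rewrite cfD cf_XnM cf_p2s coef_poly.
    by case: ltnP => lt; rewrite ?addr0 // add0r /= subnKC.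
  have [r hr] := horner_taylor2 (map_poly (@p2s L) p) a (p2s 'X^N * c).
  have := congr1 (fun u => cf u N) hr; rewrite -eyg -/(ev (y g) p) (ev_p py Gg) cf0 !cfD.
  rewrite deriv_map -/(ev a p) -/(ev a p^`()).
  have -> : cf ((p2s 'X^N * c) ^+ 2 * r) N = 0.
    by rewrite expr2 -!mulrA cf_XnM ltnn subnn mulrCA cf_XnM.
  rewrite mulrCA cf_XnM ltnn subnn addr0 cf0M.
  have -> : cf (ev a p^`()) 0 = hd (ev (y g) p^`()).
    have hda : hd a = hd (y g).
      by rewrite eyg rmorphD /= /hd cf_XnM addr0.
    rewrite -[LHS]/(hd _) !evE !rmorph_sum; apply: eq_bigr => k _.
    by rewrite !rmorphM !rmorphXn /= hda.
  (* The residue of p'(y g) is a product of differences of residues, whose inverses were put into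
     [s]. *)
  have [v vS vD] : exists2 v, inS v & v * hd (ev (y g) p^`()) = 1.
    rewrite (ev_p_deriv py Gg) rmorph_prod.
    apply: (big_ind (fun u => exists2 v, inS v & v * u = 1)).
    - by exists 1; rewrite ?mulr1 //; exists 1; rewrite rmorph1.
    - move=> u1 u2 [v1 h1 e1] [v2 h2 e2]; exists (v1 * v2); first exact: inSM.
      by rewrite mulrACA e1 e2 mulr1.
    - move=> h /andP[Gh ne]; exists (hd (y g) - hd (y h))^-1 => //.
      by rewrite rmorphB mulVr // ydist // eq_sym.
  move=> /eqP; rewrite eq_sym addrC addr_eq0 => /eqP h.
  have -> : cf (y g) N = - cf (ev a p) N * v.
    by rewrite -h mulrC mulrA vD mul1r /c /= addn0.
  apply: inSM => //.
  have -> : ev a p = fmap i (ev (p2s aS) pS) by rewrite fmap_ev fmap_p2s haS hpS.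
  by exists (- cf (ev (p2s aS) pS) N); rewrite rmorphN.
have hyS g : exists z : fps S, g \in G -> fmap i z = y g.
  case Gg: (g \in G); last by exists 0.
  have [z hz] := choice (yS g Gg).
  by exists (Fps z) => _; apply: fpsP => n; rewrite cf_fmap hz.
have [yy hyy] := choice hyS.
have finj : injective (fmap i) := fmap_inj iinj.
have htS (K : {set gT}) : exists t, K \proper G -> 1%g \in K ->
    i t = rho K /\ exists j n, (D0 <= n)%N /\ t = cf (\prod_(g in K) ('X - (yy g)%:P))`_j n.
  case: (boolP (K \proper G)) => [KG|_]; last by exists 0.
  case K1: (1%g \in K); last by exists 0.
  have [_ [j [n [len hr]]]] := hrho K KG K1.
  exists (cf (\prod_(g in K) ('X - (yy g)%:P))`_j n) => _ _; split; last by exists j, n.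
  have qSS : qS K = map_poly (fmap i) (\prod_(g in K) ('X - (yy g)%:P)).
    rewrite rmorph_prod; apply: eq_bigr => g Kg.
    by rewrite rmorphB /= map_polyX map_polyC /= hyy // (subsetP (proper_sub KG)).
  by rewrite hr qSS coef_map.
have [tS htS'] := choice htS.
have r0E : r0 = \prod_(S in [pred S : {set gT} | (S \proper G) && (1%g \in S)]) tS S.
  apply: iinj; rewrite ir0 rmorph_prod; apply: eq_bigr => K /andP[KG K1].
  by case: (htS' K KG K1).
have pyS : map_poly (@p2s S) pS = \prod_(g in G) ('X - (yy g)%:P).
  apply: (map_inj_poly finj (rmorph0 _)); rewrite map_p2s hpS py rmorph_prod.
  by apply: eq_bigr => g Gg; rewrite rmorphB /= map_polyX map_polyC /= hyy.
pose yF g := fmap phi (yy g).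
pose pF := map_poly (map_poly phi) pS.
have pyF : map_poly (@p2s F) pF = \prod_(g in G) ('X - (yF g)%:P).
  rewrite -map_p2s pyS rmorph_prod; apply: eq_bigr => g Gg.
  by rewrite rmorphB /= map_polyX map_polyC.
have hdi g : g \in G -> i (hd (yy g)) = hd (y g) by move=> Gg; rewrite -hyy.
have ydF g h : g \in G -> h \in G -> g != h -> hd (yF g) - hd (yF h) \is a GRing.unit.
  move=> Gg Gh ne; have [v hv] := invS g h.
  have : v * (hd (yy g) - hd (yy h)) = 1.
    by apply: iinj; rewrite rmorphM rmorphB /= !hdi // hv rmorph1 mulVr // ydist.
  move/(congr1 phi); rewrite rmorphM rmorphB rmorph1 /= => e1.
  by apply/unitrPr; exists (phi v); rewrite mulrC.
exists yF, pF; split=> //.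
- exists (map_poly phi eS).
    rewrite coef_map /=; suff -> : eS`_0 = 1 by rewrite rmorph1.
    by apply: iinj; rewrite rmorph1 -coef_map heS.
  move=> u Gu; exists (map_poly (map_poly phi) (QS u)) => g Gg.
  rewrite -fmap_p2s deriv_map -!fmap_ev.
  have <- : p2s eS * yy (u * g)%g * ev (yy g) pS^`() = ev (yy g) (QS u).
    apply: finj; rewrite !rmorphM /= !fmap_ev fmap_p2s heS -deriv_map hpS hQS' //.
    by rewrite !hyy ?groupM // hQ.
  by rewrite !rmorphM.
move=> r sr r1; apply/eqP/negP => /negP rn0.
have yinj : {in (G : {set gT}) &, injective yF} by exact: (y_inj ydF).
have sp : size pF = #|G|.+1 by apply: (size_p pyF).
have srp : (size r < size pF)%N by rewrite sp ltnS.
have [K [c [q [KG K1 c0 hq]]]] := min_factor (@p2s_inj F) yinj (group1 G) pyF rn0 srp r1.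
pose qF := \prod_(g in K) ('X - (yF g)%:P).
have KsG : K \subset G := proper_sub KG.
have yint g : g \in G -> integralOver (@p2s F) (yF g).
  by move=> Gg; exists pF; [exact: (p_monic pyF) | rewrite /root -/(ev _ _) (ev_p pyF Gg)].
have qint (T : {set gT}) : T \subset G ->
    forall j, integralOver (@p2s F) (\prod_(g in T) ('X - (yF g)%:P))`_j.
  move=> TG; apply: (big_ind (fun P : {poly fps F} => forall j, integralOver (@p2s F) P`_j)).
  - by move=> j; rewrite coef1; apply: integral_nat.
  - move=> P1 P2 h1 h2 j; rewrite coefM; apply: big_ind => [||k _]; first exact: integral0.
      by move=> ? ?; apply: integral_add.
    exact: integral_mul.
  - move=> g Tg j; rewrite coefB coefX coefC; apply: integral_sub; first exact: integral_nat.
    by case: eqP => _; [apply: yint; apply: (subsetP TG) | exact: integral0].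
(* The coefficients of [qF] are rational by [hq] and integral because its roots are roots of the
   monic [pF]. *)
have [qq hqq] : exists q' : {poly {poly F}}, map_poly (@p2s F) q' = qF.
  apply: lift_poly => j.
  have [|q' ->] := integral_ratl c0 (n := q`_j) _ (qint K KsG j); last by exists q'.
  have := congr1 (fun P : {poly fps F} => P`_j) hq.
  by rewrite coef_map coefCM.
have splitP : map_poly (@p2s F) pF = (\prod_(g in G :\: K) ('X - (yF g)%:P)) * qF.
  rewrite pyF (big_setID K) /= (setIidPr KsG) mulrC.
  by [].
have szq : size qF = #|K|.+1 by rewrite /qF -big_enum size_prod_XsubC -cardE.
have qF0 : qF != 0 by rewrite -size_poly_eq0 szq.
have [A hA] : exists A : {poly {poly F}}, pF = A * qq.
  have mq : qq \is monic.
    have : lead_coef qF = 1 by rewrite /qF -big_enum lead_coef_prod_XsubC.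
    rewrite -hqq lead_coef_map_inj ?rmorph0 //; last exact: p2s_inj.
    by move=> h; apply/monicP/(@p2s_inj F); rewrite h rmorph1.
  exists (Pdiv.Ring.rdivp pF qq).
  have e1 := Pdiv.RingMonic.rdivp_eq mq pF.
  rewrite {1}e1; set B := Pdiv.Ring.rmodp pF qq; suff -> : B = 0 by rewrite addr0.
  have sB : (size B < size qq)%N by rewrite Pdiv.Ring.ltn_rmodp monic_neq0.
  have e2 : (\prod_(g in G :\: K) ('X - (yF g)%:P) - map_poly (@p2s F) (Pdiv.Ring.rdivp pF qq)) * qF
     = map_poly (@p2s F) B.
    by rewrite mulrBl -splitP {1}e1 rmorphD rmorphM /= hqq addrAC subrr add0r.
  apply/eqP/negP => /negP B0.
  set D := (_ - _) in e2.
  have D0' : D != 0.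
    apply/eqP => Dz; move: e2; rewrite Dz mul0r => /esym/eqP.
    by rewrite -(rmorph0 (map_poly (@p2s F))) (inj_eq (map_inj_poly (@p2s_inj F) (rmorph0 _))) (negbTE B0).
  have := congr1 (fun P : {poly fps F} => size P) e2.
  rewrite size_mul // (size_map_inj_poly (@p2s_inj F) (rmorph0 _)) => e3.
  have : size qq = size qF by rewrite -hqq (size_map_inj_poly (@p2s_inj F) (rmorph0 _)).
  have : (0 < size D)%N by rewrite lt0n size_poly_eq0.
  move=> h1 h2; move: sB; rewrite -e3 h2; case: (size D) h1 => // m _.
  by rewrite addSn /= ltnNge leq_addl.
have pF0 : pF != 0 by rewrite -size_poly_eq0 sp.
have A0 : A != 0 by apply: contra_neq pF0 => A0; rewrite hA A0 mul0r.
have qq0 : qq != 0 by apply: contra_neq pF0 => q0; rewrite hA q0 mulr0.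
have szX : (size (swapXY qq) <= D0)%N.
  apply: (@leq_trans (size (swapXY pF))).
    rewrite hA rmorphM /= size_mul ?swapXY_eq0 //.
    have : (0 < size (swapXY A))%N by rewrite lt0n size_poly_eq0 swapXY_eq0.
    by case: (size (swapXY A)) => // m _; rewrite addSn /= leq_addl.
  apply/leq_sizeP => n le; apply/polyP => j; rewrite coef_swapXY coef0 !coef_map /=.
  suff -> : (pS`_j)`_n = 0 by rewrite rmorph0.
  apply: iinj; rewrite rmorph0; have := congr1 (fun P : {poly {poly L}} => (P`_j)`_n) hpS.
  rewrite !coef_map /= => ->.
  by rewrite -coef_swapXY [(swapXY p)`_n]nth_default // coef0.
(* The coefficient kept nonzero by [phi] lies beyond the degree of [qq] in T. *)
have [_ [j [n [len ht]]]] := htS' K KG K1.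
have qFS : qF = map_poly (fmap phi) (\prod_(g in K) ('X - (yy g)%:P)).
  by rewrite rmorph_prod; apply: eq_bigr => g Kg; rewrite rmorphB /= map_polyX map_polyC.
have pt : phi (tS K) = 0.
  have -> : phi (tS K) = cf qF`_j n by rewrite ht qFS coef_map.
  rewrite -hqq coef_map cf_p2s -coef_swapXY [(swapXY qq)`_n]nth_default ?coef0 //.
  exact: leq_trans szX len.
move: phir0; rewrite r0E (bigD1 K) /=; last by rewrite inE KG K1.
by rewrite rmorphM /= pt mul0r eqxx.
Qed.
End Descend.

(** * Points on curves over an ample field *)

Section IndepBasis.
Variables (F : fieldType) (R : nzRingType) (e : {rmorphism F -> R}).
Definition comb (l : nat -> F) (bs : seq R) := \sum_(i < size bs) e (l i) * bs`_i.
Definition indep bs := forall l, comb l bs = 0 -> forall i, (i < size bs)%N -> l i = 0.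
Lemma comb_cons l b bs : comb l (b :: bs) = e (l 0%N) * b + comb (fun i => l i.+1) bs.
Proof. by rewrite /comb /= big_ord_recl. Qed.
Lemma combZ c l bs : e c * comb l bs = comb (fun i => c * l i) bs.
Proof. by rewrite /comb mulr_sumr; apply: eq_bigr => i _; rewrite rmorphM mulrA. Qed.
(** Used to break a relation with coefficients in R into relations over F, one per coordinate. The
    clause on [co 0] lets the coordinates of a polynomial vanish beyond its size. *)
Lemma indep_basis (cs : seq R) : exists bs (co : R -> nat -> F),
  [/\ indep bs, forall c, c \in cs -> c = comb (co c) bs & forall i, co 0 i = 0].
Proof.
suff [bs [hi hc]] : exists bs, indep bs /\ forall c, c \in cs -> exists l, c = comb l bs.
  have h c : exists l, (c \in cs -> c = comb l bs) /\ (c = 0 -> forall i, l i = 0).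
    have [->|c0] := eqVneq c 0.
      by exists (fun=> 0); split=> // _; rewrite /comb big1 // => i _; rewrite rmorph0 mul0r.
    case cc: (c \in cs); last by exists (fun=> 0).
    by have [l hl] := hc c cc; exists l; split=> // c0'; rewrite c0' eqxx in c0.
  have [co hco] := choice h; exists bs, co; split=> //.
    by move=> c /(hco c).1.
  exact: (hco 0).2.
elim: cs => [|c cs [bs [hi hc]]]; first by exists [::]; split.
case: (pselect (exists l, c = comb l bs)) => [hl|nl].
  by exists bs; split=> // d; rewrite inE => /predU1P[->|/hc].
exists (c :: bs); split.
  move=> l; rewrite comb_cons => h.
  have [l0|l0] := eqVneq (l 0%N) 0.
    rewrite l0 rmorph0 mul0r add0r in h; case=> [|i] //= lt.
    exact: hi h i lt.
  case: nl; exists (fun i => - (l 0%N)^-1 * l i.+1).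
  rewrite -combZ; move/eqP: h; rewrite addrC addr_eq0 => /eqP ->.
  by rewrite mulrN rmorphN mulNr opprK mulrA -rmorphM mulVf // rmorph1 mul1r.
move=> d; rewrite inE => /predU1P[->|/hc[l ->]].
  exists (fun i => (i == 0)%:R); rewrite comb_cons /= rmorph1 mul1r /comb big1 ?addr0 // => i _.
  by rewrite rmorph0 mul0r.
exists (fun i => if i is j.+1 then l j else 0).
by rewrite comb_cons rmorph0 mul0r add0r.
Qed.
End IndepBasis.

(** Taylor expansion at the truncation of order n turns the vanishing of the n-th coefficient into a
    linear equation for [c n] with slope P'(0) modulo the variable. *)
Lemma hensel (F : fieldType) (P : {poly fps F}) : hd P.[0] = 0 -> hd P^`().[0] != 0 ->
  exists2 xi, hd xi = 0 & P.[xi] = 0.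
Proof.
move=> P0 P1; pose tr n (c : nat -> F) : fps F := p2s (\poly_(i < n) c i).
pose Phi (c : nat -> F) n := if n is 0 then 0 else - cf P.[tr n c] n / hd P^`().[0].
have [|c hc] := @strong_rec _ Phi 0.
  move=> c c' [|n] e //=; suff -> : tr n.+1 c = tr n.+1 c' by [].
  by congr p2s; apply/polyP => i; rewrite !coef_poly; case: ltnP => // /e.
exists (Fps c); first by rewrite /hd /= hc.
have hx : hd (Fps c) = 0 by rewrite /hd /= hc.
have hdev (Q : {poly fps F}) (a : fps F) : hd a = 0 -> hd Q.[a] = hd Q.[0].
  by move=> a0; rewrite -!horner_map /= a0 rmorph0.
apply: fpsP => -[|n]; first by rewrite -[LHS]/(hd _) hdev // P0.
set N := n.+1; pose d := Fps (fun k => c (N + k)%N).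
have e : Fps c = tr N c + p2s 'X^N * d.
  apply: fpsP => k; rewrite cfD cf_XnM cf_p2s coef_poly.
  by case: ltnP => lt; rewrite ?addr0 // add0r /= subnKC.
have [r hr] := horner_taylor2 P (tr N c) (p2s 'X^N * d).
rewrite e hr !cfD expr2 -!mulrA.
have -> : cf (p2s 'X^N * (d * (p2s 'X^N * (d * r)))) N = 0.
  by rewrite cf_XnM ltnn subnn mulrCA cf_XnM.
rewrite mulrCA cf_XnM ltnn subnn addr0 cf0M -[cf _^`().[_] 0]/(hd _).
rewrite hdev; last by rewrite hd_p2s coef_poly /= hc.
by rewrite /= addn0 hc /= mulrCA mulfV // mulr1 subrr.
Qed.

Lemma poly_roots_list (F : fieldType) (p : {poly F}) : p != 0 ->
  exists s : seq F, forall x, p.[x] = 0 -> x \in s.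
Proof.
move: {2}(size p) (leqnn (size p)) => n; elim: n p => [|n IH] p.
  by rewrite leqn0 size_poly_eq0 => ->.
move=> sp p0; case: (pselect (exists x, p.[x] = 0)) => [[x px]|nx]; last first.
  by exists [::] => x px; case: nx; exists x.
have /factor_theorem[q eq] : root p x by apply/eqP.
have q0 : q != 0 by apply: contra_neq p0 => q0; rewrite eq q0 mul0r.
have [|s hs] := IH q _ q0.
  move: sp; rewrite eq size_mul ?polyXsubC_eq0 // size_XsubC addn2 /=; exact.
exists (x :: s) => y; rewrite eq hornerM hornerXsubC => /eqP; rewrite mulf_eq0 inE subr_eq0.
by case/orP => [/eqP/hs ->|->]; rewrite ?orbT.
Qed.

Section Gauss.
Variable F : fieldType.
Implicit Types (h q H : {poly {poly F}}) (c d : {poly F}).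
Definition primitive_poly h := forall d, (forall j, d %| h`_j) -> (size d <= 1)%N.
Lemma irred_factor c : (1 < size c)%N -> exists2 d, irreducible_poly d & d %| c.
Proof.
move: {2}(size c) (leqnn (size c)) => n; elim: n c => [|n IH] c; first by rewrite leqn0 => /eqP ->.
move=> sc c1; case: (pselect (irreducible_poly c)) => [ic|ni]; first by exists c.
have [d [sd dc nd]] : exists d, [/\ size d != 1%N, d %| c & ~~ (d %= c)].
  apply: contrapT => h; apply: ni; split=> // d sd dc.
  by apply/negP => /negP nd; apply: h; exists d.
have c0 : c != 0 by rewrite -size_poly_eq0 -lt0n ltnW.
have d0 : d != 0 by apply: contraTneq dc => ->; rewrite dvd0p.
have sdc : (size d < size c)%N.
  rewrite ltn_neqAle dvdp_leq // andbT; apply: contra nd => e.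
  by rewrite -dvdp_size_eqp.
have [||u iu ud] := IH d; [by rewrite -ltnS; apply: leq_trans sdc sc| |by exists u => //; apply: dvdp_trans dc].
by rewrite ltn_neqAle eq_sym sd lt0n size_poly_eq0.
Qed.
Lemma irred_prime d c c' : irreducible_poly d -> d %| c * c' -> d %| c \/ d %| c'.
Proof.
move=> id dv; have [|nd] := boolP (d %| c); first by left.
right; have cop : coprimep d c.
  rewrite coprimep_def; apply/negP => /negP sg.
  have := id.2 _ sg (dvdp_gcdl d c) => e.
  by move: nd; rewrite -(eqp_dvdl _ e) dvdp_gcdr.
by rewrite -(Gauss_dvdpr _ cop).
Qed.
Lemma irred_dvd_prod d q h : irreducible_poly d ->
  (forall n, d %| (q * h)`_n) -> (exists j, ~~ (d %| h`_j)) -> forall i, d %| q`_i.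
Proof.
move=> id dv [j0 hj0]; apply: contrapT => /existsNP[i0 hi0].
have ex : exists j, ~~ (d %| h`_j) by exists j0.
have ex' : exists i, ~~ (d %| q`_i) by exists i0; apply/negP.
case: (ex_minnP ex) => j hj minj; case: (ex_minnP ex') => i hi mini.
have := dv (i + j)%N; rewrite coefM.
have lt : (i < (i + j).+1)%N by rewrite ltnS leq_addr.
rewrite (bigD1 (Ordinal lt)) //= addKn => dvs.
have dvr : d %| \sum_(k < (i + j).+1 | k != Ordinal lt) q`_k * h`_(i + j - k).
  apply: (big_ind (fun u => d %| u)); [exact: dvdp0|exact: dvdp_add|].
  move=> k; rewrite -val_eqE /= neq_ltn => /orP[lk|lk].
    apply: dvdp_mulr; apply: contraTT lk => n; rewrite -leqNgt; exact: mini.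
  apply: dvdp_mull; apply: contraTT lk => n; rewrite -leqNgt.
  by have := minj _ n; have := ltn_ord k; lia.
by move: dvs; rewrite dvdp_addl // => /(irred_prime id)[]; apply/negP.
Qed.
(** Gauss's lemma: an irreducible factor of c divides all coefficients of q h, hence those of q as h
    is primitive, and can be cancelled; the degree of c drops. *)
Lemma gauss_dvd h H : primitive_poly h -> forall c q, c != 0 -> c%:P * H = q * h ->
  exists q', H = q' * h.
Proof.
move=> ph c; move: {2}(size c) (leqnn (size c)) => n; elim: n c => [|n IH] c sc q c0 e.
  by move: sc; rewrite leqn0 size_poly_eq0 (negbTE c0).
have [c1|c1] := leqP (size c) 1.
  have [k k0 ck] : exists2 k, k != 0 & c = k%:P.
    by apply/size_poly1P; rewrite eqn_leq c1 lt0n size_poly_eq0.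
  exists ((k^-1)%:P%:P * q); rewrite -mulrA -e ck mulrA -!polyCM mulVf //.
  by rewrite mul1r.
have [d id dc] := irred_factor c1.
have d1 : (1 < size d)%N := id.1.
have d0 : d != 0 by rewrite -size_poly_eq0 -lt0n ltnW.
have dq : forall i, d %| q`_i.
  apply: (irred_dvd_prod (h := h) id) => [i|].
    by rewrite -e coefCM dvdp_mulr.
  apply: contrapT => hn; move: d1; rewrite ltnNge ph // => j.
  by apply/negP => /negP hj; apply: hn; exists j.
pose q' := map_poly (fun u => u %/ d) q.
have eq' : q = d%:P * q'.
  by apply/polyP => i; rewrite coefCM coef_map_id0 ?div0p // mulrC divpK.
have ec : c = d * (c %/ d) by rewrite mulrC divpK.
have c'0 : c %/ d != 0 by apply: contra_neq c0 => z; rewrite ec z mulr0.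
apply: (IH (c %/ d) _ q' c'0); last first.
  apply: (@mulfI _ d%:P); first by rewrite polyC_eq0.
  by rewrite !mulrA -polyCM -ec e eq'.
rewrite -ltnS; apply: leq_trans sc; rewrite size_divp //.
by case: (size d) d1 => [|[|m]] // _; case: (size c) c1 => [|m'] // _; lia.
Qed.
End Gauss.

Lemma hd_ev0 (R : comNzRingType) (y : fps R) (r : {poly {poly R}}) :
  hd y = 0 -> hd (ev y r) = (r`_0)`_0.
Proof.
move=> y0; rewrite /ev -horner_map /= y0 horner_coef0 !coef_map /=; exact: hd_p2s.
Qed.

Lemma evCM (R : comNzRingType) (y : fps R) c r : ev y (c%:P * r) = p2s c * ev y r.
Proof. by rewrite rmorphM /= evC. Qed.

Lemma size_cofactor a b n : (0 < a)%N -> (a + b).-1 = n -> (n <= a)%N -> (b <= 1)%N.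
Proof. by move=> *; lia. Qed.
Lemma size_cofactor_ge a b n : (0 < b)%N -> (a + b).-1 = n -> (a <= n)%N.
Proof. by move=> *; lia. Qed.

Section SmoothFactor.
Variables (F : fieldType) (H : {poly {poly F}}).
Hypotheses (H00 : (H`_0)`_0 = 0) (H10 : (H`_1)`_0 != 0).

Section LinearDisjoint.
Variables (xi : fps F) (n m : nat).
Hypothesis hn : forall g : {poly {poly F}}, g != 0 -> ev xi g = 0 -> (n <= size g)%N.
Hypothesis hm : forall g : {poly {poly F}}, g != 0 -> ev xi g = 0 -> size g = n ->
  (m <= size (swapXY g))%N.
Variables (E : fieldType) (e : {rmorphism F -> E}).
(** Since [xi] has coefficients in F, the coordinates of [g] along an F-independent family each
    annihilate [xi]. One of them is nonzero, and its degrees in both variables are at most those of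
    [g]. *)
Lemma base_change_min (g : {poly {poly E}}) : g != 0 -> ev (fmap e xi) g = 0 ->
  (n <= size g)%N /\ ((size g <= n)%N -> (m <= size (swapXY g))%N).
Proof.
move=> g0 gxi.
have [bs [co [hi hc co0]]] := indep_basis e (allcoef g).
have hc' j k : (g`_j)`_k = comb e (co (g`_j)`_k) bs.
  have [z|/hc//] := allcoefP g j k.
  by rewrite z /comb big1 // => i _; rewrite co0 rmorph0 mul0r.
pose gl l : {poly {poly F}} := \poly_(j < size g) \poly_(k < size g`_j) co (g`_j)`_k l.
have glE l j k : ((gl l)`_j)`_k = co (g`_j)`_k l.
  rewrite coef_poly; case: ltnP => lj; last by rewrite coef0 [g`_j]nth_default // coef0 co0.
  by rewrite coef_poly; case: ltnP => lk //; rewrite [g`_j`_k]nth_default // co0.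
have gE : g = \sum_(l < size bs) (bs`_l)%:P%:P * map_poly (map_poly e) (gl l).
  apply/polyP => j; apply/polyP => k; rewrite coef_sum coef_sum hc' /comb.
  by apply: eq_bigr => l _; rewrite !coefCM !coef_map /= glE mulrC.
have glxi l : (l < size bs)%N -> ev xi (gl l) = 0.
  move=> ll; apply: fpsP => i; rewrite cf0.
  apply: (hi (fun l => cf (ev xi (gl l)) i) _ l ll).
  have := congr1 (fun u => cf u i) gxi; rewrite {1}gE rmorph_sum cf_sum cf0 => <-.
  apply: eq_bigr => l' _; rewrite /= evCM -fmap_ev cf_CM cf_fmap.
  by rewrite mulrC.
have [l [ll gl0]] : exists l, (l < size bs)%N /\ gl l != 0.
  apply: contrapT => h; move/eqP: g0; apply; apply/polyP => j; apply/polyP => k.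
  rewrite !coef0 hc' /comb big1 // => l _; rewrite -glE.
  suff -> : gl l = 0 by rewrite !coef0 rmorph0 mul0r.
  by apply/eqP/negP => /negP ne; apply: h; exists l.
have sg : (size (gl l) <= size g)%N by apply: size_poly.
have n1 := hn gl0 (glxi _ ll).
split=> [|sn]; first exact: leq_trans sg.
apply: leq_trans (hm gl0 (glxi _ ll) _) _; first by apply/eqP; rewrite eqn_leq n1 (leq_trans sg).
apply/leq_sizeP => k lk; apply/polyP => j; rewrite coef_swapXY glE coef0.
by rewrite -coef_swapXY [(swapXY g)`_k]nth_default // coef0 co0.
Qed.
End LinearDisjoint.

(** The branch of H at the origin is a series [xi] over F; [h] annihilates it with least degree in
    Y, then in X. Over any extension, a factor of [h] that kills [xi] still has both degrees at
    least as large, so its cofactor is constant: a smooth rational point makes its component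
    absolutely irreducible. *)
Lemma smooth_factor : exists h q : {poly {poly F}},
  [/\ H = q * h, abs_irreducible2 h, (h`_0)`_0 = 0, (h`_1)`_0 != 0 & primitive_poly h].
Proof.
have [||xi xi0 Hxi] := hensel (P := map_poly (@p2s F) H).
- by rewrite horner_coef0 coef_map /= hd_p2s.
- by rewrite horner_coef0 coef_deriv coef_map /= mulr1n hd_p2s.
have H0 : H != 0 by apply: contraNneq H10 => ->; rewrite !coef0.
have ex1 : exists n, `[< exists g : {poly {poly F}}, [/\ g != 0, size g = n & ev xi g = 0] >].
  by exists (size H); apply/asboolP; exists H.
case: (ex_minnP ex1) => n /asboolP[g1 [g10 sg1 g1xi]] minn.
have hn (g : {poly {poly F}}) : g != 0 -> ev xi g = 0 -> (n <= size g)%N.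
  by move=> g0 gx; apply: minn; apply/asboolP; exists g.
have ex2 : exists m, `[< exists g : {poly {poly F}},
    [/\ g != 0, size g = n, ev xi g = 0 & size (swapXY g) = m] >].
  by exists (size (swapXY g1)); apply/asboolP; exists g1.
case: (ex_minnP ex2) => m /asboolP[h [h0 sh hxi sYh]] minm.
have hm (g : {poly {poly F}}) : g != 0 -> ev xi g = 0 -> size g = n -> (m <= size (swapXY g))%N.
  by move=> g0 gx sg; apply: minm; apply/asboolP; exists g.
have prim : primitive_poly h.
  move=> d dv; rewrite leqNgt; apply/negP => d1.
  have d0 : d != 0 by rewrite -size_poly_eq0 -lt0n ltnW.
  pose h' := map_poly (fun u => u %/ d) h.
  have eh : h = d%:P * h'.
    by apply/polyP => i; rewrite coefCM coef_map_id0 ?div0p // mulrC divpK.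
  have h'0 : h' != 0 by apply: contra_neq h0 => z; rewrite eh z mulr0.
  have h'x : ev xi h' = 0.
    move/eqP: hxi; rewrite eh rmorphM /= evC mulf_eq0 => /orP[|/eqP//].
    by rewrite -(rmorph0 (@p2s F)) (inj_eq (@p2s_inj F)) (negbTE d0).
  have sh' : size h' = n by rewrite -sh eh mul_polyC size_scale.
  have := hm h' h'0 h'x sh'; rewrite -sYh eh rmorphM /= swapXY_polyC.
  rewrite size_mul ?swapXY_eq0 ?map_polyC_eq0 // size_map_polyC.
  have : (0 < size (swapXY h'))%N by rewrite lt0n size_poly_eq0 swapXY_eq0.
  case: (size d) d1 => [|[|k]] // _; case: (size (swapXY h')) => // k' _.
  by lia.
have [q Hq] : exists q, H = q * h.
  have e1 := Pdiv.WeakIdomain.divp_eq H h.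
  have r0 : H %% h = 0.
    apply/eqP/negP => /negP r0; have := hn _ r0.
    have -> : ev xi (H %% h) = 0.
      have := congr1 (ev xi) e1; rewrite rmorphD rmorphM /= hxi mulr0 add0r => <-.
      by rewrite -mul_polyC rmorphM /= [ev xi H]Hxi mulr0.
    by move/(_ erefl); rewrite -sh leqNgt Pdiv.CommonIdomain.ltn_modpN0.
  rewrite r0 addr0 -mul_polyC in e1.
  by apply: (gauss_dvd prim _ e1); rewrite expf_neq0 // lead_coef_eq0.
have h00 : (h`_0)`_0 = 0 by rewrite -(hd_ev0 h xi0) hxi rmorph0.
exists h, q; split=> //; last first.
  apply: contraNneq H10 => z; rewrite Hq coefM !big_ord_recr big_ord0 /= add0r subn0 subnn.
  by rewrite coefD !coef0M z h00 !mulr0 addr0.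
move=> E e fE.
have fE0 : fE != 0.
  by rewrite -(rmorph0 (map_poly (map_poly e))) (inj_eq (map_inj_poly (map_inj_poly (fmorph_inj e) (rmorph0 _)) (rmorph0 _))).
have fEx : ev (fmap e xi) fE = 0 by rewrite /fE -fmap_ev hxi rmorph0.
have szE : size fE = n.
  by rewrite (size_map_inj_poly (map_inj_poly (fmorph_inj e) (rmorph0 _)) (rmorph0 _)).
have szYE : (size (swapXY fE) <= m)%N.
  apply/leq_sizeP => k lk; apply/polyP => j; rewrite coef_swapXY !coef_map coef0 /=.
  by rewrite -coef_swapXY [(swapXY h)`_k]nth_default ?sYh // coef0 rmorph0.
have key (g g' : {poly {poly E}}) : fE = g * g' -> ev (fmap e xi) g = 0 -> g' \is a GRing.unit.
  move=> eg gx.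
  have g0 : g != 0 by apply: contra_neq fE0 => z; rewrite eg z mul0r.
  have g'0 : g' != 0 by apply: contra_neq fE0 => z; rewrite eg z mulr0.
  have [n1 m1] := base_change_min hn hm g0 gx.
  have s1 : (size g' <= 1)%N.
    apply: (@size_cofactor (size g) _ n) => //; first by rewrite lt0n size_poly_eq0.
    by rewrite -szE eg size_mul.
  have sg : (size g <= n)%N.
    apply: (@size_cofactor_ge _ (size g')); first by rewrite lt0n size_poly_eq0.
    by rewrite -szE eg size_mul.
  have s2 : (size (swapXY g') <= 1)%N.
    apply: (@size_cofactor (size (swapXY g)) _ (size (swapXY fE))).
    - by rewrite lt0n size_poly_eq0 swapXY_eq0.
    - by rewrite eg rmorphM /= size_mul ?swapXY_eq0.
    - exact: leq_trans szYE (m1 sg).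
  have eg1 : g' = (g'`_0)%:P := size1_polyC s1.
  have sw : swapXY g' = map_poly polyC (g'`_0) by rewrite {1}eg1 swapXY_polyC.
  have s3 : (size (g'`_0)%R <= 1)%N by move: s2; rewrite sw size_map_polyC.
  pose k := (g'`_0)`_0.
  have eg2 : g' = k%:P%:P by rewrite eg1 /k [X in X%:P](size1_polyC s3).
  have k0 : k != 0 by apply: contra_neq g'0 => k0; rewrite eg2 k0.
  have h1 : (k^-1)%:P%:P * g' = 1 by rewrite [in LHS]eg2 -!polyCM mulVf.
  by apply/unitrP; exists (k^-1)%:P%:P; rewrite [g' * _]mulrC.
split=> //.
  apply/negP => /unitrP[v [_ e1]]; have := congr1 (ev (fmap e xi)) e1.
  by rewrite rmorphM rmorph1 /= fEx mul0r => /eqP; rewrite eq_sym oner_eq0.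
move=> g g' eg; have := fEx; rewrite eg rmorphM /= => /eqP; rewrite mulf_eq0 => /orP[]/eqP gx.
  by right; apply: key eg gx.
by left; rewrite mulrC in eg; apply: key eg gx.
Qed.
End SmoothFactor.

Section AmplePoints.
Variable F : fieldType.
Hypothesis ampF : ample F.

(** Only finitely many points lie over the zeros of B: a vertical line X = a meets the curve in
    infinitely many points only if X - a divides [h], which primitivity forbids. *)
Lemma ample_points (H : {poly {poly F}}) (B : {poly F}) :
  (H`_0)`_0 = 0 -> (H`_1)`_0 != 0 -> B != 0 ->
  exists a b, (H.[b%:P]).[a] = 0 /\ B.[a] != 0.
Proof.
move=> H00 H10 B0; have [h [q [Hq irr h00 h10 prim]]] := smooth_factor H00 H10.
have [sB hsB] := poly_roots_list B0.
have hT a : exists s : seq F, forall b, (h.[b%:P]).[a] = 0 -> b \in s.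
  pose ha := map_poly (horner_eval a) h.
  have ha0 : ha != 0.
    apply/eqP => z; have : (size ('X - a%:P)%R <= 1)%N; last by rewrite size_XsubC.
    apply: prim => j; rewrite dvdp_XsubCl /root.
    have := congr1 (fun p : {poly F} => p`_j) z; rewrite coef_map coef0 /= /horner_eval => ->.
    by rewrite eqxx.
  have [s hs] := poly_roots_list ha0; exists s => b hb; apply: hs.
  by rewrite -[b](hornerC b a) -/(horner_eval a _) horner_map.
have [T hT'] := choice hT.
have sm : eval2 h^`() 0 0 != 0.
  by rewrite /eval2 polyC0 !horner_coef0 coef_deriv mulr1n.
have [|a [b [ns hab]]] := ampF irr (a := 0) (b := 0) _ (or_intror sm) [seq (a, b) | a <- sB, b <- T a].
  by rewrite /eval2 polyC0 !horner_coef0.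
exists a, b; split; first by rewrite Hq !hornerM [h.[_].[_]]hab mulr0.
apply: contra ns => /eqP/hsB aB; apply/allpairsPdep.
by exists a, b; split=> //; apply: hT'.
Qed.

(** The curve is the line Y = 0, and B vanishes on [s]. *)
Lemma ample_infinite (s : seq F) : exists x, x \notin s.
Proof.
have [||| a [b [_ ha]]] := @ample_points 'X (\prod_(c <- s) ('X - c%:P)).
- by rewrite coefX coef0.
- by rewrite coefX coef1 oner_neq0.
- by rewrite monic_neq0 // monic_prod_XsubC.
by exists a; apply: contraNN ha => sa; rewrite -/(root _ a) root_prod_XsubC.
Qed.

Lemma ample_embed (T : finType) : exists lam : T -> F, injective lam.
Proof.
have h n : exists s : seq F, size s = n /\ uniq s.
  elim: n => [|n [s [ss us]]]; first by exists [::].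
  by have [x hx] := ample_infinite s; exists (x :: s); rewrite /= ss hx us.
have [s [ss us]] := h #|T|.
exists (fun t => nth 0 s (enum_rank t)) => x y /eqP.
by rewrite nth_uniq ?ss // => /eqP/val_inj/enum_rank_inj.
Qed.
End AmplePoints.

(** * Specializing power series over an ample field *)

Notation tofrac := (@FracField.tofrac _).

Lemma fractionP (D : idomainType) (x : {fraction D}) :
  exists n d : D, d != 0 /\ x = tofrac n / tofrac d.
Proof.
suff [n [d [d0 e]]] : exists n d : D, d != 0 /\ tofrac d * x = tofrac n.
  exists n, d; split=> //; rewrite -e mulrC mulKf // tofrac_eq0 //.
move: x; elim/quotW=> r; exists (frac r).1, (frac r).2; split; first exact: denom_ratioP.
rewrite -[LHS]/(FracField.mul _ _) !piE; apply/eqmodP.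
rewrite /= FracField.equivfE /FracField.mulf !numden_Ratio ?mulf_neq0 ?oner_neq0 ?denom_ratioP //.
by rewrite mulr1 mul1r mulrC.
Qed.

Section FracMap.
Variables (D L : idomainType) (f : {rmorphism D -> L}).
Hypothesis injf : injective f.
Lemma fracmap_ex : exists g : {rmorphism {fraction D} -> {fraction L}},
  forall a, g (tofrac a) = tofrac (f a).
Proof.
have f0 d : d != 0 -> tofrac (f d) != 0.
  by move=> d0; rewrite tofrac_eq0 -(rmorph0 f) (inj_eq injf).
have t0 (d : D) : d != 0 -> tofrac d != 0 by rewrite tofrac_eq0.
have h (x : {fraction D}) : exists y : {fraction L}, forall n d, d != 0 -> x = tofrac n / tofrac d ->
    y = tofrac (f n) / tofrac (f d).
  have [n [d [d0 ->]]] := fractionP x.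
  exists (tofrac (f n) / tofrac (f d)) => n' d' d'0 /eqP.
  rewrite eqr_div ?t0 // -!rmorphM tofrac_eq => /eqP e.
  by apply/eqP; rewrite eqr_div ?f0 // -!rmorphM tofrac_eq e.
have [g hg] := choice h.
have gE n d : d != 0 -> g (tofrac n / tofrac d) = tofrac (f n) / tofrac (f d).
  by move=> d0; apply: hg.
have gz : zmod_morphism g.
  move=> x y; have [n [d [d0 ->]]] := fractionP x; have [n' [d' [d'0 ->]]] := fractionP y.
  rewrite -mulNr addf_div ?t0 // -rmorphN -!rmorphM -rmorphD !gE ?mulf_neq0 //.
  rewrite -mulNr addf_div ?f0 //.
  by rewrite !rmorphD /= !rmorphM /= !rmorphN /=.
have gm : monoid_morphism g.
  split=> [|x y].
    have := gE 1 1 (oner_neq0 _); by rewrite !rmorph1 !divr1.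
  have [n [d [d0 ->]]] := fractionP x; have [n' [d' [d'0 ->]]] := fractionP y.
  by rewrite mulf_div -!rmorphM !gE ?mulf_neq0 // !rmorphM /= mulf_div.
pose gr : {rmorphism {fraction D} -> {fraction L}} :=
  HB.pack g (GRing.isZmodMorphism.Build _ _ g gz) (GRing.isMonoidMorphism.Build _ _ g gm).
exists gr.
by move=> a /=; have := gE a 1 (oner_neq0 _); rewrite !rmorph1 !divr1.
Qed.
End FracMap.

Lemma common_denom_alg (A : comPzRingType) (b d n i r x : A) :
  d * i = 1 -> d * (b * r) * x + b * n = b * d * (r * x + n * i).
Proof.
move=> h; transitivity (d * (b * r) * x + b * n * (d * i)); last by ring.
by rewrite h mulr1.
Qed.
Lemma common_denom (D : idomainType) (r : {poly {fraction D}}) :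
  exists (b : D) (a : {poly D}), b != 0 /\ map_poly tofrac a = (tofrac b)%:P * r.
Proof.
elim/poly_ind: r => [|r c [b [a [b0 e]]]].
  by exists 1, 0; rewrite oner_neq0 rmorph0 mulr0.
have [n [d [d0 ->]]] := fractionP c.
exists (b * d), (d%:P * a * 'X + (b * n)%:P); split; first exact: mulf_neq0.
rewrite rmorphD !rmorphM /= e !map_polyC map_polyX /= ?tofracM ?polyCM.
apply: common_denom_alg; rewrite -polyCM mulfV // tofrac_eq0 //.
Qed.

Section Frob.
Variables (K W : fieldType) (io : {rmorphism K -> W}).
Definition inF w z := exists r : {poly K}, (map_poly io r).[w] = z.
Definition sepel z := exists g : {poly K}, [/\ separable_poly g & root (map_poly io g) z].

(** A least annihilator is separable unless its derivative vanishes; then it is a polynomial in X^p,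
    and z^p has smaller degree. The condition on q forces q = 1 in characteristic 0. *)
Lemma sep_power n z (g : {poly K}) : (size g <= n)%N -> g != 0 -> root (map_poly io g) z ->
  exists q : nat, [pchar W].-nat q /\ sepel (z ^+ q).
Proof.
elim: n z g => [|n IH] z g sg g0 gz; first by move: sg; rewrite leqn0 size_poly_eq0 (negbTE g0).
case: (pselect (exists h : {poly K}, [/\ h != 0, (size h < size g)%N & root (map_poly io h) z])).
  by case=> h [h0 sh hz]; apply: (IH z h) => //; rewrite -ltnS; apply: leq_trans sg.
move=> nh.
have g'_size : (size g^`() < size g)%N by apply: lt_size_deriv.
have [d0|d0] := eqVneq g^`() 0; last first.
  exists 1%N; split=> //; rewrite expr1; exists g; split=> //.
  rewrite unlock coprimep_def; apply/negP => /negP sd.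
  pose d := gcdp g g^`(); have d_0 : d != 0 by rewrite gcdp_eq0 negb_and g0.
  have sd2 : (size d < size g)%N.
    by apply: leq_ltn_trans g'_size; apply: dvdp_leq d0 (dvdp_gcdr _ _).
  have eg : g = (g %/ d) * d by rewrite divpK // dvdp_gcdl.
  have e0 : g %/ d != 0 by apply: contra_neq g0 => z0; rewrite eg z0 mul0r.
  have se : (size (g %/ d)%R < size g)%N.
    rewrite size_divp //; move: sd; rewrite -/d; have : (0 < size d)%N by rewrite lt0n size_poly_eq0.
    have : (0 < size g)%N by rewrite lt0n size_poly_eq0.
    by case: (size d) => [|[|k]] //; case: (size g) => // k' _ _ _; lia.
  move: gz; rewrite eg rmorphM rootM => /orP[r1|r1]; apply: nh.
    by exists (g %/ d).
  by exists d.
have sg2 : (1 < size g)%N.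
  rewrite ltnNge; apply/negP => /size1_polyC e; move: gz g0.
  by rewrite e map_polyC rootC fmorph_eq0 polyC_eq0 => ->.
have coef0' i : (i.+1)%:R * g`_i.+1 = 0.
  by have := congr1 (fun p : {poly K} => p`_i) d0; rewrite coef_deriv coef0 mulr_natl.
have [p pc] : exists p, p \in [pchar K].
  have l0 : lead_coef g != 0 by rewrite lead_coef_eq0.
  have := coef0' (size g).-2.
  have -> : ((size g).-2.+1 = (size g).-1)%N by case: (size g) sg2 => [|[|k]].
  rewrite -lead_coefE => /eqP; rewrite mulf_eq0 (negbTE l0) orbF => n0.
  by apply: (natf0_pchar _ n0); case: (size g) sg2 => [|[|k]].
have pp : prime p := pcharf_prime pc.
pose h : {poly K} := \poly_(j < size g) g`_(j * p).
have gh : g = h \Po 'X^p.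
  apply/polyP => i; rewrite coef_comp_poly_Xn ?prime_gt0 //; case: ifP => [dv|ndv].
    rewrite coef_poly; case: ltnP => lt; first by rewrite divnK.
    by rewrite nth_default // (leq_trans lt) // leq_div.
  case: i ndv => [|i] ndv; first by rewrite dvdn0 in ndv.
  have /eqP := coef0' i; rewrite mulf_eq0 -(dvdn_pcharf pc) ndv /=.
  by move/eqP.
have szh : (size h < size g)%N.
  have := size_comp_poly h 'X^p; rewrite -gh size_polyXn /= => e.
  have : (1 < p)%N by apply: prime_gt1.
  have : (0 < (size g).-1)%N by case: (size g) sg2 => [|[|k]].
  move: sg2; rewrite e; case: (size h) e => [|k] /=; first by rewrite mul0n.
  case: (size g) => // k' /= -> _ k0 p1; rewrite ltnS.
  by rewrite muln_gt0 in k0; case/andP: k0 => k0 _; rewrite -{1}[k]muln1 ltn_pmul2l.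
have h0 : h != 0 by apply: contra_neq g0 => z0; rewrite gh z0 comp_poly0.
have hz : root (map_poly io h) (z ^+ p).
  by move: gz; rewrite gh map_comp_poly map_polyXn /root horner_comp hornerXn.
have [|q [qn sq]] := IH (z ^+ p) h _ h0 hz; first by rewrite -ltnS; apply: leq_trans sg.
exists (p * q)%N; rewrite exprM; split=> //.
by rewrite pnatM qn andbT pnatE // (rmorph_pchar io).
Qed.

Lemma inF_trans w z v : inF w z -> inF z v -> inF w v.
Proof.
by move=> [r1 <-] [r2 <-]; exists (r2 \Po r1); rewrite map_comp_poly horner_comp.
Qed.
Lemma inF_X w v n : inF w v -> inF w (v ^+ n).
Proof. by move=> [r <-]; exists (r ^+ n); rewrite rmorphXn /= horner_exp. Qed.
Lemma inF_frob w v q : [pchar W].-nat q -> inF w v -> inF (w ^+ q) (v ^+ q).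
Proof.
move=> qn [r <-]; elim/poly_ind: r => [|r c [r' hr']].
  exists 0; rewrite !rmorph0 !horner0; case: q qn => // q _; by rewrite expr0n.
exists (r' * 'X + (c ^+ q)%:P).
rewrite !rmorphD !rmorphM /= !map_polyC !map_polyX /= !hornerE hr' rmorphXn /=.
by rewrite exprDn_pchar // exprMn.
Qed.

Variables (tau : nat -> K) (P : W -> Prop).
Hypotheses (taui : injective tau) (P0 : P 0)
  (Pc : forall n y x, P y -> P x -> P (io (tau n) * y - x)) (PX : forall x n, P x -> P (x ^+ n)).

Lemma sepel_alg z : sepel z -> algebraicOver io z.
Proof. by move=> [g [sg gz]]; exists g => //; apply: separable_poly_neq0. Qed.

(** A primitive element theorem up to Frobenius. The property [P], later that of being a power
    series, is to hold for the primitive element; so the latter has to be built by the operations in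
    [Pc] and [PX] alone. *)
Lemma primitive_power (s : seq W) :
  (forall u, u \in s -> P u /\ algebraicOver io u) ->
  exists q w, [/\ [pchar W].-nat q, P w, sepel w & forall u, u \in s -> inF w (u ^+ q)].
Proof.
elim: s => [|u s IH] hs.
  exists 1%N, 0; split=> //; exists 'X; split; last by rewrite map_polyX rootX.
  by rewrite unlock derivX coprimep1.
have [|q [w [qn Pw sw hw]]] := IH; first by move=> v vs; apply: hs; rewrite inE vs orbT.
have [Pu [g g0 gu]] := hs u (mem_head _ _).
have [q1 [q1n [h [sh hu]]]] := sep_power (leqnn _) g0 gu.
have [gw g0w gwr] := sepel_alg sw.
have [r r0 hr] := large_field_PET g0w gwr hu sh.
have [n hn] : exists n, ~~ root r (io (tau n)).
  apply: contrapT => nn.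
  have := max_poly_roots (rs := [seq io (tau i) | i <- iota 0 (size r)]) r0.
  rewrite size_map size_iota ltnn => h0; suff // : false by [].
  apply: h0; last by rewrite map_inj_uniq ?iota_uniq // => i j /fmorph_inj/taui.
  by apply/allP => _ /mapP[i _ ->]; apply: contrapT => /negP hi; apply: nn; exists i.
have [] := hr _ hn; set z := (_ - w) => hzw hzu.
have Pz : P z by apply: Pc => //; apply: PX.
(* The new element is replaced by a separable power of itself; the exponent [q2] is then absorbed
   everywhere. *)
have [gz gz0 gzr] : algebraicOver io z.
  apply: algebraic_sub; last exact: sepel_alg.
  by apply: algebraic_mul; [exact: algebraic_id | apply: sepel_alg; exists h].
have [q2 [q2n sz]] := sep_power (leqnn _) gz0 gzr.
exists (q * q1 * q2)%N, (z ^+ q2); split=> //.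
- by rewrite !pnatM qn q1n q2n.
- exact: PX.
move=> v; rewrite inE => /predU1P[->|/hw vs]; rewrite exprM; apply: inF_frob => //.
  by rewrite mulnC exprM; apply: inF_X.
by rewrite exprM; apply: inF_X; apply: inF_trans vs.
Qed.
End Frob.

Record sub_ring (L : nzRingType) := SubRing {
  sr_in :> L -> Prop;
  sr_one : sr_in 1;
  sr_sub : forall a b, sr_in a -> sr_in b -> sr_in (a - b);
  sr_mul : forall a b, sr_in a -> sr_in b -> sr_in (a * b) }.

Section SubRingType.
Variables (L : nzRingType) (S : sub_ring L).
Definition sr_pred : {pred L} := fun x => `[< S x >].
Lemma sr_closed : subring_closed sr_pred.
Proof.
split=> [|a b /asboolP ha /asboolP hb|a b /asboolP ha /asboolP hb]; apply/asboolP.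
- exact: sr_one.
- exact: sr_sub.
- exact: sr_mul.
Qed.
HB.instance Definition _ := GRing.isSubringClosed.Build L sr_pred sr_closed.
Record sr_type := SrType { sr_val : L; sr_valP : sr_val \in sr_pred }.
HB.instance Definition _ := [isSub for sr_val].
HB.instance Definition _ := [Choice of sr_type by <:].
HB.instance Definition _ := [SubChoice_isSubNzRing of sr_type by <:].
Lemma sr_val_zmod : zmod_morphism sr_val.
Proof. by move=> x y; apply: (rmorphB (val : sr_type -> L)). Qed.
Lemma sr_val_mon : monoid_morphism sr_val.
Proof.
by split=> [|x y]; [apply: (rmorph1 (val : sr_type -> L)) | apply: (rmorphM (val : sr_type -> L))].
Qed.
HB.instance Definition _ := GRing.isZmodMorphism.Build sr_type L sr_val sr_val_zmod.
HB.instance Definition _ := GRing.isMonoidMorphism.Build sr_type L sr_val sr_val_mon.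
Lemma sr_in_val (x : sr_type) : S (sr_val x).
Proof. exact/asboolP/sr_valP. Qed.
Definition to_sr x (Sx : S x) : sr_type := SrType (introT (asboolP (S x)) Sx).
Lemma sr_val_inj : injective sr_val. Proof. exact: val_inj. Qed.
End SubRingType.
Section SubComRing.
Variables (L : comNzRingType) (S : sub_ring L).
Lemma sr_mulC : @commutative (sr_type S) (sr_type S) *%R.
Proof. by move=> x y; apply: sr_val_inj; rewrite !rmorphM mulrC. Qed.
HB.instance Definition _ := GRing.PzRing_hasCommutativeMul.Build (sr_type S) sr_mulC.
End SubComRing.

Section Approx.
Variables (F : fieldType) (D : idomainType) (io : {rmorphism D -> fps F}).
Definition approx N (a : fps F) (p : {poly F}) := forall n, (n < N)%N -> cf a n = p`_n.
Lemma approxM N a b p q : approx N a p -> approx N b q -> approx N (a * b) (p * q).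
Proof.
move=> h1 h2 n lt; rewrite cfM coefM; apply: eq_bigr => i _.
by rewrite h1 ?h2 //; [apply: leq_ltn_trans lt; apply: leq_subr | apply: leq_trans lt].
Qed.
Lemma approxD N a b p q : approx N a p -> approx N b q -> approx N (a + b) (p + q).
Proof. by move=> h1 h2 n lt; rewrite cfD coefD h1 ?h2. Qed.
Lemma approx_horner N (psi : {rmorphism D -> {poly F}}) (Q : {poly D}) w W :
  (forall a, approx N (io a) (psi a)) -> approx N w W ->
  approx N (map_poly io Q).[w] (map_poly psi Q).[W].
Proof.
move=> hpsi hw; elim/poly_ind: Q => [|Q c IH].
  by rewrite !rmorph0 !horner0 => n _; rewrite coef0.
rewrite !rmorphD !rmorphM /= !map_polyC !map_polyX /= !hornerE.
by apply: approxD => //; apply: approxM.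
Qed.
Lemma approx_trunc N a : approx N a (trunc N a).
Proof. by move=> n lt; rewrite coef_trunc. Qed.
End Approx.

(** D is a polynomial ring over F in x and in those elements of [s] that are transcendental over the
    preceding ones. Replacing these by truncations gives homomorphisms to F[x] that agree with the
    inclusion modulo x^N; they bring questions over D down to plane curves. *)
Lemma tower (F : fieldType) (s : seq (fps F)) :
  exists (D : idomainType) (io : {rmorphism D -> fps F}),
  [/\ injective io,
      forall N, exists psi : {rmorphism D -> {poly F}}, forall a, approx N (io a) (psi a),
      exists tau : nat -> D, injective tau &
      forall u, u \in s -> exists2 f : {poly D}, f != 0 & (map_poly io f).[u] = 0].
Proof.
elim: s => [|u s [D [io [inj app [tau taui] alg]]]].
  exists {poly F}, (@p2s F : {rmorphism _ -> _}); split=> //.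
  - exact: p2s_inj.
  - by move=> N; exists (idfun : {rmorphism _ -> _}).
  - exists (fun n => 'X^n) => m n /(congr1 (fun p : {poly F} => size p)).
    by rewrite !size_polyXn => -[].
case: (pselect (exists2 f : {poly D}, f != 0 & (map_poly io f).[u] = 0)) => [hu|nu].
  exists D, io; split=> //; first by exists tau.
  by move=> v; rewrite inE => /predU1P[->|/alg].
pose io' : {rmorphism {poly D} -> fps F} := horner_eval u \o map_poly io.
have io'C (f : {poly D}) : map_poly io' (map_poly polyC f) = map_poly io f.
  apply/polyP => i; rewrite !coef_map /= /horner_eval map_polyC /= hornerC //.
exists {poly D}, io'; split.
- move=> f g /eqP; rewrite -subr_eq0 -rmorphB => /eqP h; apply/eqP.
  rewrite -subr_eq0; apply/negP => /negP ne; apply: nu; by exists (f - g).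
- move=> N; have [psi hpsi] := app N.
  exists (horner_eval (trunc N u) \o map_poly psi : {rmorphism _ -> _}) => a.
  by apply: approx_horner => //; apply: approx_trunc.
- by exists (fun n => (tau n)%:P) => m n /polyC_inj/taui.
- move=> v; rewrite inE => /predU1P[->|/alg[f f0 fv]].
    exists ('X - 'X%:P); first by rewrite polyXsubC_eq0.
    rewrite rmorphB /= map_polyX map_polyC /= /horner_eval map_polyX hornerX.
    by rewrite hornerXsubC subrr.
  exists (map_poly polyC f); last by rewrite io'C.
  by rewrite map_poly_eq0_id0 // polyC_eq0 lead_coef_eq0.
Qed.

Lemma poly_low (F : fieldType) (p : {poly F}) k : (forall n, (n < k)%N -> p`_n = 0) ->
  exists q, p = 'X^k * q /\ q`_0 = p`_k.
Proof.
move=> h; exists (drop_poly k p); rewrite coef_drop_poly add0n; split=> //.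
rewrite -{1}[p](poly_take_drop k) [RHS]mulrC; suff -> : take_poly k p = 0 by rewrite add0r.
by apply/polyP => i; rewrite coef_take_poly coef0; case: ltnP => // /h.
Qed.

(** Newton's substitution. With e the order of G'(w) and W0 a truncation of w, expanding G(W0 +
    x^(e+1) Y) gives x^(2e+1) H(x, Y) with H zero and smooth at the origin. A point (a, b) of H then
    specializes x to a, and avoids the zeros of the image of [beta]. *)
Lemma ample_point_on (F : fieldType) (D : idomainType) (io : {rmorphism D -> fps F})
    (G : {poly D}) (w : fps F) (beta : D) :
  ample F -> injective io ->
  (forall N, exists psi : {rmorphism D -> {poly F}}, forall a, approx N (io a) (psi a)) ->
  (map_poly io G).[w] = 0 -> (map_poly io G^`()).[w] != 0 -> beta != 0 ->
  exists (th : {rmorphism D -> F}) (ws : F), (map_poly th G).[ws] = 0 /\ th beta != 0.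
Proof.
move=> amp inj app Gw /eqP G'w b0.
have [e [he le]] := lowest_term G'w.
have [nb [hb _]] : exists n, cf (io beta) n != 0 /\ forall i, (i < n)%N -> cf (io beta) i = 0.
  by apply: lowest_term => z; move: b0; rewrite -(inj_eq inj) z rmorph0 eqxx.
pose k := (e + e).+1.
(* Enough precision for G(W0) to be divisible by x^(k+1) and for the lowest term of [beta] to
   survive. *)
pose N := (k.+1 + nb.+1)%N.
have [psi hpsi] := app N.
pose W0 := trunc N w; have hW := @approx_trunc _ N w.
pose GN := map_poly psi G.
have h1 := approx_horner G hpsi hW; have h2 := approx_horner G^`() hpsi hW.
have [c0 [ec0 _]] : exists q : {poly F}, GN.[W0] = 'X^(k.+1) * q /\ q`_0 = GN.[W0]`_k.+1.
  by apply: poly_low => n lt; rewrite -h1 ?Gw ?cf0 //; apply: leq_trans lt _; rewrite leq_addr.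
have eN : (e < N)%N by rewrite /N /k; lia.
have [c [ec c00]] : exists q : {poly F}, GN^`().[W0] = 'X^e * q /\ q`_0 = GN^`().[W0]`_e.
  by apply: poly_low => n lt; rewrite deriv_map -h2 ?le //; apply: ltn_trans eN.
have c0n : c`_0 != 0 by rewrite c00 deriv_map -h2.
have [r hr] := horner_taylor2 (map_poly polyC GN) W0%:P (('X^(e.+1))%:P * 'X).
pose H : {poly {poly F}} := ('X * c0)%:P + c%:P * 'X + 'X%:P * r * 'X^2.
have eH : (map_poly polyC GN).[W0%:P + ('X^(e.+1))%:P * 'X] = ('X^k)%:P * H.
  rewrite hr deriv_map !horner_map /= ec0 ec /H /k !polyCM !rmorphXn /= !exprS !exprD.
  ring.
have [||| a [b [Hab Ba]]] := @ample_points F amp H (psi beta).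
- by rewrite /H !coefD coefC coefMX coefMXn /= !coef0 !addr0 coefXM.
- by rewrite /H !coefD coefC coefMX coefMXn /= !coef0 add0r addr0 coefC.
- have : (psi beta)`_nb != 0 by rewrite -hpsi //; rewrite /N; lia.
  by apply: contraNneq => ->; rewrite coef0.
pose th : {rmorphism D -> F} := horner_eval a \o psi.
pose Eab : {rmorphism {poly {poly F}} -> F} := horner_eval a \o horner_eval b%:P.
exists th, (Eab (W0%:P + ('X^(e.+1))%:P * 'X)); split; last exact: Ba.
have -> : map_poly th G = map_poly Eab (map_poly polyC GN).
  by apply/polyP => i; rewrite !coef_map /= /horner_eval hornerC.
by rewrite horner_map eH rmorphM /= {2}/horner_eval {2}/horner_eval Hab mulr0.
Qed.

(** Bezout with denominators cleared; minimality of G makes it coprime to A. The nonzero constant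
    [d] certifies that A stays nonzero at the root under every specialization that keeps [d]. *)
Lemma cofactor_coprime (D L : idomainType) (io : {rmorphism D -> L}) (G A : {poly D}) (w : L) :
  injective io -> G != 0 -> (map_poly io G).[w] = 0 ->
  (forall Q : {poly D}, (map_poly io Q).[w] = 0 -> (size Q < size G)%N -> Q = 0) ->
  (map_poly io A).[w] != 0 ->
  exists (X : {poly D}) (d : D), d != 0 /\ (map_poly io (X * A - d%:P)).[w] = 0.
Proof.
move=> inj G0 Gw minG Aw.
have io0 x : x != 0 -> io x != 0 by move=> x0; rewrite -(rmorph0 io) (inj_eq inj).
pose E (Q : {poly D}) := (map_poly io Q).[w].
have EM P Q : E (P * Q) = E P * E Q by rewrite /E rmorphM hornerM.
have EZ c Q : E (c *: Q) = io c * E Q by rewrite -mul_polyC EM /E map_polyC hornerC.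
pose d := gcdp G A.
have d0 : d != 0 by rewrite gcdp_eq0 negb_and G0.
have dw : E d != 0.
  apply: contraNneq Aw => dw; have := dvdp_gcdr G A; rewrite Pdiv.WeakIdomain.dvdp_eq => /eqP e.
  have := congr1 E e; rewrite EZ EM dw mulr0 => /eqP.
  by rewrite mulf_eq0 (negbTE (io0 _ _)) ?expf_neq0 ?lead_coef_eq0.
have sd : size d = 1%N.
  apply/eqP/negP => /negP sd.
  have := dvdp_gcdl G A; rewrite Pdiv.WeakIdomain.dvdp_eq -/d => /eqP e.
  set q := G %/ d in e; have cd : lead_coef d ^+ scalp G d != 0 by rewrite expf_neq0 ?lead_coef_eq0.
  have q0 : q = 0.
    have [//|q0] := eqVneq q 0.
    apply: minG.
      have := congr1 E e; rewrite EZ EM [E G]Gw mulr0 => /esym/eqP.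
      by rewrite mulf_eq0 (negbTE dw) orbF => /eqP.
    have := congr1 (fun P : {poly D} => size P) e; rewrite size_scale // => ->.
    rewrite size_mul //; have : (0 < size d)%N by rewrite lt0n size_poly_eq0.
    have : (0 < size q)%N by rewrite lt0n size_poly_eq0.
    by case: (size d) sd => [|[|m]] //; case: (size q) => // m' _ _ _; lia.
  by move: e; rewrite q0 mul0r => /eqP; rewrite -mul_polyC mulf_eq0 polyC_eq0 (negbTE cd) (negbTE G0).
have [c ec] : exists c, d = c%:P by exists d`_0; apply: size1_polyC; rewrite sd.
have c0 : c != 0 by rewrite -polyC_eq0 -ec.
have [u /eqpP[[c1 c2] /= /andP[c10 c20] e]] := Bezoutp G A.
exists (c1 *: u.2), (c2 * c); split; first exact: mulf_neq0.
have -> : c1 *: u.2 * A - (c2 * c)%:P = - (c1 *: (u.1 * G)).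
  by rewrite polyCM mul_polyC -ec -/d -e scalerDr -scalerAl opprD addrCA subrr addr0.
by rewrite rmorphN hornerN -[X in - X]/(E _) EZ EM [E G]Gw !mulr0 oppr0.
Qed.

(** The subring consists of the v with b v^q = A(w0), where A is over D and [th] keeps b nonzero;
    [phi] sends v to A(ws) / th b, the specialization of v^q. It is additive because q is a power of
    the characteristic, or 1. *)
Theorem ample_specializable (F : fieldType) : ample F -> specializable (fps F) F.
Proof.
move=> amp s0 rho rho0; pose s := rho :: s0.
have [D [io [inj app [tau taui] alg]]] := tower s.
have [iF hiF] := fracmap_ex inj.
have io0 x : x != 0 -> io x != 0 by move=> x0; rewrite -(rmorph0 io) (inj_eq inj).
have evF (Q : {poly D}) v : (map_poly iF (map_poly tofrac Q)).[tofrac v] = tofrac (map_poly io Q).[v].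
  rewrite -horner_map -!map_poly_comp; congr _.[_]; apply: eq_map_poly => a /=.
  exact: hiF.
have tinj (L : idomainType) : injective (@FracField.tofrac L).
  by move=> a b /eqP; rewrite tofrac_eq => /eqP.
have [|||||q [w [qn [w0 ew] sepw hw]]] := @primitive_power {fraction D} {fraction fps F} iF (fun n => tofrac (tau n))
    (fun z => exists v, z = tofrac v) _ _ _ _ [seq tofrac u | u <- s].
- by move=> m n /tinj/taui.
- by exists 0; rewrite tofrac0.
- move=> n _ _ [y ->] [x ->]; exists (io (tau n) * y - x).
  by rewrite hiF tofracB tofracM.
- by move=> _ n [x ->]; exists (x ^+ n); rewrite tofracXn.
- move=> _ /mapP[u us ->]; split; first by exists u.
  have [f f0 fu] := alg u us; exists (map_poly tofrac f).
    by rewrite map_poly_eq0_id0 // tofrac_eq0 lead_coef_eq0.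
  by rewrite /root evF fu tofrac0.
subst w.
have hex u : exists Ab : {poly D} * D, u \in s -> Ab.2 != 0 /\
    io Ab.2 * u ^+ q = (map_poly io Ab.1).[w0].
  case us: (u \in s); last by exists (0, 0).
  have [r hr] := hw (tofrac u) (map_f _ us).
  have [b [a [b0 e]]] := common_denom r.
  exists (a, b) => _; split=> //=; apply: (tinj (fps F)).
  by rewrite -evF e [map_poly iF _]rmorphM /= map_polyC hornerM hornerC /= hiF hr tofracM tofracXn.
have [AB hAB] := choice hex.
have exG : exists n, `[< exists Q : {poly D}, [/\ Q != 0, size Q = n & (map_poly io Q).[w0] = 0] >].
  have [g [sg gw]] := sepw; have [b [a [b0 e]]] := common_denom g.
  exists (size a); apply/asboolP; exists a; split=> //.
    apply: contraTneq (separable_poly_neq0 sg) => a0; rewrite negbK.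
    move/eqP: e; rewrite a0 rmorph0 eq_sym mulf_eq0 polyC_eq0 tofrac_eq0 (negbTE b0) /=.
    by [].
  apply: (tinj (fps F)); rewrite -evF e [map_poly iF _]rmorphM /= hornerM (eqP gw) mulr0 tofrac0 //.
case: (ex_minnP exG) => n /asboolP[G [G0 sG Gw]] minn.
have minG (Q : {poly D}) : (map_poly io Q).[w0] = 0 -> (size Q < size G)%N -> Q = 0.
  move=> Qw; rewrite sG => lt; apply/eqP/negP => /negP Q0; move: lt; rewrite ltnNge minn //.
  by apply/asboolP; exists Q.
(* Over the fractions of D the minimal G divides a separable polynomial, so w0 is a simple root. *)
have G'w : (map_poly io G^`()).[w0] != 0.
  apply/eqP => G'0; have [g [sg gw]] := sepw.
  pose GK : {poly {fraction D}} := map_poly tofrac G.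
  have GK0 : GK != 0 by rewrite map_poly_eq0_id0 // tofrac_eq0 lead_coef_eq0.
  have GKw : (map_poly iF GK).[tofrac w0] = 0 by rewrite evF Gw tofrac0.
  have GK'w : (map_poly iF GK^`()).[tofrac w0] = 0 by rewrite /GK deriv_map evF G'0 tofrac0.
  have eg := divp_eq g GK.
  have r0 : g %% GK = 0.
    have [b [a [b0 e]]] := common_denom (g %% GK).
    have a0 : a = 0.
      apply: minG.
        apply: (tinj (fps F)); rewrite -evF e [map_poly iF _]rmorphM /= hornerM.
        have := congr1 (fun P => (map_poly iF P).[tofrac w0]) eg.
        by rewrite rmorphD rmorphM /= hornerD hornerM GKw mulr0 add0r (eqP gw) => <-; rewrite mulr0 tofrac0.
      have -> : size a = size (g %% GK).
        have := congr1 (fun P : {poly {fraction D}} => size P) e.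
        rewrite mul_polyC size_scale ?tofrac_eq0 // => <-.
        by rewrite size_map_inj_poly ?tofrac0 //; apply: tinj.
      have -> : size G = size GK by rewrite size_map_inj_poly ?tofrac0 //; apply: tinj.
      by rewrite ltn_modp.
    by move/eqP: e; rewrite a0 rmorph0 eq_sym mulf_eq0 polyC_eq0 tofrac_eq0 (negbTE b0) => /eqP.
  rewrite r0 addr0 in eg.
  have cop : coprimep (map_poly iF g) (map_poly iF g^`()).
    by rewrite coprimep_map; move: sg; rewrite unlock.
  have := coprimep_root cop gw.
  rewrite eg derivM rmorphD !rmorphM /= hornerD !hornerM GKw GK'w !mulr0 addr0 eqxx //.
have [rhos srho] : rho \in s /\ {subset s0 <= s}.
  by split; [apply: mem_head | move=> x xs; rewrite inE xs orbT].
have [b0 eb] := hAB rho rhos.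
have Arho : (map_poly io (AB rho).1).[w0] != 0 by rewrite -eb mulf_neq0 ?io0 ?expf_neq0.
have [X [d [d0 hX]]] := cofactor_coprime inj G0 Gw minG Arho.
pose B := \prod_(u <- s) (AB u).2.
have B0 : B != 0.
  by rewrite /B prodf_seq_neq0; apply/allP => u us; case: (hAB u us).
(* What must survive: the leading coefficient of G for pseudo-division, all denominators, and the
   certificate [d] for [rho]. *)
have beta0 : lead_coef G * (B * d) != 0 by rewrite !mulf_neq0 ?lead_coef_eq0.
have [th [ws [Gws thb]]] := ample_point_on amp inj app Gw G'w beta0.
have [thG thB thd] : [/\ th (lead_coef G) != 0, th B != 0 & th d != 0].
  by move: thb; rewrite !rmorphM !mulf_eq0 !negb_or => /and3P[].
(* Relations at w0 persist at ws: G divides them up to a power of its leading coefficient. Hence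
   [phi] is well defined. *)
have WD (Q : {poly D}) : (map_poly io Q).[w0] = 0 -> (map_poly th Q).[ws] = 0.
  move=> Qw; have e := Pdiv.WeakIdomain.divp_eq Q G.
  have r0 : Q %% G = 0.
    apply: minG; last by rewrite Pdiv.CommonIdomain.ltn_modpN0.
    have := congr1 (fun P => (map_poly io P).[w0]) e.
    rewrite rmorphD rmorphM /= hornerD hornerM Gw mulr0 add0r -mul_polyC rmorphM /= hornerM Qw.
    by rewrite mulr0 => <-.
  rewrite r0 addr0 in e; have := congr1 (fun P => (map_poly th P).[ws]) e.
  rewrite rmorphM /= hornerM Gws mulr0 -mul_polyC rmorphM /= hornerM map_polyC hornerC => /eqP.
  by rewrite mulf_eq0 /= rmorphXn /= expf_eq0 (negbTE thG) andbF => /eqP.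
pose T v Ac := th Ac.2 != 0 /\ io Ac.2 * v ^+ q = (map_poly io Ac.1).[w0].
have qn' : [pchar (fps F)].-nat q.
  apply: sub_in_pnat qn => p _; rewrite !inE => /andP[-> h]; rewrite andTb.
  by rewrite -(inj_eq (tinj _)) tofrac0 rmorph_nat.
have T1 : T 1 (1, 1).
  by rewrite /T /= rmorph1 oner_neq0 !rmorph1 expr1n mulr1 hornerC.
have TB v v' a a' : T v a -> T v' a' -> T (v - v') (a'.2%:P * a.1 - a.2%:P * a'.1, a.2 * a'.2).
  move=> [h1 e1] [h2 e2]; split=> /=; first by rewrite rmorphM mulf_neq0.
  rewrite exprDn_pchar // exprNn_pchar // !rmorphB !rmorphM /= !map_polyC !hornerE -e1 -e2 /=.
  ring.
have TM v v' a a' : T v a -> T v' a' -> T (v * v') (a.1 * a'.1, a.2 * a'.2).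
  move=> [h1 e1] [h2 e2]; split=> /=; first by rewrite rmorphM mulf_neq0.
  by rewrite exprMn !rmorphM /= hornerM -e1 -e2; ring.
pose S : sub_ring (fps F) := @SubRing _ (fun v => exists a, T v a) (ex_intro _ _ T1)
  (fun a b ha hb => let: ex_intro _ h1 := ha in let: ex_intro _ h2 := hb in ex_intro _ _ (TB _ _ _ _ h1 h2))
  (fun a b ha hb => let: ex_intro _ h1 := ha in let: ex_intro _ h2 := hb in ex_intro _ _ (TM _ _ _ _ h1 h2)).
pose val_of (a : {poly D} * D) := (map_poly th a.1).[ws] / th a.2.
have uniqT v a a' : T v a -> T v a' -> val_of a = val_of a'.
  move=> [h1 e1] [h2 e2]; apply/eqP; rewrite eqr_div // -subr_eq0; apply/eqP.
  have := WD (a.1 * a'.2%:P - a'.1 * a.2%:P).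
  rewrite !rmorphB !rmorphM /= !map_polyC !hornerE /= => -> //.
  by rewrite -e1 -e2; ring.
have hphi (x : sr_type S) : exists y, forall a, T (sr_val x) a -> y = val_of a.
  by have [a ha] := sr_in_val x; exists (val_of a) => a'; apply: uniqT.
have [phi phiE] := choice hphi.
have phiz : zmod_morphism phi.
  move=> x y; have [a ha] := sr_in_val x; have [b hb] := sr_in_val y.
  rewrite (phiE x a ha) (phiE y b hb) (phiE (x - y) _ (TB _ _ _ _ ha hb)) /val_of /=.
  rewrite !rmorphB !rmorphM /= !map_polyC !hornerE /=.
  by case: ha hb => [h1 _] [h2 _]; field; rewrite h1 h2.
have phim : monoid_morphism phi.
  split; first by rewrite (phiE 1 _ T1) /val_of /= !rmorph1 hornerC divr1.
  move=> x y; have [a ha] := sr_in_val x; have [b hb] := sr_in_val y.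
  rewrite (phiE x a ha) (phiE y b hb) (phiE (x * y) _ (TM _ _ _ _ ha hb)) /val_of /=.
  by rewrite !rmorphM /= hornerM mulf_div.
pose phir : {rmorphism sr_type S -> F} := HB.pack phi
  (GRing.isZmodMorphism.Build _ _ phi phiz) (GRing.isMonoidMorphism.Build _ _ phi phim).
have inT u : u \in s -> T u (AB u).
  move=> us; have [h1 h2] := hAB u us; split=> //.
  by move: thB; rewrite /B rmorph_prod prodf_seq_neq0 => /allP/(_ u us).
exists (sr_type S), (@sr_val _ S : {rmorphism _ -> _}), phir; split.
- exact: sr_val_inj.
- move=> u us; have Su : S u by exists (AB u); apply: inT; apply: srho.
  by exists (to_sr Su).
have Sr : S rho by exists (AB rho); apply: inT.
exists (to_sr Sr) => //=; rewrite (phiE _ (AB rho)); last exact: inT.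
have [h1 _] := inT _ rhos.
rewrite mulf_neq0 ?invr_neq0 //.
have := WD _ hX; rewrite rmorphB rmorphM /= map_polyC !hornerE => /eqP; rewrite subr_eq0 => /eqP e.
by apply: contraNneq thd => z; rewrite -e z mulr0.
Qed.

(** * Reduction to cyclic groups of prime power order *)

Section Covers.
Variable F : fieldType.
Hypothesis amp : ample F.

Lemma join_cover (gT : finGroupType) (G H1 H2 : {group gT}) :
  G :=: (H1 <*> H2)%g -> split_cover H1 F -> split_cover H2 F -> split_cover G F.
Proof.
move=> defG c1 c2; apply: gen_cover; apply: (descend (ample_specializable amp)).
have [lam laminj] := ample_embed amp gT.
apply: (cover_gen (lam := fun g => kc (lam g))); last exact: patch defG c1 c2.
move=> g h ne; rewrite -rmorphB.
have [|b hb] := @fps_invertible _ (kc (lam g - lam h)) (lam g - lam h)^-1.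
  rewrite -[cf _ 0]/(hd _) hd_kc mulVf // subr_eq0; by apply: contra_neq ne => /laminj.
by apply/unitrPr; exists b; rewrite mulrC.
Qed.

(** Any other group is generated by two proper subgroups: the p-part and the p'-part of a cyclic
    group, or a maximal subgroup and the cyclic group of an element outside it. *)
Lemma cyclic_covers :
  (forall (gT : finGroupType) (x : gT) l, prime l -> (l.-group <[x]>)%g -> split_cover <[x]>%G F) ->
  forall (gT : finGroupType) (G : {group gT}), split_cover G F.
Proof.
move=> cyc gT G; move: {2}(#|G|) (leqnn #|G|) => n; elim: n G => [|n IH] G.
  by rewrite leqn0 => /eqP G0; have := cardG_gt0 G; rewrite G0.
move=> Gn.
have step (H1 H2 : {group gT}) : H1 \proper G -> H2 \proper G -> G :=: (H1 <*> H2)%g -> split_cover G F.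
  move=> p1 p2 defG; apply: (join_cover defG); apply: IH; rewrite -ltnS.
    exact: leq_trans (proper_card p1) Gn.
  exact: leq_trans (proper_card p2) Gn.
case: (boolP (cyclic G)) => [/cyclicP[x Gx]|nc].
  have eG : G = <[x]>%G by apply: group_inj.
  have [G1|G1] := leqP #|G| 1.
    (* The trivial group is an l-group for every prime l; 2 is an arbitrary choice. *)
    rewrite eG; apply: (cyc _ x 2) => //; rewrite -Gx.
    have : #|G| = 1%N by apply/eqP; rewrite eqn_leq G1 cardG_gt0.
    by move/card1_trivg => ->; apply: pgroup1.
  pose p := pdiv #|G|; have pp : prime p := pdiv_prime G1.
  case: (boolP (p.-group G)%g) => [pG|npG].
    by rewrite eG; apply: (cyc _ x p) => //; rewrite -Gx.
  have sub1 : <[x.`_p]>%g \subset G by rewrite Gx cycle_subG groupX ?cycle_id // mem_cycle.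
  have sub2 : <[x.`_p^']>%g \subset G by rewrite Gx cycle_subG mem_cycle.
  apply: (step <[x.`_p]>%G <[x.`_p^']>%G).
  - rewrite properEneq sub1 andbT; apply: contraNneq npG => <-.
    by rewrite /pgroup -orderE; apply: p_elt_constt.
  - rewrite properEneq sub2 andbT; apply/eqP => e.
    have : p^'.-nat #|G| by rewrite -e -orderE; apply: p_elt_constt.
    rewrite p'natE // /p pdiv_dvd //.
  apply/eqP; rewrite eqEsubset join_subG sub1 sub2 !andbT.
  rewrite {1}Gx cycle_subG -{1}(consttC p x) groupM // ?mem_gen // inE cycle_id ?orbT //.
have [M maxM] : {M : {group gT} | maxgroup M (fun H : {group gT} => H \proper G)}.
  apply: ex_maxgroup; exists 1%G; rewrite properEneq sub1G andbT.
  by apply: contraNneq nc => <-; apply: cyclic1.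
have [pM hM] := maxgroupP maxM.
have [sMG [x Gx nMx]] := properP pM.
apply: (step M <[x]>%G) => //.
  rewrite properEneq cycle_subG Gx andbT; apply: contraNneq nc => <-; exact: cycle_cyclic.
apply/eqP; rewrite eqEsubset join_subG sMG cycle_subG Gx !andbT.
apply: contraT => nGM; case/negP: nMx.
have pj : (M <*> <[x]>)%G \proper G by rewrite properE join_subG sMG cycle_subG Gx.
have := hM _ pj (joing_subl _ _) => e.
by rewrite -e mem_gen // inE cycle_id orbT.
Qed.
End Covers.

Section ClassicalUnit.
Variable R : nzRingType.
(** Invertibility decided classically equips any ring with a unit structure; it serves subrings and
    quotient rings alike. *)
Definition cl_unit : pred R := fun x => `[< exists y, y * x = 1 /\ x * y = 1 >].
Definition cl_inv (x : R) : R :=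
  if pselect (exists y, y * x = 1 /\ x * y = 1) is left e then projT1 (cid e) else x.
Lemma cl_mulVr : {in cl_unit, left_inverse 1 cl_inv *%R}.
Proof. by move=> x /asboolP hx; rewrite /cl_inv; case: pselect => // e; case: cid => y []. Qed.
Lemma cl_mulrV : {in cl_unit, right_inverse 1 cl_inv *%R}.
Proof. by move=> x /asboolP hx; rewrite /cl_inv; case: pselect => // e; case: cid => y []. Qed.
Lemma cl_unitP (x y : R) : y * x = 1 /\ x * y = 1 -> cl_unit x.
Proof. by move=> h; apply/asboolP; exists y. Qed.
Lemma cl_inv_out : {in [predC cl_unit], cl_inv =1 id}.
Proof. by move=> x /asboolP hx; rewrite /cl_inv; case: pselect. Qed.
End ClassicalUnit.

HB.instance Definition _ (L : nzRingType) (S : sub_ring L) :=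
  GRing.NzRing_hasMulInverse.Build (sr_type S) (@cl_mulVr _) (@cl_mulrV _) (@cl_unitP _) (@cl_inv_out _).

Section SubDomain.
Variables (L : idomainType) (S : sub_ring L).
Lemma sr_integral : GRing.integral_domain_axiom (sr_type S).
Proof.
move=> x y /(congr1 (@sr_val _ S)); rewrite rmorphM rmorph0 /= => /eqP.
rewrite mulf_eq0 => /orP[]/eqP h; apply/orP; [left|right]; apply/eqP/sr_val_inj; by rewrite h rmorph0.
Qed.
HB.instance Definition _ := GRing.ComUnitRing_isIntegral.Build (sr_type S) sr_integral.
End SubDomain.

Lemma monic_eq_prod (R : idomainType) (P : {poly R}) (rs : seq R) :
  size P = (size rs).+1 -> P \is monic -> all (root P) rs -> uniq rs ->
  P = \prod_(z <- rs) ('X - z%:P).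
Proof.
move=> szP mP rP urs; apply/eqP; rewrite -subr_eq0; apply/negP => /negP D0.
set Q := \prod_(z <- rs) _ in D0 *.
have szQ : size Q = (size rs).+1 by rewrite /Q size_prod_XsubC.
have := max_poly_roots D0 _ urs; rewrite ltnNge => h; suff : (size (P - Q)%R <= size rs)%N.
  move=> le; have : ~~ (size (P - Q)%R <= size rs)%N; last by rewrite le.
  apply: h; apply/allP => z zs; rewrite /root hornerD hornerN.
  have /eqP -> : root Q z by rewrite /Q root_prod_XsubC.
  by rewrite (eqP (allP rP _ zs)) subrr.
apply/leq_sizeP => j; rewrite leq_eqVlt => /predU1P[<-|lt].
  rewrite coefB; have := monic_prod_XsubC rs xpredT id; rewrite monicE lead_coefE -/Q szQ /= => /eqP ->.
  by move: mP; rewrite monicE lead_coefE szP => /eqP ->; rewrite subrr.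
by rewrite coefB !nth_default ?szP ?szQ // subrr.
Qed.

Section Cyc.
Variable F : fieldType.

(** * Cyclic covers and Artin-Schreier towers *)

Definition cyc_ax n (A : (nat -> fps F) -> Prop) :=
  [/\ forall a b, A a -> A b -> A (fun i => a i + b i),
      forall a b, A a -> A b -> A (fun i => a i * b i),
      forall a, A a -> A (fun i => a i.+1),
      forall a, A a -> forall i, a (i + n)%N = a i &
  [/\ forall p, A (fun=> p2s p),
      forall (d : {poly F}) a, d`_0 = 1 -> A (fun i => p2s d * a i) -> A a,
      forall a c, A a -> (forall i, a i = c) -> ratl c,
      exists2 a, A a & forall i, hd (a i) = (n %| i)%:R &
      forall a, A a -> a 0%N = 0 -> forall i, a i = 0]].

Definition cyc_cover n := exists A, cyc_ax n A.

Lemma cyc_split n (gT : finGroupType) (x : gT) : #[x]%g = n -> cyc_cover n ->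
  split_cover <[x]>%G F.
Proof.
move=> ox [A [add mul shift per [pol sat rat' [eps Aeps heps] dom]]].
have shiftn k a : A a -> A (fun i => a (i + k)%N).
  elim: k => [|k IH] Aa; first by under eq_fun do rewrite addn0.
  have := shift _ (IH Aa); congr A; apply: funext => i; congr a; lia.
have perm k a : A a -> forall i, a (i + k * n)%N = a i.
  move=> Aa i; elim: k => [|k IH]; first by rewrite addn0.
  by rewrite mulSn addnCA addnC per // IH.
have per_mod a : A a -> forall i j, i = j %[mod n] -> a i = a j.
  move=> Aa i j e; rewrite (divn_eq i n) (divn_eq j n) e.
  by rewrite ![(_ * n + _)%N]addnC !perm.
pose B (f : gT -> fps F) := exists2 a, A a & forall i, f (x ^+ i)%g = a i.
exists B; split; [| | |split].
- move=> f g [a Aa ha] [b Ab hb]; exists (fun i => a i + b i); first exact: add.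
  by move=> i; rewrite ha hb.
- move=> f g [a Aa ha] [b Ab hb]; exists (fun i => a i * b i); first exact: mul.
  by move=> i; rewrite ha hb.
- move=> f u /cycleP[k ->] [a Aa ha]; exists (fun i => a (i + k)%N); first exact: shiftn.
  by move=> i; rewrite -expgD addnC ha.
- by move=> p; exists (fun=> p2s p).
- move=> f c [a Aa ha] fc; apply: (rat' a) => // i; rewrite -ha fc // mem_cycle //.
- have h g : exists v, forall i, (x ^+ i)%g = g -> v = eps i.
    case: (pselect (exists i, (x ^+ i)%g = g)) => [[i <-]|n']; last first.
      by exists 0 => i e; case: n'; exists i.
    exists (eps i) => j e; apply: per_mod => //; apply/eqP; rewrite -ox -eq_expg_mod_order e //.
  have [f hf] := choice h; exists f.
    by exists eps => // i; apply: hf.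
  move=> g /cycleP[i ->]; rewrite (hf _ i erefl) heps -ox order_dvdn //.
- move=> f [a Aa ha] f1 g /cycleP[i ->]; rewrite ha (dom a) //.
  by rewrite -ha expg0.
Qed.

Definition rat_const (a : nat -> fps F) := exists2 c, ratl c & forall i, a i = c.

Lemma cyc_const : cyc_ax 1 rat_const.
Proof.
split; [| | | |split].
- move=> a b [c rc hc] [d rd hd']; exists (c + d); first exact: ratD.
  by move=> i; rewrite hc hd'.
- move=> a b [c rc hc] [d rd hd']; exists (c * d); first exact: ratM.
  by move=> i; rewrite hc hd'.
- by move=> a [c rc hc]; exists c.
- by move=> a [c rc hc] i; rewrite !hc.
- by move=> p; exists (p2s p) => //; apply: rat_poly.
- move=> d a d0 [c [e [p [e0 h]]] hc]; exists (a 0%N).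
    by exists (e * d), p; rewrite coef0M e0 d0 mulr1; split=> //; rewrite rmorphM -mulrA /= hc.
  by move=> i; apply: (mulfI (p2s_neq0 d0)); rewrite !hc.
- by move=> a c [c' rc hc] h; rewrite -(h 0%N) hc.
- exists (fun=> 1); first by exists 1 => //; rewrite -(rmorph1 (@p2s F)); apply: rat_poly.
  by move=> i; rewrite rmorph1 dvd1n.
- by move=> a [c rc hc] a0 i; rewrite hc -(hc 0%N).
Qed.

Lemma cyc_trivial : cyc_cover 1.
Proof. by exists rat_const; apply: cyc_const. Qed.

Section ArtinSchreier.
Variables (p n : nat) (A : (nat -> fps F) -> Prop).
Hypotheses (pc : p \in [pchar F]) (n0 : (0 < n)%N) (axA : cyc_ax n A).
Variables (a b : nat -> fps F).
Hypotheses (Aa : A a) (Ab : A b).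
Hypothesis trb : forall j, \sum_(i < n) b (j + i)%N = 1.
Hypothesis ab : forall j, a j.+1 - a j = b j ^+ p - b j.
Hypothesis a00 : hd (a 0%N) = 0.

Let pp : prime p := pcharf_prime pc.
Let pcS : p \in [pchar (fps F)] := rmorph_pchar kc pc.
Lemma frobB (x y : fps F) : (x - y) ^+ p = x ^+ p - y ^+ p.
Proof.
by rewrite exprDn_pchar ?exprNn_pchar // pnatE.
Qed.
Lemma frobD (x y : fps F) : (x + y) ^+ p = x ^+ p + y ^+ p.
Proof. by rewrite exprDn_pchar // pnatE. Qed.
Lemma frob_nat i : (i%:R : fps F) ^+ p = i%:R.
Proof. by rewrite -(pFrobenius_autE pcS) pFrobenius_aut_nat. Qed.

Lemma as_root : exists2 x0 : fps F, hd x0 = 0 & x0 ^+ p - x0 = a 0%N.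
Proof.
have p0 := prime_gt0 pp.
have [||x0 h0 hx] := hensel (P := 'X^p - 'X - (a 0%N)%:P).
- by rewrite !hornerE expr0n eqn0Ngt p0 /= !sub0r oppr0 rmorphB rmorph0 /= a00 subr0.
- rewrite !derivB derivXn derivX derivC subr0 hornerD hornerN hornerMn (mulrn_pchar pcS).
  by rewrite hornerC sub0r rmorphN rmorph1 oppr_eq0 oner_neq0.
exists x0 => //; apply/eqP; rewrite -subr_eq0; move/eqP: hx; rewrite !hornerE //.
Qed.

Variable x0 : fps F.
Hypotheses (hx0 : hd x0 = 0) (x0p : x0 ^+ p - x0 = a 0%N).
(** The conjugates of [x0] under a generator: each step adds a term of b, and as b has trace 1, n
    steps add 1. The generator thus has order n p. *)
Definition as_x j := x0 + \sum_(i < j) b i.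
Notation x := as_x.
Lemma x_S j : x j.+1 = x j + b j.
Proof. by rewrite /x big_ord_recr addrA. Qed.
Lemma x_p j : x j ^+ p - x j = a j.
Proof.
elim: j => [|j IH]; first by rewrite /x big_ord0 addr0.
rewrite x_S frobD -[a j.+1](subrK (a j)) ab -IH; ring.
Qed.
Lemma x_n j : x (j + n)%N = x j + 1.
Proof.
rewrite -(trb j) /x -addrA; congr (_ + _).
elim: n => [|k IH]; first by rewrite addn0 big_ord0 addr0.
by rewrite addnS big_ord_recr IH big_ord_recr /= addrA.
Qed.
Lemma x_kn k j : x (j + k * n)%N = x j + k%:R.
Proof.
elim: k => [|k IH]; first by rewrite addn0 addr0.
have -> : (j + k.+1 * n = (j + k * n) + n)%N by rewrite mulSn; lia.
by rewrite x_n IH -addrA natr1.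
Qed.

Inductive as_cover : (nat -> fps F) -> Prop :=
| AsBase f : A f -> as_cover f
| AsX : as_cover x
| AsAdd f g : as_cover f -> as_cover g -> as_cover (fun i => f i + g i)
| AsMul f g : as_cover f -> as_cover g -> as_cover (fun i => f i * g i).

Definition as_nf (f : nat -> fps F) := exists al : nat -> nat -> fps F,
  (forall k, A (al k)) /\ forall j, f j = \sum_(k < p) al k j * x j ^+ k.
Lemma as_nf_ext f g : f =1 g -> as_nf f -> as_nf g.
Proof. by move=> /funext ->. Qed.
Let addA : forall a b, A a -> A b -> A (fun i => a i + b i). Proof. by case: axA. Qed.
Let mulA : forall a b, A a -> A b -> A (fun i => a i * b i). Proof. by case: axA. Qed.
Let polA : forall p, A (fun=> p2s p). Proof. by case: axA => _ _ _ _ []. Qed.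
Lemma A0 : A (fun=> 0).
Proof. by have := polA 0; congr A; apply: funext => i; rewrite rmorph0. Qed.
Lemma A1 : A (fun=> 1).
Proof. by have := polA 1; congr A; apply: funext => i; rewrite rmorph1. Qed.
Lemma AN f : A f -> A (fun i => - f i).
Proof.
by move=> Af; have := mulA (polA (-1)) Af; congr A; apply: funext => i; rewrite rmorphN1 mulN1r.
Qed.
Lemma AX f k : A f -> A (fun i => f i ^+ k).
Proof.
move=> Af; elim: k => [|k IH]; first exact: A1.
by have := mulA Af IH; congr A; apply: funext => i; rewrite exprS.
Qed.
Lemma as_nf_base f : A f -> as_nf f.
Proof.
move=> Af; exists (fun k => if k == 0%N then f else fun=> 0); split=> [k|j].
  by case: eqP => _ //; apply: A0.
case: p pp => // q _; rewrite big_ord_recl /= expr0 mulr1 big1 ?addr0 // => k _.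
by rewrite mul0r.
Qed.
Lemma as_nf_add f g : as_nf f -> as_nf g -> as_nf (fun i => f i + g i).
Proof.
move=> [al [hal hf]] [be [hbe hg]]; exists (fun k i => al k i + be k i); split=> [k|j].
  exact: addA.
by rewrite hf hg -big_split; apply: eq_bigr => k _; rewrite mulrDl.
Qed.
Lemma as_nf_scale f g : A g -> as_nf f -> as_nf (fun i => g i * f i).
Proof.
move=> Ag [al [hal hf]]; exists (fun k i => g i * al k i); split=> [k|j]; first exact: mulA.
by rewrite hf mulr_sumr; apply: eq_bigr => k _; rewrite mulrA.
Qed.
Lemma as_nf_X f : as_nf f -> as_nf (fun i => x i * f i).
Proof.
move=> [al [hal hf]]; have p1 := prime_gt1 pp.
pose last := al p.-1.
exists (fun k i => (if k is k'.+1 then al k' i else 0) +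
   ((if k == 0%N then last i * a i else 0) + (if k == 1%N then last i else 0))).
split=> [k|j].
  apply: addA; first by case: k => [|k]; [exact: A0 | exact: hal].
  apply: addA; case: eqP => _; try exact: A0; [apply: mulA => //; exact: hal | exact: hal].
rewrite hf mulr_sumr /last; have := x_p j.
case: p pp p1 => [|[|q]] // _ _ /= xp.
under [RHS]eq_bigr do rewrite mulrDl.
rewrite big_split /= [in RHS]big_ord_recl /= mul0r add0r big_ord_recr /=.
congr (_ + _).
  by apply: eq_bigr => k _; rewrite /bump /= add1n exprS; ring.
rewrite big_ord_recl big_ord_recl /= big1 => [|k _]; last by rewrite !addr0 mul0r.
rewrite mulrCA -exprS -[x j ^+ q.+2](subrK (x j)) xp /bump /= !addr0 add0r expr0 expr1; ring.
Qed.
Lemma as_nf_mul f g : as_nf f -> as_nf g -> as_nf (fun i => f i * g i).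
Proof.
move=> [al [hal hf]] ng.
have nX k : as_nf (fun i => x i ^+ k * g i).
  elim: k => [|k IH]; first by apply: as_nf_ext ng => i; rewrite mul1r.
  by apply: as_nf_ext (as_nf_X IH) => i; rewrite exprS mulrA.
suff h N : as_nf (fun i => \sum_(k < N) al k i * (x i ^+ k * g i)).
  apply: as_nf_ext (h p) => i; rewrite hf mulr_suml; apply: eq_bigr => k _.
  by rewrite mulrA.
elim: N => [|N IH]; first by apply: as_nf_ext (as_nf_base A0) => i; rewrite big_ord0.
by apply: as_nf_ext (as_nf_add IH (as_nf_scale (hal N) (nX N))) => i; rewrite big_ord_recr.
Qed.
Lemma as_normal f : as_cover f -> as_nf f.
Proof.
elim=> {f} [f|||]; [exact: as_nf_base| | |].
- by apply: as_nf_ext (as_nf_X (as_nf_base A1)) => i; rewrite mulr1.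
- by move=> f g _ nf _ ng; apply: as_nf_add.
- by move=> f g _ nf _ ng; apply: as_nf_mul.
Qed.

Hypothesis nosol : forall u v, A u -> A v -> u 0%N != 0 -> u 0%N * x0 != v 0%N.

Let shiftA : forall f, A f -> A (fun i => f i.+1). Proof. by case: axA. Qed.
Let perA : forall f, A f -> forall i, f (i + n)%N = f i. Proof. by case: axA. Qed.
Let satA : forall (d : {poly F}) f, d`_0 = 1 -> A (fun i => p2s d * f i) -> A f.
Proof. by case: axA => _ _ _ _ []. Qed.
Let ratA : forall f c, A f -> (forall i, f i = c) -> ratl c.
Proof. by case: axA => _ _ _ _ []. Qed.
Let domA : forall f, A f -> f 0%N = 0 -> forall i, f i = 0.
Proof. by case: axA => _ _ _ _ []. Qed.

(** A copy of [A] inside F[[T]], since a member of [A] is determined by its value at index 0. *)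
Definition ring0 : sub_ring (fps F).
Proof.
exists (fun u => exists2 f, A f & f 0%N = u).
- by exists (fun=> 1) => //; apply: A1.
- by move=> _ _ [f Af <-] [g Ag <-]; exists (fun i => f i - g i) => //; apply: addA => //; apply: AN.
- by move=> _ _ [f Af <-] [g Ag <-]; exists (fun i => f i * g i) => //; apply: mulA.
Defined.

Lemma nat_inj i j : (i < p)%N -> (j < p)%N -> i%:R = j%:R :> fps F -> i = j.
Proof.
wlog le : i j / (i <= j)%N => [hw ip jp e|].
  have [le|/ltnW le] := leqP i j; first exact: hw.
  by apply/esym; apply: hw.
move=> ip jp /eqP; rewrite eq_sym -subr_eq0 -natrB // -(dvdn_pcharf pcS).
have [/eqP|pos] := posnP (j - i)%N; first by rewrite subn_eq0 => ji _; apply/eqP; rewrite eqn_leq le.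
by move/(dvdn_leq pos); rewrite leqNgt (leq_ltn_trans (leq_subr i j) jp).
Qed.

Lemma as_poly_prod : 'X^p - 'X - (a 0%N)%:P = \prod_(i : 'I_p) ('X - (x0 + (nat_of_ord i)%:R)%:P).
Proof.
set P := (X in X = _); have p1 := prime_gt1 pp.
have szP : size P = p.+1.
  rewrite /P -addrA size_polyDl size_polyXn // -opprD size_polyN size_XaddC; exact: p1.
pose rs := [seq x0 + (nat_of_ord i)%:R | i <- enum 'I_p].
have -> : \prod_(i : 'I_p) ('X - (x0 + (nat_of_ord i)%:R)%:P) = \prod_(z <- rs) ('X - z%:P).
  by rewrite big_map big_enum.
apply: monic_eq_prod.
- by rewrite size_map -cardE card_ord.
- by rewrite monicE lead_coefE szP /P !coefB coefXn coefX coefC eqxx; case: p p1 => [|[|q]] //= _; rewrite !subr0.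
- apply/allP => _ /mapP[i _ ->]; rewrite /root /P !hornerE frobD frob_nat.
  by rewrite -x0p; apply/eqP; ring.
rewrite map_inj_uniq ?enum_uniq // => i j /addrI /nat_inj e.
by apply/val_inj/e.
Qed.

(** The Artin-Schreier alternative: a factor of X^p - X - a with d roots x0 + i, 0 < d < p, has
    second coefficient -(d x0 + an integer). As d is invertible, x0 would be a fraction over [A],
    against [nosol]. *)
Lemma as_indep (al : nat -> nat -> fps F) : (forall k, A (al k)) -> \sum_(k < p) al k 0%N * x0 ^+ k = 0 ->
  forall k, (k < p)%N -> al k 0%N = 0.
Proof.
move=> hal h0.
have hA k : ring0 (al k 0%N) by exists (al k).
pose r : {poly sr_type ring0} := \poly_(k < p) to_sr (hA k).
have rE : map_poly (@sr_val _ ring0) r = \poly_(k < p) al k 0%N.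
  by apply/polyP => k; rewrite coef_map !coef_poly /=; case: ifP.
suff r0 : r = 0.
  move=> k kp; have := congr1 (fun q : {poly fps F} => q`_k) rE.
  by rewrite r0 rmorph0 coef0 coef_poly kp.
apply/eqP/negP => /negP r0.
have ha0 : ring0 (a 0%N) by exists a.
pose Q : {poly sr_type ring0} := 'X^p - 'X - (to_sr ha0)%:P.
have QE : map_poly (@sr_val _ ring0) Q = \prod_(i in [set: 'I_p]) ('X - (x0 + (nat_of_ord i)%:R)%:P).
  under eq_bigl do rewrite inE.
  by rewrite -as_poly_prod /Q !rmorphB /= map_polyXn map_polyX map_polyC.
have inj0 := @sr_val_inj _ ring0.
have p0 := prime_gt0 pp.
have yinj : {in [set: 'I_p] &, injective (fun i : 'I_p => x0 + (nat_of_ord i)%:R)}.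
  by move=> i j _ _ /addrI/nat_inj e; apply/val_inj/e.
have szQ : size Q = p.+1.
  rewrite -(size_map_inj_poly inj0 (rmorph0 _)) QE -big_enum size_prod_XsubC -cardE cardsT card_ord //.
have [||S [c [q [SJ S0 c0 hq]]]] := min_factor inj0 yinj (in_setT (Ordinal p0)) QE r0.
- by rewrite szQ ltnS size_poly.
- by rewrite rE horner_poly addr0.
have Sp : (#|S| < p)%N by have := proper_card SJ; rewrite cardsT card_ord.
have S1 : (0 < #|S|)%N by apply/card_gt0P; exists (Ordinal p0).
pose d := #|S|; have dn0 : d%:R != 0 :> fps F.
  apply/negP; rewrite -(dvdn_pcharf pcS) => /(dvdn_leq S1); by rewrite leqNgt Sp.
pose rs := [seq x0 + (nat_of_ord i)%:R | i in S].
have hc : sr_val q`_d.-1 = - (sr_val c * (d%:R * x0 + \sum_(i in S) (nat_of_ord i)%:R)).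
  have := congr1 (fun P : {poly fps F} => P`_d.-1) hq.
  rewrite coef_map /= coefCM => ->.
  have -> : \prod_(i in S) ('X - (x0 + (nat_of_ord i)%:R)%:P) = \prod_(z <- rs) ('X - z%:P).
    by rewrite big_image.
  have -> : d = size rs by rewrite size_image.
  rewrite coefPn_prod_XsubC ?size_image -?lt0n // mulrN big_image /= big_split /= sumr_const.
  by rewrite mulr_natl.
have [f Af hf] := sr_in_val c; have [g Ag hg] := sr_in_val q`_d.-1.
have Asum : A (fun=> \sum_(i in S) (nat_of_ord i)%:R).
  have := polA (\sum_(i in S) (nat_of_ord i)%:R); congr A; apply: funext => i.
  by rewrite rmorph_sum; apply: eq_bigr => j _; rewrite rmorph_nat.
have Ad : A (fun=> d%:R).
  by have := polA d%:R; congr A; apply: funext => i; rewrite rmorph_nat.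
have := nosol (mulA Ad Af) (addA (AN Ag) (AN (mulA Af Asum))).
have vc0 : sr_val c != 0 by apply/eqP => z; case/eqP: c0; apply: inj0; rewrite z rmorph0.
rewrite hf hg hc (mulf_neq0 dn0 vc0).
by move/(_ isT)/eqP; apply; ring.
Qed.

Lemma as_x_hd k : hd (x (k * n)%N) = k%:R.
Proof. by rewrite -[(k * n)%N]add0n x_kn /x big_ord0 addr0 rmorphD rmorph_nat /= hx0 add0r. Qed.

Theorem as_cyc : cyc_cover (n * p).
Proof.
exists as_cover; split; [exact: AsAdd | exact: AsMul | | | split].
- move=> f; elim=> {f} [f Af||f g _ h1 _ h2|f g _ h1 _ h2].
  + by apply: AsBase; apply: shiftA.
  + have := AsAdd AsX (AsBase Ab); congr as_cover; apply: funext => i; by rewrite x_S.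
  + exact: AsAdd h1 h2.
  + exact: AsMul h1 h2.
- move=> f; elim=> {f} [f Af||f g _ h1 _ h2|f g _ h1 _ h2] i.
  + rewrite mulnC; elim: (X in (X * n)%N) => [|k IH]; first by rewrite addn0.
    by rewrite mulSn addnCA addnC perA.
  + by rewrite mulnC x_kn (pcharf0 pcS) addr0.
  + by rewrite h1 h2.
  + by rewrite h1 h2.
- by move=> q; apply: AsBase.
- move=> d f d0 /as_normal[al [hal hf]].
  have du : p2s d \is a GRing.unit by apply: fps_unit_hd; rewrite hd_p2s.
  have hA k : as_cover (fun i => (p2s d)^-1 * al k i).
    apply: AsBase; apply: (satA d0); have := hal k; congr A; apply: funext => i.
    by rewrite mulrA mulrV // mul1r.
  have hX k : as_cover (fun i => x i ^+ k).
    elim: k => [|k IH]; first exact: AsBase A1.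
    by have := AsMul AsX IH; congr as_cover; apply: funext => i; rewrite exprS.
  have hs N : as_cover (fun i => \sum_(k < N) (p2s d)^-1 * al k i * x i ^+ k).
    elim: N => [|N IH].
      by have := AsBase A0; congr as_cover; apply: funext => i; rewrite big_ord0.
    have := AsAdd IH (AsMul (hA N) (hX N)); congr as_cover; apply: funext => i.
    by rewrite big_ord_recr.
  have := hs p; congr as_cover; apply: funext => i.
  apply: (mulrI du); rewrite hf mulr_sumr; apply: eq_bigr => k _.
  by rewrite !mulrA mulrV // mul1r.
- move=> f c /as_normal[al [hal hf]] fc; apply: (ratA (hal 0%N)) => j.
  (* Moving j by multiples of n fixes the coefficients and takes x through p distinct values, all of
     them roots of Q. *)
  pose Q : {poly fps F} := \poly_(k < p) al k j - c%:P.
  have szQ : (size Q <= p)%N.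
    rewrite (leq_trans (size_polyD _ _)) // geq_max size_poly size_polyN.
    by rewrite (leq_trans (size_polyC_leq1 _)) // prime_gt0.
  have al_n k m : al k (j + m * n)%N = al k j.
    elim: m => [|m IH]; first by rewrite addn0.
    by rewrite mulSn addnCA addnC perA.
  have Q0 : Q = 0.
    apply/eqP; apply: contraTT szQ => nQ; rewrite -ltnNge.
    have := @max_poly_roots _ Q [seq x j + i%:R | i <- iota 0 p] nQ.
    rewrite size_map size_iota; apply.
      apply/allP => _ /mapP[i _ ->]; rewrite /root hornerD hornerN hornerC horner_poly.
      rewrite -(fc (j + i * n)%N) hf x_kn subr_eq0; apply/eqP; apply: eq_bigr => k _.
      by rewrite al_n.
    rewrite map_inj_in_uniq ?iota_uniq // => i i'; rewrite !mem_iota /= => h1 h2 /addrI.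
    exact: nat_inj.
  have := congr1 (fun P : {poly fps F} => P`_0) Q0.
  by rewrite coefB coef_poly coefC coef0 prime_gt0 //= => /eqP; rewrite subr_eq0 => /eqP.
- have [eps Aeps heps] : exists2 e, A e & forall i, hd (e i) = (n %| i)%:R.
    by case: axA => _ _ _ _ [].
  have hX k : as_cover (fun i => x i ^+ k).
    elim: k => [|k IH]; first exact: AsBase A1.
    by have := AsMul AsX IH; congr as_cover; apply: funext => i; rewrite exprS.
  (* At T = 0 the value of x at k n is k, and 1 - k^(p-1) is the indicator of p dividing k. *)
  exists (fun i => eps i * (1 + (-1) * x i ^+ p.-1)).
    apply: AsMul; first exact: AsBase; apply: AsAdd; first exact: AsBase A1.
    by apply: AsMul => //; apply: AsBase; have := AN A1.
  move=> j; rewrite rmorphM rmorphD rmorphM rmorphXn rmorph1 rmorphN1 /= heps.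
  case: (boolP (n %| j)%N) => [/dvdnP[k ->]|ndv]; last first.
    rewrite mul0r; case: (boolP (n * p %| j)%N) => // dv; case/negP: ndv.
    by apply: dvdn_trans dv; apply: dvdn_mulr.
  rewrite as_x_hd mul1r [(k * n)%N]mulnC dvdn_pmul2l // (dvdn_pcharf pc).
  have := pFrobenius_aut_nat pc k; rewrite pFrobenius_autE.
  have [->|kn] := eqVneq (k%:R : F) 0.
    have := prime_gt1 pp; case: p => [|[|q]] // _ _.
    by rewrite expr0n /= mulr0 addr0.
  rewrite -{1}(prednK (prime_gt0 pp)) exprS -[RHS]mulr1 => /(mulfI kn) ->.
  by rewrite mulr1 subrr.
- move=> f /as_normal[al [hal hf]] f0 j.
  rewrite hf big1 // => k _; rewrite (domA (hal k)) ?mul0r //.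
  apply: (as_indep hal _ (ltn_ord k)); rewrite -[RHS]f0 hf.
  by apply: eq_bigr => i _; rewrite /x big_ord0 addr0.
Qed.
End ArtinSchreier.
End Cyc.

Lemma sum_period (R : zmodType) (f : nat -> R) n j : (forall i, f (i + n)%N = f i) ->
  \sum_(i < n) f (j + i)%N = \sum_(i < n) f i.
Proof.
move=> per; elim: j => [//|j <-].
have := erefl (\sum_(i < n.+1) f (j + i)%N).
rewrite {1}big_ord_recl /= big_ord_recr /= per addn0 => h.
apply: (addrI (f j)); rewrite [RHS]addrC -h; congr (_ + _).
by apply: eq_bigr => i _; rewrite /bump /= add1n addSnnS.
Qed.

Section CycStep.
Variables (F : fieldType) (n : nat) (A : (nat -> fps F) -> Prop).
Hypotheses (n0 : (0 < n)%N) (axA : cyc_ax n A).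
Let addA : forall a b, A a -> A b -> A (fun i => a i + b i). Proof. by case: axA. Qed.
Let mulA : forall a b, A a -> A b -> A (fun i => a i * b i). Proof. by case: axA. Qed.
Let polA : forall p, A (fun=> p2s p). Proof. by case: axA => _ _ _ _ []. Qed.
Let shiftA : forall f, A f -> A (fun i => f i.+1). Proof. by case: axA. Qed.
Let perA : forall f, A f -> forall i, f (i + n)%N = f i. Proof. by case: axA. Qed.
Let domA : forall f, A f -> f 0%N = 0 -> forall i, f i = 0.
Proof. by case: axA => _ _ _ _ []. Qed.

Lemma cyc_shiftn f k : A f -> A (fun i => f (i + k)%N).
Proof.
elim: k => [|k IH] Af; first by under eq_fun do rewrite addn0.
have := shiftA (IH Af); congr A; apply: funext => i; congr f; lia.
Qed.

Lemma cyc_big (I : Type) (r : seq I) (f : I -> nat -> fps F) :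
  (forall k, A (f k)) -> A (fun i => \sum_(k <- r) f k i).
Proof.
move=> Af; elim: r => [|k r IH].
  by have := A0 axA; congr A; apply: funext => i; rewrite big_nil.
by have := addA (Af k) IH; congr A; apply: funext => i; rewrite big_cons.
Qed.

(** The trace of [eps] is rational with value 1 at T = 0, so that [eps] can be divided by it. *)
Lemma trace_one : exists2 b, A b & forall j, \sum_(i < n) b (j + i)%N = 1.
Proof.
have [eps Aeps heps] : exists2 e, A e & forall i, hd (e i) = (n %| i)%:R.
  by case: axA => _ _ _ _ [].
pose c := \sum_(i < n) eps i.
have tr j : \sum_(i < n) eps (j + i)%N = c by apply: sum_period; apply: perA.
have [e [q [e0 hq]]] : ratl c.
  have ratA : forall f c, A f -> (forall i, f i = c) -> ratl c by case: axA => _ _ _ _ [].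
  by apply: ratA tr; apply: cyc_big => k; apply: cyc_shiftn.
have q0 : q`_0 = 1.
  rewrite -hd_p2s -hq rmorphM /= hd_p2s e0 mul1r /c rmorph_sum /= -(prednK n0) big_ord_recl.
  rewrite heps dvdn0 big1 ?addr0 // => i _; rewrite heps gtnNdvd //; case: i => i /=.
  rewrite /bump; lia.
have qu : p2s q \is a GRing.unit by apply: fps_unit_hd; rewrite hd_p2s q0.
exists (fun i => (p2s q)^-1 * (p2s e * eps i)).
  have sat : forall (d : {poly F}) a, d`_0 = 1 -> A (fun i => p2s d * a i) -> A a.
    by case: axA => _ _ _ _ [].
  apply: (sat _ _ q0); have := mulA (polA e) Aeps; congr A; apply: funext => i.
  by rewrite mulrA mulrV // mul1r.
by move=> j; rewrite -!mulr_sumr tr hq mulVr.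
Qed.

(** Additive Hilbert 90, by the usual sum weighted with an element of trace 1. Subtracting a
    constant keeps the differences and makes [a] vanish at T = 0, as Hensel's lemma for x^p - x = a
    requires. *)
Lemma hilbert90 b beta : A b -> (forall j, \sum_(i < n) b (j + i)%N = 1) ->
  A beta -> (forall j, \sum_(i < n) beta (j + i)%N = 0) ->
  exists2 a, A a & (forall j, a j.+1 - a j = beta j) /\ hd (a 0%N) = 0.
Proof.
move=> Ab trb Abeta trbeta.
pose S i j := \sum_(l < i) beta (j + l)%N.
pose a j := - \sum_(i < n) S i j * b (j + i)%N.
have SS i j : S i j.+1 = S i.+1 j - beta j.
  rewrite /S big_ord_recl addn0 addrC addKr; apply: eq_bigr => l _.
  by rewrite addSnnS.
have aS j : a j.+1 - a j = beta j.
  rewrite /a opprK.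
  have -> : \sum_(i < n) S i j.+1 * b (j.+1 + i)%N =
     \sum_(i < n) S i.+1 j * b (j + i.+1)%N - beta j.
    under eq_bigr do rewrite SS mulrBl.
    rewrite sumrB -mulr_sumr trb mulr1; congr (_ - _); apply: eq_bigr => i _.
    by rewrite addSnnS.
  have := erefl (\sum_(i < n.+1) S i j * b (j + i)%N).
  rewrite {1}big_ord_recl /= big_ord_recr /= [S n j]trbeta mul0r addr0 {1}/S big_ord0 mul0r add0r.
  move=> <-; under [X in _ + X]eq_bigr do rewrite /bump /= add1n.
  ring.
exists (fun j => a j - p2s (hd (a 0%N))%:P); last first.
  split=> [j|]; first by rewrite -(aS j); ring.
  by rewrite rmorphB /= hd_p2s coefC subrr.
apply: addA; last by apply: (AN axA).
apply: (AN axA); apply: cyc_big => k; apply: mulA; last exact: cyc_shiftn.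
by apply: cyc_big => l; apply: cyc_shiftn.
Qed.

Variables (p : nat).
Hypothesis pc : p \in [pchar F].
Let pp : prime p := pcharf_prime pc.
Let pcS : p \in [pchar (fps F)] := rmorph_pchar kc pc.

Lemma frob_ratio (y u : fps F) : u != 0 -> y ^+ p = u ^+ p.-1 * y -> exists k, y = k%:R * u.
Proof.
move=> u0 hy; have p1 := prime_gt1 pp.
pose P : {poly fps F} := 'X^p - u ^+ p.-1 *: 'X.
have szX : (size (- (u ^+ p.-1 *: 'X) : {poly fps F}) <= 2)%N.
  by rewrite size_polyN (leq_trans (size_scale_leq _ _)) // size_polyX.
have szP : size P = p.+1 by rewrite /P size_polyDl size_polyXn // (leq_ltn_trans szX).
pose rs := [seq (nat_of_ord i)%:R * u | i <- enum 'I_p].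
have e : P = \prod_(z <- rs) ('X - z%:P).
  apply: monic_eq_prod.
  - by rewrite szP size_map -cardE card_ord.
  - rewrite monicE lead_coefE szP /P /= coefB coefXn coefZ coefX eqxx.
    by case: p p1 => [|[|q]] //= _; rewrite mulr0 subr0.
  - apply/allP => _ /mapP[i _ ->]; rewrite /root /P hornerD hornerN hornerXn hornerZ hornerX exprMn (frob_nat pc).
    by rewrite mulrCA -exprSr prednK ?prime_gt0 // subrr.
  rewrite map_inj_uniq ?enum_uniq // => i j /(mulIf u0) /(nat_inj pc) h.
  by apply/val_inj/h.
have : root P y by rewrite /root /P hornerD hornerN hornerXn hornerZ hornerX hy subrr.
by rewrite e root_prod_XsubC => /mapP[i _ ->]; exists i.
Qed.

(** If x0 = v/u over [A], the difference x_j - v_j/u_j grows by one constant k of the prime field at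
    each step. After n steps it is n k = 0, as p divides n; but it is 1 by periodicity of u and v.
    The first layer, with n = 1, is treated by degrees. *)
Lemma as_step : (p %| n)%N -> cyc_cover F (n * p).
Proof.
move=> pn; have [b Ab trb] := trace_one.
have Abeta : A (fun i => b i ^+ p - b i) by apply: addA; [apply: (AX axA) | apply: (AN axA)].
have trbeta j : \sum_(i < n) (b (j + i)%N ^+ p - b (j + i)%N) = 0.
  rewrite sumrB trb; have := rmorph_sum (pFrobenius_aut pcS) (index_enum 'I_n) xpredT (fun i => b (j + i)%N).
  rewrite trb rmorph1 /= => h; apply/eqP; rewrite subr_eq0 {1}h; apply/eqP.
  by apply: eq_bigr => i _; rewrite pFrobenius_autE.
have [a Aa [ab a0]] := hilbert90 Ab trb Abeta trbeta.
have [x0 hx0 x0p] := as_root pc a0.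
apply: (as_cyc pc n0 axA Aa Ab trb ab hx0 x0p) => u v Au Av u0; apply/negP => /eqP uv.
pose x := as_x b x0.
have xS j : x j.+1 = x j + b j by apply: x_S.
have xp j : x j ^+ p - x j = a j by apply: (x_p pc ab x0p).
have xx0 : x 0%N = x0 by rewrite /x /as_x big_ord0 addr0.
have eqw : forall j, v j ^+ p - v j * u j ^+ p.-1 - a j * u j ^+ p = 0.
  apply: domA.
    apply: addA; [apply: addA; [exact: (AX axA)|]|]; apply: (AN axA); apply: mulA => //; exact: (AX axA).
  by rewrite -uv -x0p exprMn -(prednK (prime_gt0 pp)) exprS; ring.
have un0 j : u j != 0.
  apply: contraNneq u0 => uj; have := domA (cyc_shiftn j Au) uj (j * n.-1)%N.
  have -> : (j * n.-1 + j = j * n)%N by rewrite addnC -mulnS prednK.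
  move=> <-; apply/eqP; elim: {uj}j => [//|j ->]; by rewrite mulSn addnC perA.
pose dl j := u j * x j - v j.
have dl0 : dl 0%N = 0 by rewrite /dl xx0 uv subrr.
have dlp j : dl j ^+ p = u j ^+ p.-1 * dl j.
  rewrite /dl (frobB pc) exprMn -[x j ^+ p](subrK (x j)) xp.
  have := eqw j; move/eqP; rewrite subr_eq0 subr_eq => /eqP ->.
  rewrite -(prednK (prime_gt0 pp)) exprS; ring.
have [k hk] := frob_ratio (un0 1%N) (dlp 1%N).
have step : forall j, u j * u j.+1 * b j - (v j.+1 * u j - v j * u j.+1) - k%:R * (u j * u j.+1) = 0.
  have Au1 := shiftA Au; have Av1 := shiftA Av.
  have Ak : A (fun=> k%:R).
    by have := polA k%:R; congr A; apply: funext => i; rewrite rmorph_nat.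
  apply: domA.
    apply: addA; last by apply: (AN axA); do 2!apply: mulA => //.
    apply: addA; first by do 2!apply: mulA => //.
    apply: (AN axA); apply: addA; first exact: mulA.
    by apply: (AN axA); apply: mulA.
  move: hk dl0; rewrite /dl xS xx0 => hk dl0.
  have -> : u 0%N * u 1%N * b 0%N - (v 1%N * u 0%N - v 0%N * u 1%N) - k%:R * (u 0%N * u 1%N) =
    (u 1%N * (x0 + b 0%N) - v 1%N) * u 0%N - (u 0%N * x0 - v 0%N) * u 1%N - k%:R * (u 0%N * u 1%N) by ring.
  by rewrite hk dl0; ring.
have dlj j : dl j = (j * k)%:R * u j.
  elim: j => [|j IH]; first by rewrite dl0 mul0r.
  apply: (mulfI (un0 j)).
  have -> : u j * dl j.+1 = dl j * u j.+1 + (u j * u j.+1 * b j - (v j.+1 * u j - v j * u j.+1)).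
    by rewrite /dl xS; ring.
  move/eqP: (step j); rewrite subr_eq0 => /eqP ->; rewrite IH mulSn natrD; ring.
have := dlj n; rewrite natrM (_ : n%:R = 0) ?mul0r; last by apply/eqP; rewrite -(dvdn_pcharf pcS).
rewrite /dl (_ : x n = x0 + 1); last by rewrite -xx0; apply: (x_n trb x0 0).
rewrite (perA Au 0) (perA Av 0) mulrDr uv mulr1 addrC addKr.
by move/eqP; rewrite (negPf u0).
Qed.
End CycStep.

(** For x = Q/P this is x^p - x = T. The left side has degree at most p deg P if deg Q <= deg P, and
    exactly p deg Q otherwise; the right side has degree p deg P + 1. *)
Lemma as_no_poly (F : fieldType) p (P Q : {poly F}) : (1 < p)%N -> P != 0 ->
  Q ^+ p - Q * P ^+ p.-1 <> 'X * P ^+ p.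
Proof.
move=> p1 P0 e; have Q0 : Q != 0.
  apply: contra_eq_neq e => ->; rewrite mul0r subr0 expr0n -[p]prednK ?(ltnW p1) //= eq_sym.
  by rewrite mulf_neq0 ?polyX_eq0 ?expf_neq0.
have sz (R : {poly F}) : R != 0 -> size R = (size R).-1.+1 by rewrite -size_poly_gt0 => /prednK.
have szX (R : {poly F}) k : R != 0 -> size (R ^+ k) = ((size R).-1 * k).+1.
  by move=> R0; rewrite -size_exp -sz ?expf_neq0.
have szr : size ('X * P ^+ p) = ((size P).-1 * p).+2.
  by rewrite size_mul ?polyX_eq0 ?expf_neq0 // size_polyX szX.
have szm : size (- (Q * P ^+ p.-1)) = ((size Q).-1 + (size P).-1 * p.-1).+1.
  by rewrite size_polyN size_mul ?expf_neq0 // szX // (sz Q) //= addnS.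
have := szr; rewrite -e; have [le|lt] := leqP (size Q).-1 (size P).-1.
  have := leq_mul le (leqnn p.-1); have := size_polyD (Q ^+ p) (- (Q * P ^+ p.-1)).
  rewrite szX // szm; set a := size _; set x := (size P).-1 in le *; set y := (size Q).-1 in le *.
  move=> h1 h2 h3; have : (a <= (x * p).+1)%N.
    apply: leq_trans h1 _; rewrite geq_max !ltnS leq_mul2r le orbT /=.
    by rewrite -{2}(prednK (ltnW p1)) mulnS leq_add2r.
  by rewrite h3 ltnn.
rewrite size_polyDl szX ?szm //.
  move=> [h]; have : (p %| (size P).-1 * p + 1)%N by rewrite addn1 -h dvdn_mull.
  by rewrite dvdn_addr ?dvdn_mull // dvdn1 => /eqP pe; rewrite pe in p1.
rewrite ltnS -{2}(prednK (ltnW p1)) mulnS ltn_add2l ltn_mul2r lt andbT -ltnS prednK ?(ltnW p1) //.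
Qed.

Lemma as_base (F : fieldType) p : p \in [pchar F] -> cyc_cover F p.
Proof.
move=> pc; rewrite -[p]mul1n; have axA := cyc_const F; have pp := pcharf_prime pc.
have A1' := A1 axA.
have Aa : rat_const (fun=> p2s ('X : {poly F})) by exists (p2s 'X) => //; apply: rat_poly.
have trb (j : nat) : \sum_(i < 1) (fun=> 1 : fps F) (j + i)%N = 1 by rewrite big_ord1.
have ab (j : nat) : (fun=> p2s 'X : fps F) j.+1 - (fun=> p2s 'X : fps F) j =
   (fun=> 1 : fps F) j ^+ p - (fun=> 1 : fps F) j by rewrite expr1n !subrr.
have a0 : hd (p2s ('X : {poly F})) = 0 by rewrite hd_p2s coefX.
have [x0 hx0 x0p] := as_root (a := fun=> p2s 'X) pc a0.
apply: (as_cyc pc (ltn0Sn 0) axA Aa A1' trb ab hx0 x0p) => u v.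
move=> [c [e1 [q1 [e10 hc]]] hu] [d [e2 [q2 [e20 hd']]] hv]; rewrite hu hv => c0.
apply/negP => /eqP cd; apply: (@as_no_poly _ p (e2 * q1) (e1 * q2)).
- exact: prime_gt1.
- have nz (e : {poly F}) : e`_0 = 1 -> e != 0.
    by move=> h; apply: contra_eq_neq h => ->; rewrite coef0 eq_sym oner_neq0.
  apply: mulf_neq0; first exact: nz.
  apply: contra_neq c0 => q0; apply: (mulfI (p2s_neq0 e10)).
  by rewrite hc q0 rmorph0 mulr0.
apply: p2s_inj.
have hQ : p2s (e1 * q2) = p2s (e2 * q1) * x0.
  by rewrite !rmorphM /= -hc -hd' -cd; ring.
move: (e2 * q1) (e1 * q2) hQ => PP QQ hQ; rewrite rmorphB !rmorphM !rmorphXn /= hQ -x0p exprMn.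
have -> : p2s PP ^+ p = p2s PP * p2s PP ^+ p.-1.
  by rewrite -exprS prednK ?prime_gt0.
ring.
Qed.

Lemma as_cyclic (F : fieldType) p m : p \in [pchar F] -> cyc_cover F (p ^ m).
Proof.
move=> pc; elim: m => [|m [A axA]]; first exact: cyc_trivial.
case: m axA => [|m] axA; first exact: as_base.
rewrite expnSr; apply: (as_step _ axA pc); last by rewrite expnSr dvdn_mull.
by rewrite expn_gt0 prime_gt0 ?(pcharf_prime pc).
Qed.

(** * Kummer covers *)

(** L is generated by a root of an irreducible factor p of the cyclotomic polynomial [Psi], so all
    conjugates are powers z^c with c prime to l. An invariant P(z) is constant on the roots of p,
    hence P modulo p is constant. Testing all such c avoids determining the Galois group. *)
Lemma zeta_ext (F : fieldType) l m : prime l -> (l%:R : F) != 0 ->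
  exists (L : fieldType) (e : {rmorphism F -> L}) (z : L), (l ^ m.+1).-primitive_root z /\
    forall P : {poly F}, (forall c, coprime c l -> (map_poly e P).[z ^+ c] = (map_poly e P).[z]) ->
      exists a, e a = (map_poly e P).[z].
Proof.
move=> pl l0; have l1 := prime_gt1 pl; have l_0 := prime_gt0 pl.
pose Psi : {poly F} := \sum_(j < l) 'X^(l ^ m) ^+ j.
have fact : 'X^(l ^ m.+1) - 1 = ('X^(l ^ m) - 1) * Psi.
  by rewrite -subrX1 -exprM -expnSr.
have szX k : (0 < k)%N -> size ('X^k - 1 : {poly F}) = k.+1 by move=> k0; rewrite size_XnsubC.
have lm k : (0 < l ^ k)%N by rewrite expn_gt0 l_0.
have Psi0 : Psi != 0.
  by apply: contra_eq_neq fact => ->; rewrite mulr0 -size_poly_eq0 szX.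
have szPsi : (1 < size Psi)%N.
  have := szX _ (lm m.+1); rewrite fact size_mul // ?szX //; last by rewrite -size_poly_eq0 szX.
  have : (l ^ m < l ^ m.+1)%N by rewrite ltn_exp2l.
  case: (size Psi) => [|[|s]] //; first by rewrite addn0 /= => h1 h2; lia.
  by rewrite addn1 /= => h1 h2; lia.
have [p ip pPsi] := irred_factor szPsi.
have [L _ [z zp _]] := irredp_FAdjoin ip.
pose e : {rmorphism F -> L} := GRing.in_alg L.
have p1 : (1 < size p)%N by case: ip.
have szp : size (map_poly e p) = size p by rewrite size_map_poly.
have evPsi (y : L) : (map_poly e Psi).[y] = \sum_(j < l) (y ^+ (l ^ m)) ^+ j.
  rewrite rmorph_sum horner_sum; apply: eq_bigr => j _.
  by rewrite !rmorphXn /= map_polyX -exprM hornerXn exprM.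
have nroot (y : L) : y ^+ (l ^ m) = 1 -> ~~ root (map_poly e Psi) y.
  move=> h; rewrite /root evPsi (eq_bigr (fun=> 1)) => [|j _]; last by rewrite h expr1n.
  by rewrite sumr_const card_ord -(rmorph_nat e) fmorph_eq0.
have rootP (y : L) : root (map_poly e p) y -> root (map_poly e Psi) y.
  move=> rp; have /dvdpP[q ->] : map_poly e p %| map_poly e Psi by rewrite dvdp_map.
  by rewrite rootM rp orbT.
have zn : z ^+ (l ^ m.+1) = 1.
  apply/eqP; rewrite -subr_eq0; have := congr1 (fun P => (map_poly e P).[z]) fact.
  rewrite rmorphB rmorphM rmorph1 /= map_polyXn hornerD hornerN hornerXn hornerC hornerM => ->.
  by have /rootP/eqP -> := zp; rewrite mulr0.
have prim : (l ^ m.+1).-primitive_root z.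
  have [k pk] := prim_order_exists (lm _) zn.
  move=> /(dvdn_pfactor _ _ pl)[j]; rewrite leq_eqVlt => /predU1P[-> <- //|jm ke].
  suff h : z ^+ (l ^ m) = 1 by have := nroot z h; rewrite (rootP _ zp).
  apply/eqP; rewrite -(prim_order_dvd pk) ke dvdn_exp2l //; lia.
exists L, e, z; split=> // P hP; set c := _.[_].
have dv : map_poly e p %| \prod_(i <- iota 0 (l ^ m.+1)) ('X - (z ^+ i)%:P).
  have -> : iota 0 (l ^ m.+1) = index_iota 0 (l ^ m.+1) by rewrite /index_iota subn0.
  rewrite (factor_Xn_sub_1 prim).
  have -> : 'X^(l ^ m.+1) - 1 = map_poly e ('X^(l ^ m) - 1) * map_poly e Psi.
    by rewrite -rmorphM -fact rmorphB rmorph1 /= map_polyXn.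
  by rewrite dvdp_mull // dvdp_map.
have [mk hmk] := dvdp_prod_XsubC dv; set js := mask _ _ in hmk.
have ujs : uniq js by rewrite mask_uniq ?iota_uniq.
have szjs : size js = (size p).-1.
  by have := eqp_size hmk; rewrite szp size_prod_XsubC => ->.
have jsP j : j \in js -> (j < l ^ m.+1)%N /\ root (map_poly e p) (z ^+ j).
  move=> jj; split; first by have := mem_mask jj; rewrite mem_iota.
  by rewrite (eqp_root hmk) -(big_map _ xpredT (fun y => 'X - y%:P)) root_prod_XsubC; apply: map_f.
have cop j : j \in js -> coprime j l.
  move=> /jsP[_ /rootP]; rewrite coprime_sym prime_coprime //; apply: contraL => /dvdnP[k ->].
  apply: nroot; rewrite -exprM -mulnA -expnS mulnC exprM zn expr1n //.
pose r := P %% p; pose Q := map_poly e r - c%:P.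
have szQ : (size Q <= (size p).-1)%N.
  rewrite (leq_trans (size_polyD _ _)) // geq_max size_polyN size_map_poly.
  have := ltn_modp P p; rewrite -size_poly_gt0 (ltnW p1) => h; rewrite -ltnS prednK ?(ltnW p1) // h /=.
  by rewrite (leq_trans (size_polyC_leq1 _)) // -ltnS prednK ?(ltnW p1).
have [Q0|Q0] := eqVneq Q 0.
  exists r`_0; have := congr1 (fun P : {poly L} => P`_0) Q0.
  by rewrite coefB coef_map coefC coef0 /= => /eqP; rewrite subr_eq0 => /eqP.
have := @max_poly_roots _ Q [seq z ^+ j | j <- js] Q0; rewrite size_map szjs ltnNge szQ.
have -> : all (root Q) [seq z ^+ j | j <- js].
  apply/allP => _ /mapP[j jj ->]; rewrite /root hornerD hornerN hornerC subr_eq0 /c.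
  rewrite -(hP j (cop j jj)) [in X in _ == X](divp_eq P p) -/r rmorphD rmorphM /= hornerD hornerM.
  by have [_ /eqP ->] := jsP _ jj; rewrite mulr0 add0r.
suff -> : uniq [seq z ^+ j | j <- js] by move/(_ isT isT).
rewrite map_inj_in_uniq // => i j /jsP[ilt _] /jsP[jlt _] /eqP; rewrite (eq_prim_root_expr prim).
by rewrite !modn_small // => /eqP.
Qed.

(** The equation is expanded along an F-independent family; as d has constant term 1, some
    coordinate of d has a nonzero constant term. *)
Lemma rat_descend (F L : fieldType) (e : {rmorphism F -> L}) (c : fps F) (d q : {poly L}) :
  d`_0 = 1 -> p2s d * fmap e c = p2s q -> ratl c.
Proof.
move=> d0 h; have [bs [co [ind hco co0]]] := indep_basis e (d ++ q).
pose dk k : {poly F} := \poly_(i < size d) co d`_i k.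
pose qk k : {poly F} := \poly_(i < size q) co q`_i k.
have E (r : {poly L}) k i : (\poly_(i < size r) co r`_i k)`_i = co r`_i k.
  by rewrite coef_poly; case: ltnP => // le; rewrite nth_default // co0.
have hcof (r : {poly L}) i : {subset (r : seq L) <= d ++ q} -> r`_i = comb e (co r`_i) bs.
  move=> sub_r; case: (ltnP i (size r)) => lt; first by apply: hco; apply: sub_r; apply: mem_nth.
  by rewrite nth_default // /comb big1 // => k _; rewrite co0 rmorph0 mul0r.
have dsub : {subset (d : seq L) <= d ++ q} by move=> x xd; rewrite mem_cat xd.
have qsub : {subset (q : seq L) <= d ++ q} by move=> x xq; rewrite mem_cat xq orbT.
have eqk k : (k < size bs)%N -> p2s (dk k) * c = p2s (qk k).
  move=> kb; apply: fpsP => N; apply/eqP; rewrite -subr_eq0 -cfB; apply/eqP.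
  apply: (ind (fun k => cf (p2s (dk k) * c - p2s (qk k)) N)) => //.
  have := congr1 (fun f => cf f N) h; rewrite cfM cf_p2s (hcof _ _ qsub) => /eqP.
  rewrite -subr_eq0 => /eqP hN; rewrite -[RHS]hN /comb.
  under eq_bigr do rewrite cfB cfM cf_p2s (E q) rmorphB rmorph_sum mulrBl mulr_suml.
  rewrite sumrB exchange_big; congr (_ - _); apply: eq_bigr => i _.
  rewrite cf_p2s cf_fmap (hcof _ _ dsub) /comb mulr_suml; apply: eq_bigr => j _.
  by rewrite cf_p2s (E d) rmorphM /= mulrAC.
have [k kb dk0] : exists2 k, (k < size bs)%N & co d`_0 k != 0.
  apply: contrapT => no; have /eqP := hcof _ 0%N dsub; rewrite {1}d0 /comb big1 ?oner_eq0 // => i _.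
  case: (eqVneq (co d`_0 i) 0) => [->|nz]; first by rewrite rmorph0 mul0r.
  by case: no; exists (i : nat).
by apply: rat_unit (eqk k kb); rewrite (E d) unitfE.
Qed.

Lemma ev_XnsubC (R : comNzRingType) (y : fps R) n (c : {poly R}) : ev y ('X^n - c%:P) = y ^+ n - p2s c.
Proof. by rewrite /ev rmorphB /= map_polyXn map_polyC hornerD hornerN hornerXn hornerC. Qed.

Section Kummer.
Variables (F : fieldType) (l m : nat).
Hypotheses (pl : prime l) (l0 : (l%:R : F) != 0).
Variable n : nat.
Hypothesis nE : n = (l ^ m.+1)%N.
Variables (L : fieldType) (e : {rmorphism F -> L}) (z : L).
Hypothesis prim : n.-primitive_root z.
Hypothesis invar : forall P : {poly F}, (forall c, coprime c l -> (map_poly e P).[z ^+ c] = (map_poly e P).[z]) ->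
  exists a, e a = (map_poly e P).[z].
Variable g : fps F.
Hypotheses (gn : g ^+ n = 1 - p2s 'X) (hg : hd g = 1).

Let n1 : (1 < n)%N. Proof. by rewrite nE -(exp1n m.+1) ltn_exp2r ?prime_gt1. Qed.
Let n_0 : (0 < n)%N := ltnW n1.
Let nF : (n%:R : F) != 0. Proof. by rewrite nE natrX expf_neq0. Qed.
Let cop c : coprime c l -> coprime c n. Proof. by move=> h; rewrite nE coprimeXr. Qed.

Let unitE c : coprime c l -> (c ^ (totient n).-1 * c = 1 %[mod n])%N.
Proof. by move=> h; rewrite -expnSr prednK ?totient_gt0 // Euler_exp_totient // cop. Qed.

(** The residue of i/c modulo n: by Euler the power of c is its inverse. *)
Definition kexp i c := ((i * c ^ (totient n).-1) %% n)%N.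
(** The product of the n-th roots of (1 - z^(c0 c) T)^r with r = i/c modulo n. The inverse of c in
    the exponent makes z -> z^c0 carry the i-th radical to the (c0 i)-th, which is the equivariance
    needed for descent to F. *)
Definition kY c0 i : fps L :=
  \prod_(c < n | coprime c l) (sub e (z ^+ (c0 * c)) g) ^+ kexp i c.
(** The same product with an indeterminate for z: conjugation becomes evaluation at another power of
    z, and automorphisms of L need not be constructed. *)
Definition kYp i : fps {poly F} :=
  \prod_(c < n | coprime c l) (sub (@polyC F) ('X^c) g) ^+ kexp i c.
Definition zeval c0 : {poly F} -> L := horner_eval (z ^+ c0) \o map_poly e.
HB.instance Definition _ c0 := GRing.RMorphism.on (zeval c0).

Lemma kYpE c0 i : fmap (zeval c0) (kYp i) = kY c0 i.
Proof.
rewrite /kYp /kY rmorph_prod /=; apply: eq_bigr => c _; rewrite rmorphXn /=; congr (_ ^+ _).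
apply: fpsP => N; rewrite cf_fmap !cf_sub rmorphM rmorphXn /= /zeval /=.
by rewrite /horner_eval map_polyC map_polyXn hornerC hornerXn exprM.
Qed.

Lemma reindex_mulmod (R : Type) (idx : R) (op : Monoid.com_law idx) c0 (P : pred nat) (f : nat -> R) :
  coprime c0 l ->
  \big[op/idx]_(i < n | P i) f i = \big[op/idx]_(i < n | P ((c0 * i) %% n)%N) f ((c0 * i) %% n)%N.
Proof.
move=> h; pose mo c (i : 'I_n) : 'I_n := Ordinal (ltn_pmod (c * i) n_0).
rewrite (reindex_onto (mo c0) (mo (c0 ^ (totient n).-1)%N)) /=.
  apply: eq_bigl => i; rewrite -[RHS]andbT; congr (_ && _); apply/eqP/val_inj => /=.
  by rewrite modnMmr mulnA -modnMml unitE // modnMml mul1n modn_small.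
move=> i _; apply: val_inj => /=.
by rewrite modnMmr mulnA [(c0 * _)%N]mulnC -modnMml unitE // modnMml mul1n modn_small.
Qed.

Lemma kY_galois c0 i : coprime c0 l -> kY c0 i = kY 1 (c0 * i).
Proof.
move=> h; rewrite /kY [RHS](@reindex_mulmod _ _ _ c0 (fun c => coprime c l)
  (fun c => sub e (z ^+ (1 * c)) g ^+ kexp (c0 * i) c)) //.
have copm c : coprime ((c0 * c) %% n)%N l = coprime c l.
  have ln : (l %| n)%N by rewrite nE expnS dvdn_mulr.
  have lc x : coprime x l = ~~ (l %| x)%N by rewrite coprime_sym prime_coprime.
  by rewrite !lc {1}/dvdn modn_dvdm // -/(dvdn _ _) Euclid_dvdM // negb_or -lc h.
rewrite /=; apply: eq_big => [c|c hc]; first by rewrite copm.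
rewrite mul1n (prim_expr_mod prim); congr (_ ^+ _).
rewrite /kexp; apply/esym; rewrite -modnMmr modnXm modnMmr expnMn.
have -> : (c0 * i * (c0 ^ (totient n).-1 * c ^ (totient n).-1) =
  (c0 ^ (totient n).-1 * c0) * (i * c ^ (totient n).-1))%N by ring.
by rewrite -modnMml unitE // modnMml mul1n.
Qed.

Lemma hd_kY c0 i : hd (kY c0 i) = 1.
Proof.
rewrite rmorph_prod big1 //= => c _; rewrite rmorphXn /=.
by rewrite (_ : hd _ = 1) ?expr1n // -[LHS]/(cf (sub e _ g) 0) cf_sub expr0 mulr1 -[cf g 0]/(hd g) hg rmorph1.
Qed.

(** The integral part of the exponents: reducing them modulo n splits kw^i into the i-th radical and
    this polynomial. *)
Definition kh i : {poly L} := \prod_(c < n | coprime c l) (1 - (z ^+ c) *: 'X) ^+ ((kexp 1 c * i) %/ n)%N.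
Definition kw := kY 1 1.

Lemma kh0 i : (kh i)`_0 = 1.
Proof.
rewrite -hd_p2s rmorph_prod rmorph_prod /= big1 // => c _; rewrite !rmorphXn /= hd_p2s.
by rewrite coefB coef1 coefZ coefX mulr0 subr0 expr1n.
Qed.

Lemma kw_pow i : kw ^+ i = kY 1 i * p2s (kh i).
Proof.
rewrite /kw /kY /kh rmorph_prod -prodrXl -big_split; apply: eq_bigr => c _ /=.
rewrite -exprM rmorphXn /= {1}(divn_eq (kexp 1 c * i) n) exprD mulrC; congr (_ * _).
  by congr (_ ^+ _); rewrite /kexp modnMml mul1n mulnC.
rewrite [(_ %/ _ * _)%N]mulnC exprM -rmorphXn /= gn rmorphB rmorph1 /= mul1n; congr (_ ^+ _).
apply: fpsP => N; rewrite !(cfB, cf1, cf_sub, cf_p2s) coefB coef1 coefZ !coefX; congr (_ - _).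
by case: N => [|[|N]]; rewrite /= ?rmorph0 ?rmorph1 ?expr1 ?mul0r ?mulr0 ?mul1r ?mulr1.
Qed.

Let nL : (n%:R : L) != 0. Proof. by rewrite -(rmorph_nat e) fmorph_eq0. Qed.

(** The conjugations z -> z^c0 permute the terms of the sum, so it is defined over F. At T = 0 it is
    the average of the z^(i j). *)
Lemma kummer_idem j : exists b : fps F,
  fmap e b = kc (n%:R^-1) * \sum_(i < n) kc (z ^+ (i * j)) * kY 1 i.
Proof.
pose P := kc (n%:R^-1)%:P * \sum_(i < n) kc ('X^(i * j)) * kYp i : fps {poly F}.
have kcE (c : {poly F}) c0 : fmap (zeval c0) (kc c) = kc (zeval c0 c).
  by rewrite /kc fmap_p2s map_polyC.
have PE c0 : coprime c0 l -> fmap (zeval c0) P =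
    kc (n%:R^-1) * \sum_(i < n) kc (z ^+ (i * j)) * kY 1 i.
  move=> h; rewrite rmorphM rmorph_sum /= kcE; congr (_ * _).
    by congr kc; rewrite /zeval /= /horner_eval map_polyC hornerC /= fmorphV rmorph_nat.
  rewrite [RHS](@reindex_mulmod _ _ _ c0 xpredT (fun i => kc (z ^+ (i * j)) * kY 1 i)) //=.
  apply: eq_bigr => i _; rewrite rmorphM /= kcE kYpE kY_galois //; congr (_ * _).
    rewrite /zeval /= /horner_eval map_polyXn hornerXn -exprM; congr kc.
    by apply/eqP; rewrite (eq_prim_root_expr prim) modnMml mulnA.
  rewrite /kY; apply: eq_bigr => c _; congr (_ ^+ _); by rewrite /kexp modnMml.
have H N : exists a, e a = cf (fmap (zeval 1) P) N.
  rewrite cf_fmap /zeval /= /horner_eval; apply: invar => c hc.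
  have := congr1 (fun f => cf f N) (etrans (PE c hc) (esym (PE 1 (coprime1n _)))).
  by rewrite !cf_fmap /zeval /= /horner_eval.
have [b hb] := choice H; exists (Fps b); rewrite -(PE 1) ?coprime1n //.
by apply: fpsP => N; rewrite cf_fmap hb.
Qed.

(** Sequences over F which over L are rational in T and [kw], with conjugates kw -> z^j kw: the
    cover over F is cut out of the Kummer cover over L by asking for expansions over F. *)
Definition kummer (b : nat -> fps F) := exists (d : {poly L}) (al : {poly {poly L}}),
  d`_0 = 1 /\ forall j, p2s d * fmap e (b j) = ev (kc (z ^+ j) * kw) al.

Definition kQ : {poly {poly L}} := 'X^n - (kh n)%:P.
Lemma kw_n : kw ^+ n = p2s (kh n).
Proof.
rewrite kw_pow {1}/kY big1 ?mul1r // => c _.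
by rewrite /kexp modnMr expr0.
Qed.
Lemma kwj j : (kc (z ^+ j) * kw) ^+ n = p2s (kh n).
Proof.
by rewrite exprMn -rmorphXn /= -exprM mulnC exprM (prim_expr_order prim) expr1n rmorph1 mul1r kw_n.
Qed.
Lemma kQ0 j : ev (kc (z ^+ j) * kw) kQ = 0.
Proof.
by rewrite /kQ ev_XnsubC kwj subrr. Qed.
Lemma kQ_monic : kQ \is monic.
Proof. exact: monicXnsubC. Qed.
Lemma kummer_red al : exists2 r : {poly {poly L}}, (size r <= n)%N &
  forall j, ev (kc (z ^+ j) * kw) al = ev (kc (z ^+ j) * kw) r.
Proof.
exists (al %% kQ).
  by have := ltn_modp al kQ; rewrite monic_neq0 ?kQ_monic // size_XnsubC.
by move=> j; rewrite {1}(Pdiv.IdomainMonic.divp_eq kQ_monic al) rmorphD rmorphM /= kQ0 mulr0 add0r.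
Qed.
Lemma kw_neq0 : kw != 0.
Proof.
by apply: contra_eq_neq (hd_kY 1 1) => /=; rewrite -/kw => ->; rewrite rmorph0 eq_sym oner_neq0.
Qed.
Lemma kc_inj (R : comNzRingType) : injective (@kc R).
Proof. by move=> x y h; rewrite -[x]hd_kc h hd_kc. Qed.
Lemma kw_inj : {in gtn n &, injective (fun j => kc (z ^+ j) * kw)}.
Proof.
move=> i j ilt jlt /(mulIf kw_neq0)/kc_inj/eqP.
by rewrite (eq_prim_root_expr prim) !modn_small // => /eqP.
Qed.
Lemma kQ_prod : map_poly (@p2s L) kQ = \prod_(i : 'I_n) ('X - (kc (z ^+ i) * kw)%:P).
Proof.
have -> : \prod_(i : 'I_n) ('X - (kc (z ^+ i) * kw)%:P) =
    \prod_(y <- [seq kc (z ^+ (nat_of_ord i)) * kw | i <- enum 'I_n]) ('X - y%:P).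
  by rewrite big_map big_enum.
have mQ : map_poly (@p2s L) kQ = 'X^n - (p2s (kh n))%:P.
  by rewrite rmorphB /= map_polyXn map_polyC.
apply: monic_eq_prod.
- by rewrite mQ size_XnsubC // size_map -cardE card_ord.
- by rewrite mQ monicXnsubC.
- by apply/allP => _ /mapP[i _ ->]; rewrite /root -/(ev _ _) kQ0.
rewrite map_inj_uniq ?enum_uniq // => i j /kw_inj h; apply/val_inj/h; exact: ltn_ord.
Qed.

(** X^n - kh n is irreducible: the constant term of a factor with |S| roots makes (kh n)^|S| an n-th
    power up to constants and factors c^n, while [kh n] has a simple zero at 1/z; so n divides
    |S|. *)
Lemma kummer_dom b : kummer b -> b 0%N = 0 -> forall i, b i = 0.
Proof.
move=> [d [al [d0 hb]]] b0 i; have [r szr hr] := kummer_red al.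
suff r0 : r = 0.
  apply: (fmap_inj (fmorph_inj e)); apply: (mulfI (p2s_neq0 d0)).
  by rewrite hb hr r0 !rmorph0 mulr0.
apply/eqP/negP => /negP r0.
have yinj : {in [set: 'I_n] &, injective (fun i : 'I_n => kc (z ^+ i) * kw)}.
  by move=> x y _ _ /kw_inj h; apply/val_inj/h; exact: ltn_ord.
have hQ : map_poly (@p2s L) kQ = \prod_(x in [set: 'I_n]) ('X - (kc (z ^+ x) * kw)%:P).
  by rewrite kQ_prod; apply: eq_bigl => x; rewrite inE.
have [||S [c [q [SJ S0 c0 hq]]]] := min_factor (@p2s_inj L) yinj (in_setT (Ordinal n_0)) hQ r0.
- by rewrite size_XnsubC.
- by rewrite -/(ev _ _) -(hr 0%N) -hb b0 rmorph0 mulr0.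
have Sn : (#|S| < n)%N by have := proper_card SJ; rewrite cardsT card_ord.
have S1 : (0 < #|S|)%N by apply/card_gt0P; exists (Ordinal n_0).
pose u : L := \prod_(i in S) - z ^+ i.
have hq0 : p2s q`_0 = p2s c * (kc u * kw ^+ #|S|).
  have := congr1 (fun P : {poly fps L} => P.[0]) hq.
  rewrite horner_coef0 coef_map /= hornerM hornerC => ->; congr (_ * _).
  rewrite horner_prod rmorph_prod /= -prodr_const -big_split /=; apply: eq_bigr => j _.
  by rewrite hornerXsubC sub0r rmorphN mulNr.
have hqn : q`_0 ^+ n = c ^+ n * ((u ^+ n)%:P * kh n ^+ #|S|).
  apply: p2s_inj; rewrite !rmorphM !rmorphXn /= hq0 !exprMn -kw_n -!exprM [(n * _)%N]mulnC.
  by congr (_ * (_ * _)); rewrite -rmorphXn.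
have un0 : u ^+ n != 0.
  rewrite expf_neq0 // /u; apply/prodf_neq0 => j _; rewrite oppr_eq0 expf_neq0 //.
  by apply: contra_eq_neq (prim_expr_order prim) => ->; rewrite expr0n eqn0Ngt n_0 /= eq_sym oner_neq0.
have z0 : z != 0.
  by apply: contra_eq_neq (prim_expr_order prim) => ->; rewrite expr0n eqn0Ngt n_0 /= eq_sym oner_neq0.
have h0 : kh n != 0 by apply: contra_eq_neq (kh0 n) => ->; rewrite coef0 eq_sym oner_neq0.
have q0 : q`_0 != 0.
  apply: contra_eq_neq hqn => ->; rewrite expr0n eqn0Ngt n_0 /= eq_sym.
  by rewrite !mulf_neq0 ?expf_neq0 // polyC_eq0.
have mupX (P : {poly L}) k : P != 0 -> mup z^-1 (P ^+ k) = (k * mup z^-1 P)%N.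
  move=> P0; elim: k => [|k IH]; first by rewrite expr0 mul0n mupNroot // root1.
  by rewrite exprS mupM ?expf_neq0 // IH mulSn.
have muph : mup z^-1 (kh n) = 1%N.
  rewrite /kh (bigD1 (Ordinal n1)) ?coprime1n //= mupMl.
    rewrite /kexp mul1n exp1n (modn_small n1) mul1n divnn n_0 expr1 expr1.
    have -> : 1 - z *: 'X = (- z)%:P * ('X - (z^-1)%:P).
      by rewrite -mul_polyC mulrBr -rmorphM /= mulNr mulfV // !rmorphN rmorph1 opprK mulNr addrC.
    rewrite mupMr; first by rewrite -['X - _]expr1 mup_XsubCX eqxx.
    by rewrite rootC oppr_eq0.
  rewrite /root horner_prod; apply/prodf_neq0 => c' /andP[_ ne].
  rewrite horner_exp expf_neq0 // hornerD hornerN hornerZ hornerX hornerC subr_eq0 eq_sym.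
  rewrite -(inj_eq (mulIf z0)) mulfVK // mul1r -[X in _ != X]expr1 (eq_prim_root_expr prim).
  by rewrite !modn_small.
have := congr1 (mup z^-1) hqn.
have cf0 : (u ^+ n)%:P != 0 by rewrite polyC_eq0.
rewrite mupX // mupM ?mulf_neq0 ?expf_neq0 // mupMr ?rootC // !mupX // muph muln1.
move=> hm; have : (n %| #|S|)%N.
  by rewrite -(dvdn_addr _ (dvdn_mulr (mup z^-1 c) (dvdnn n))) -hm dvdn_mulr.
by move/(dvdn_leq S1); rewrite leqNgt Sn.
Qed.

Lemma kummer_ax : cyc_ax n kummer.
Proof.
have ev_add y := rmorphD (ev y); have ev_mul y := rmorphM (ev y).
split; [| | | |split].
- move=> a b [d [al [d0 ha]]] [d' [al' [d0' hb]]].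
  exists (d * d'), (d'%:P * al + d%:P * al'); split; first by rewrite coef0M d0 d0' mulr1.
  by move=> j; rewrite !rmorphD !rmorphM /= !evC -ha -hb; ring.
- move=> a b [d [al [d0 ha]]] [d' [al' [d0' hb]]].
  exists (d * d'), (al * al'); split; first by rewrite coef0M d0 d0' mulr1.
  by move=> j; rewrite !rmorphM /= -ha -hb; ring.
- move=> a [d [al [d0 ha]]]; exists d, (al \Po (z%:P%:P * 'X)); split=> // j.
  rewrite ha /ev map_comp_poly horner_comp; congr _.[_].
  rewrite rmorphM /= map_polyC map_polyX hornerM hornerC hornerX mulrA.
  by congr (_ * _); rewrite exprS [kc _]rmorphM.
- move=> a [d [al [d0 ha]]] i; apply: (fmap_inj (fmorph_inj e)); apply: (mulfI (p2s_neq0 d0)).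
  by rewrite !ha exprD (prim_expr_order prim) mulr1.
- move=> p; exists 1, (map_poly e p)%:P; split=> [|j]; first by rewrite coef1.
  by rewrite rmorph1 mul1r fmap_p2s evC.
- move=> d a d0 [d' [al [d0' ha]]]; exists (d' * map_poly e d), al; split=> [|j].
    by rewrite coef0M d0' coef_map /= d0 rmorph1 mulr1.
  by rewrite -ha [p2s (_ * _)]rmorphM [fmap e (_ * _)]rmorphM /= fmap_p2s mulrA.
- move=> a c [d [al [d0 ha]]] hc; have [r szr hr] := kummer_red al.
  apply: (@rat_descend _ _ e c d r`_0 d0).
  pose Q := map_poly (@p2s L) r - (p2s d * fmap e c)%:P.
  have szQ : (size Q <= n)%N.
    rewrite (leq_trans (size_polyD _ _)) // geq_max size_polyN.
    by rewrite (leq_trans (size_poly _ _)) // (leq_trans (size_polyC_leq1 _)).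
  suff /(congr1 (fun P : {poly fps L} => P`_0)) : Q = 0.
    by rewrite coefB coef_map coefC coef0 /= => /eqP; rewrite subr_eq0 => /eqP.
  apply/eqP; apply: contraTT szQ => Q0; rewrite -ltnNge.
  have := @max_poly_roots _ Q [seq kc (z ^+ i) * kw | i <- iota 0 n] Q0.
  rewrite size_map size_iota; apply.
    apply/allP => _ /mapP[i _ ->]; rewrite /root hornerD hornerN hornerC -/(ev _ _) -hr -ha hc.
    by rewrite subrr.
  rewrite map_inj_in_uniq ?iota_uniq // => i j; rewrite !mem_iota add0n /= => hi hj.
  exact: kw_inj.
- have [b hb] := choice kummer_idem; exists b.
    (* [kY 1 i] is kw^i / kh i, and the product of all [kh i] is a common denominator. *)
    exists (\prod_(i < n) kh i), (\sum_(i < n) (n%:R^-1 *: \prod_(k < n | k != i) kh k)%:P * 'X^i).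
    split; first by rewrite -hd_p2s !rmorph_prod big1 //= => i _; rewrite hd_p2s kh0.
    move=> j; rewrite hb mulrCA mulr_sumr rmorph_sum mulr_sumr /=; apply: eq_bigr => i _.
    rewrite evCM (rmorphXn (ev (kc (z ^+ j) * kw))) /= evX exprMn kw_pow (bigD1 i) //=.
    rewrite -mul_polyC !rmorphM /= -/(kc _).
    rewrite -rmorphXn /= -exprM [(j * i)%N]mulnC; ring.
  move=> j; apply: (fmorph_inj e); rewrite rmorph_nat.
  have -> : e (hd (b j)) = hd (fmap e (b j)) by [].
  rewrite hb rmorphM rmorph_sum /= hd_kc.
  under eq_bigr do rewrite rmorphM /= hd_kc hd_kY mulr1 mulnC exprM.
  have [dv|ndv] := boolP (n %| j)%N.
    move: dv; rewrite (prim_order_dvd prim) => /eqP ->.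
    by under eq_bigr do rewrite expr1n; rewrite sumr_const card_ord mulVf.
  have zj : z ^+ j - 1 != 0 by rewrite subr_eq0 -(prim_order_dvd prim).
  apply/eqP; rewrite mulf_eq0; apply/orP; right; rewrite -(inj_eq (mulfI zj)) -subrX1.
  by rewrite -exprM mulnC exprM (prim_expr_order prim) expr1n subrr mulr0.
- exact: kummer_dom.
Qed.
End Kummer.

Lemma kummer_root (F : fieldType) n : (n%:R : F) != 0 ->
  exists2 g : fps F, g ^+ n = 1 - p2s 'X & hd g = 1.
Proof.
move=> n0.
have [||x hx px] := hensel (P := ('X + 1) ^+ n - (1 - p2s ('X : {poly F}))%:P).
- rewrite !hornerE expr1n rmorphB rmorph1 rmorphB rmorph1 /= hd_p2s coefX subr0 subrr //.
- rewrite derivB derivC subr0 deriv_exp derivD derivX derivC addr0 mul1r hornerMn.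
  by rewrite !hornerE expr1n rmorph_nat.
exists (x + 1); last by rewrite rmorphD /= hx add0r rmorph1.
by apply/eqP; rewrite -subr_eq0; move/eqP: px; rewrite !hornerE.
Qed.

Lemma kummer_cyclic (F : fieldType) l m : prime l -> (l%:R : F) != 0 -> cyc_cover F (l ^ m.+1).
Proof.
move=> pl l0; have [L [e [z [prim inv]]]] := zeta_ext m pl l0.
have nF : ((l ^ m.+1)%:R : F) != 0 by rewrite natrX expf_neq0.
by have [g gn hg] := kummer_root nF; exists (kummer l (l ^ m.+1) e z g); apply: (kummer_ax pl l0 erefl).
Qed.

Theorem ample_split_gen (F : fieldType) : ample F ->
  forall (gT : finGroupType) (G : {group gT}), split_gen G F.
Proof.
move=> amp gT G; have [lam linj] := ample_embed amp gT.
apply: (cover_gen (lam := lam)).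
  by move=> g h; rewrite unitfE subr_eq0 (inj_eq linj).
apply: cyclic_covers => // {gT G lam linj} gT x l pl /p_natP[k ox].
apply: (@cyc_split _ (l ^ k)) => //.
have [pc|npc] := boolP (l \in [pchar F]); first exact: as_cyclic.
case: k ox => [|k] _; first exact: cyc_trivial.
by apply: kummer_cyclic; rewrite // inE pl in npc *.
Qed.

Import Num.Theory Order.TTheory.

(** * The degree valuation of an Ore field of fractions *)

Section OreValuation.
Variables (k K : unitRingType) (s d : k -> k) (iota : {rmorphism k -> K}) (t : K).
Hypotheses (kdiv : is_divring k) (saut : ring_aut s) (ofK : is_ore_fraction_field s d iota t).

Let Kdiv : is_divring K. Proof. by case: ofK. Qed.
Let tE a : t * iota a = iota (s a) * t + iota (d a). Proof. by case: ofK => _ ->. Qed.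

Lemma divring_mulf_eq0 (R : unitRingType) (x y : R) : is_divring R -> x * y = 0 -> (x = 0) \/ (y = 0).
Proof.
move=> div; have [->|/div xu] := eqVneq x 0; [by left | right].
by apply: (mulrI xu); rewrite mulr0.
Qed.

Lemma divring_mul_neq0 (R : unitRingType) (x y : R) : is_divring R -> x != 0 -> y != 0 -> x * y != 0.
Proof. by move=> div x0 y0; apply/eqP => /(divring_mulf_eq0 div)[]/eqP; apply/negP. Qed.

Lemma divring_inv_neq0 (R : unitRingType) (x : R) : x != 0 -> x^-1 != 0.
Proof. by rewrite invr_eq0. Qed.

(** Degree in t less than n, directly inside K, because the product of {poly k} is not the skew
    one. *)
Fixpoint ore_lt n (x : K) : Prop :=
  if n is n'.+1 then exists a y, ore_lt n' y /\ x = iota a * t ^+ n' + y else x = 0.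
Definition ore_lead n a x := exists2 y, ore_lt n y & x = iota a * t ^+ n + y.
Definition ore_deg n x := exists2 a, a != 0 & ore_lead n a x.

Lemma ore_lt0 n : ore_lt n 0.
Proof. by elim: n => [//|n IH]; exists 0, 0; rewrite rmorph0 mul0r addr0. Qed.
Lemma ore_ltS n x : ore_lt n x -> ore_lt n.+1 x.
Proof. by exists 0, x; rewrite rmorph0 mul0r add0r. Qed.
Lemma ore_lt_widen n m x : (n <= m)%N -> ore_lt n x -> ore_lt m x.
Proof. by move=> /subnK <- h; elim: (m - n)%N => [//|i IH]; apply: ore_ltS. Qed.
Lemma ore_lt_sub n x y : ore_lt n x -> ore_lt n y -> ore_lt n (x - y).
Proof.
elim: n x y => [|n IH] x y /=; first by move=> -> ->; rewrite subr0.
move=> [a [x' [hx ->]]] [b [y' [hy ->]]]; exists (a - b), (x' - y'); split; first exact: IH.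
by rewrite rmorphB mulrBl opprD addrACA.
Qed.
Lemma ore_lt_add n x y : ore_lt n x -> ore_lt n y -> ore_lt n (x + y).
Proof.
by move=> hx hy; rewrite -[y]opprK -[- y]sub0r; do 2!apply: ore_lt_sub => //; apply: ore_lt0.
Qed.
Lemma ore_lt_scale n a x : ore_lt n x -> ore_lt n (iota a * x).
Proof.
elim: n x => [|n IH] x /=; first by move=> ->; rewrite mulr0.
move=> [b [y [hy ->]]]; exists (a * b), (iota a * y); split; first exact: IH.
by rewrite mulrDr rmorphM mulrA.
Qed.
Lemma ore_lt_mulX n x : ore_lt n x -> ore_lt n.+1 (t * x).
Proof.
elim: n x => [|n IH] x; first by move=> ->; rewrite mulr0; apply: ore_lt0.
move=> [a [y [hy ->]]]; exists (s a), (iota (d a) * t ^+ n + t * y); split.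
  by apply: ore_lt_add; [exists (d a), 0; split; [exact: ore_lt0 | rewrite addr0] | exact: IH].
by rewrite mulrDr mulrA tE mulrDl -mulrA -exprS addrA.
Qed.
Lemma ore_lt_mulXn i n x : ore_lt n x -> ore_lt (i + n) (t ^+ i * x).
Proof.
move=> h; elim: i => [|i IH]; first by rewrite mul1r.
by rewrite exprS -mulrA; apply: ore_lt_mulX.
Qed.
Lemma ore_lt_mul n m x y : ore_lt n x -> ore_lt m.+1 y -> ore_lt (n + m) (x * y).
Proof.
elim: n x => [|n IH] x; first by move=> -> _; rewrite mul0r; apply: ore_lt0.
move=> [a [z [hz ->]]] hy; rewrite mulrDl -mulrA addSn; apply: ore_lt_add.
  by apply: ore_lt_scale; rewrite -addnS; apply: ore_lt_mulXn.
by apply/ore_ltS/IH.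
Qed.
Lemma ore_lead_lt n a x : ore_lead n a x -> ore_lt n.+1 x.
Proof. by case=> y hy ->; exists a, y. Qed.
Lemma ore_lead_mulXn i n a x : ore_lead n a x -> ore_lead (i + n) (iter i s a) (t ^+ i * x).
Proof.
move=> h; elim: i => [|i [y hy IH]]; first by rewrite mul1r.
rewrite exprS -mulrA IH; exists (iota (d (iter i s a)) * t ^+ (i + n) + t * y).
  apply: ore_lt_add; last exact: ore_lt_mulX.
  by exists (d (iter i s a)), 0; split; [exact: ore_lt0 | rewrite addr0].
by rewrite mulrDr mulrA tE mulrDl -mulrA -exprS addrA.
Qed.
Lemma ore_deg_mul n m x y : ore_deg n x -> ore_deg m y -> ore_deg (n + m) (x * y).
Proof.
move=> [a a0 [x' hx ->]] [b b0 hy]; exists (a * iter n s b).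
  apply: divring_mul_neq0 => //; elim: n {x' hx} => [//|n IH] /=; case: saut => sD _ _ /bij_inj sI.
  by apply: contra_neq IH => h; apply: sI; rewrite h; apply: (addrI (s 0)); rewrite -sD !addr0.
have [y' hy' e] := ore_lead_mulXn n hy.
exists (iota a * y' + x' * y).
  by apply: ore_lt_add; [exact: ore_lt_scale | apply: ore_lt_mul => //; apply: ore_lead_lt hy].
by rewrite mulrDl -mulrA e mulrDr mulrA rmorphM addrA.
Qed.

Lemma ore_ltP n x : ore_lt n x -> exists b : nat -> k, x = \sum_(i < n) iota (b i) * t ^+ i.
Proof.
elim: n x => [|n IH] x /=; first by move=> ->; exists (fun=> 0); rewrite big_ord0.
move=> [a [y [/IH[b ->] ->]]]; exists (fun i => if i == n then a else b i).
rewrite big_ord_recr /= eqxx addrC; congr (_ + _); apply: eq_bigr => i _.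
by rewrite ltn_eqF.
Qed.
Lemma ore_lt_sum n (b : nat -> k) : ore_lt n (\sum_(i < n) iota (b i) * t ^+ i).
Proof.
elim: n => [|n IH]; first by rewrite big_ord0.
by exists (b n), (\sum_(i < n) iota (b i) * t ^+ i); rewrite big_ord_recr addrC.
Qed.
Lemma ore_deg_neq0 n x : ore_deg n x -> x != 0.
Proof.
move=> [a a0 [_ /ore_ltP[b ->] ->]]; apply/eqP => h.
pose q := \poly_(i < n.+1) (if i == n then a else b i).
have szq : size q = n.+1 by rewrite size_poly_eq //= eqxx.
have : q != 0 by rewrite -size_poly_eq0 szq.
case: ofK => _ _ inj _; case/eqP; apply: inj; rewrite -[RHS]h /ore_eval szq big_ord_recr /= addrC.
rewrite coef_poly ltnSn eqxx; congr (_ + _); apply: eq_bigr => i _.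
by rewrite coef_poly ltnS ltnW // ltn_eqF.
Qed.
Lemma ore_deg_eval (p : {poly k}) : p != 0 -> ore_deg (size p).-1 (ore_eval iota t p).
Proof.
move=> p0; exists (lead_coef p); first by rewrite lead_coef_eq0.
exists (\sum_(i < (size p).-1) iota p`_i * t ^+ i); first exact: ore_lt_sum.
rewrite /ore_eval lead_coefE; move: p0; rewrite -size_poly_gt0; case: (size p) => // n _.
by rewrite big_ord_recr addrC.
Qed.
Lemma ore_lt_deg n x : ore_lt n x -> x = 0 \/ exists2 i, (i < n)%N & ore_deg i x.
Proof.
elim: n x => [|n IH] x; first by left.
move=> [a [y [hy ->]]]; have [->|a0] := eqVneq a 0; last first.
  by right; exists n => //; exists a => //; exists y.
rewrite rmorph0 mul0r add0r; case: (IH _ hy) => [->|[i lt h]]; [by left | right].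
by exists i => //; apply: ltnW.
Qed.
Lemma ore_deg_uniq n m x : ore_deg n x -> ore_deg m x -> n = m.
Proof.
wlog lt : n m / (n < m)%N => [hw hn hm|].
  by case: (ltngtP n m) => // h; [exact: hw | apply/esym; exact: hw].
move=> [a _ /ore_lead_lt/(ore_lt_widen lt) hn] [b b0 [y hy e]].
have /ore_deg_neq0 : ore_deg m 0 by exists b => //; exists (y - x); [exact: ore_lt_sub | rewrite addrA -e subrr].
by rewrite eqxx.
Qed.
Lemma ore_frac x : x != 0 -> exists n m u w, [/\ ore_deg n u, ore_deg m w & x = u * w^-1].
Proof.
case: (ofK) => _ _ _ /(_ x)[p [q [q0 ->]]] x0.
have p0 : p != 0.
  by apply: contra_neq x0 => ->; rewrite /ore_eval size_poly0 big_ord0 mul0r.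
by do 4!eexists; split; first exact: ore_deg_eval p0; first exact: ore_deg_eval q0.
Qed.
Lemma degU n x : ore_deg n x -> x \is a GRing.unit. Proof. by move/ore_deg_neq0/Kdiv. Qed.
(** The Ore condition is read off from K: w^-1 u is itself a fraction f g^-1. *)
Lemma ore_cond n m u w : ore_deg n u -> ore_deg m w ->
  exists n' m' f g, [/\ ore_deg n' f, ore_deg m' g, u * g = w * f & (n + m' = m + n')%N].
Proof.
move=> hu hw; have uu := degU hu; have wu := degU hw.
have [n' [m' [f [g [hf hg e]]]]] : exists n' m' f g, [/\ ore_deg n' f, ore_deg m' g & w^-1 * u = f * g^-1].
  by apply: ore_frac; apply: divring_mul_neq0; rewrite ?divring_inv_neq0 ?(ore_deg_neq0 hu) ?(ore_deg_neq0 hw).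
have e2 : u * g = w * f.
  by apply: (mulIr (_ : g^-1 \is a GRing.unit)); rewrite ?unitrV ?(degU hg) // mulrK ?(degU hg) // -mulrA -e mulVKr.
exists n', m', f, g; split=> //; apply: (ore_deg_uniq (ore_deg_mul hu hg)).
by rewrite e2; apply: ore_deg_mul.
Qed.

Definition is_val x (r : int) := exists n m u w,
  [/\ ore_deg n u, ore_deg m w, x = u * w^-1 & r = m%:Z - n%:Z].
Lemma is_val_uniq x r r' : is_val x r -> is_val x r' -> r = r'.
Proof.
move=> [n [m [u [w [hu hw -> ->]]]]] [n' [m' [u' [w' [hu' hw' e ->]]]]].
have [a [b [f [g [hf hg e2 dg]]]]] := ore_cond hw hw'.
have e3 : u * g = u' * f.
  have wu := degU hw; have w'u := degU hw'.
  rewrite -[g](mulKr wu) e2 mulrA e mulrA; congr (_ * _).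
  by rewrite -mulrA mulVr ?mulr1.
have := ore_deg_uniq (ore_deg_mul hu hg); rewrite e3 => /(_ _ (ore_deg_mul hu' hf)); lia.
Qed.
Lemma is_val_ex x : x != 0 -> exists r, is_val x r.
Proof.
by move=> /ore_frac[n [m [u [w [hu hw ->]]]]]; exists (m%:Z - n%:Z), n, m, u, w.
Qed.
Lemma is_val_mul x y r r' : is_val x r -> is_val y r' -> is_val (x * y) (r + r').
Proof.
move=> [n [m [u [w [hu hw -> ->]]]]] [n' [m' [u' [w' [hu' hw' -> ->]]]]].
have [a [b [f [g [hf hg e dg]]]]] := ore_cond hu' hw.
exists (n + a)%N, (m' + b)%N, (u * f), (w' * g); split; [exact: ore_deg_mul | exact: ore_deg_mul | | lia].
rewrite invrM ?(degU hw') ?(degU hg) //.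
rewrite -!mulrA; congr (_ * _); rewrite !mulrA; congr (_ * _).
apply: (mulrI (degU hw)); rewrite mulVKr ?(degU hw) //.
by rewrite mulrA -e mulrK ?(degU hg).
Qed.

Definition oval (x : K) : int := if pselect (exists r, is_val x r) is left e then projT1 (cid e) else 0.
Lemma ovalP x r : is_val x r -> oval x = r.
Proof.
rewrite /oval => h; case: pselect => [e|[]]; last by exists r.
by case: cid => r' /= h'; apply: is_val_uniq h' h.
Qed.
Lemma oval_is x : x != 0 -> is_val x (oval x).
Proof. by move=> /is_val_ex[r h]; rewrite (ovalP h). Qed.
Lemma ovalM x y : x != 0 -> y != 0 -> oval (x * y) = oval x + oval y.
Proof. by move=> /oval_is hx /oval_is hy; apply/ovalP/is_val_mul. Qed.

(** The case x = 0 stands apart because [oval 0] is a default value. *)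
Definition vge (r : int) x := x = 0 \/ r <= oval x.

Lemma vgeW r r' x : r' <= r -> vge r x -> vge r' x.
Proof. by move=> le [->|h]; [left | right; apply: le_trans h]. Qed.
Lemma vgeM r r' x y : vge r x -> vge r' y -> vge (r + r') (x * y).
Proof.
move=> [->|hx]; first by rewrite mul0r; left.
move=> [->|hy]; first by rewrite mulr0; left.
have [->|x0] := eqVneq x 0; first by rewrite mul0r; left.
have [->|y0] := eqVneq y 0; first by rewrite mulr0; left.
by right; rewrite ovalM // lerD.
Qed.
Lemma vgeD r x y : vge r x -> vge r y -> vge r (x + y).
Proof.
have [->|x0] := eqVneq x 0; first by rewrite add0r.
have [->|y0] := eqVneq y 0; first by rewrite addr0.
move=> [/eqP|hx]; first by rewrite (negPf x0).
move=> [/eqP|hy]; first by rewrite (negPf y0).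
have [n [m [u [w [hu hw ex rx]]]]] := oval_is x0.
have [n' [m' [u' [w' [hu' hw' ey ry]]]]] := oval_is y0.
have [a [b [f [g [hf hg e dg]]]]] := ore_cond hw hw'.
have wgu : w * g \is a GRing.unit by exact: degU (ore_deg_mul hw hg).
have fE : w'^-1 = f * (w * g)^-1.
  by apply: (mulrI (degU hw')); rewrite mulrV ?(degU hw') // mulrA -e mulrV.
have gE : w^-1 = g * (w * g)^-1.
  by apply: (mulrI (degU hw)); rewrite mulrV ?(degU hw) // mulrA mulrV.
rewrite ex ey fE {1}gE !mulrA -mulrDl.
have h1 := ore_deg_mul hu hg; have h2 := ore_deg_mul hu' hf.
have : ore_lt (maxn (n + b) (n' + a)).+1 (u * g + u' * f).
  case: h1 h2 => [c _ /ore_lead_lt h1] [c' _ /ore_lead_lt h2].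
  by apply: ore_lt_add; [apply: ore_lt_widen h1 | apply: ore_lt_widen h2]; lia.
case/ore_lt_deg=> [->|[i lt hi]]; first by rewrite mul0r; left.
right; rewrite (ovalP (r := (m + b)%N%:Z - i%:Z)); last by exists i, (m + b)%N, (u * g + u' * f), (w * g); split=> //; apply: ore_deg_mul.
lia.
Qed.
Lemma ore_deg1 : ore_deg 0 1.
Proof. by exists 1; rewrite ?oner_neq0 //; exists 0 => //; rewrite rmorph1 mul1r addr0. Qed.
Lemma ore_deg_val n x : ore_deg n x -> oval x = - n%:Z.
Proof. by move=> h; apply: ovalP; exists n, 0%N, x, 1; split=> //; [exact: ore_deg1 | rewrite invr1 mulr1 | lia]. Qed.
Lemma oval_iota a : a != 0 -> oval (iota a) = 0.
Proof.
by move=> a0; rewrite (@ore_deg_val 0%N) ?oppr0 //; exists a => //; exists 0 => //; rewrite mulr1 addr0.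
Qed.
Lemma ore_deg_t : ore_deg 1 t.
Proof.
by exists 1; rewrite ?oner_neq0 //; exists 0; [exact: ore_lt0 | rewrite rmorph1 mul1r addr0].
Qed.
Lemma oval_t : oval t = -1. Proof. exact: (ore_deg_val ore_deg_t). Qed.
Lemma t_neq0 : t != 0. Proof. exact: ore_deg_neq0 ore_deg_t. Qed.
Lemma oval1 : oval 1 = 0. Proof. by rewrite (ore_deg_val ore_deg1) oppr0. Qed.
Lemma vge_iota a : vge 0 (iota a).
Proof. by have [->|a0] := eqVneq a 0; [rewrite rmorph0; left | right; rewrite oval_iota]. Qed.
Lemma vgeN r x : vge r x -> vge r (- x).
Proof. by move=> h; rewrite -mulN1r -(add0r r) -(rmorphN1 iota); apply: vgeM => //; apply: vge_iota. Qed.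
Lemma vgeB r x y : vge r x -> vge r y -> vge r (x - y).
Proof. by move=> hx hy; apply: vgeD => //; apply: vgeN. Qed.
Lemma vge_sum (I : Type) (rs : seq I) (P : pred I) (f : I -> K) r :
  (forall i, P i -> vge r (f i)) -> vge r (\sum_(i <- rs | P i) f i).
Proof. by move=> h; elim/big_rec: _ => [|i x Pi hx]; [left | apply: vgeD => //; apply: h]. Qed.
Lemma ovalX x n : x != 0 -> x ^+ n != 0 /\ oval (x ^+ n) = n%:Z * oval x.
Proof.
move=> x0; elim: n => [|n [nz IH]]; first by rewrite oner_neq0 oval1 mul0r.
by rewrite exprS ovalM // divring_mul_neq0 // IH; split=> //; lia.
Qed.
Lemma ovalV x : x != 0 -> oval x^-1 = - oval x.
Proof.
move=> x0; apply: (addrI (oval x)); rewrite -ovalM ?divring_inv_neq0 // mulrV ?Kdiv //.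
by rewrite oval1 subrr.
Qed.
Lemma vge_val x y r : x != 0 -> oval x = r -> vge (r + 1) y -> x + y != 0 /\ oval (x + y) = r.
Proof.
move=> x0 xr hy; have nv z : z = 0 \/ r + 1 <= oval z -> z = x + y -> False.
  move=> hz ez; have : vge (r + 1) x by rewrite -[x](addrK y) -ez; apply: vgeB.
  by case=> [/eqP|]; [rewrite (negPf x0) | rewrite xr; lia].
have s0 : x + y != 0 by apply/eqP => h; apply: (nv 0); [left | rewrite h].
split=> //; have : vge r (x + y).
  by apply: vgeD; [right; rewrite xr | apply: vgeW hy; lia].
case=> [/eqP|h]; first by rewrite (negPf s0).
apply/eqP; rewrite eq_le h andbT; have : ~ (r + 1 <= oval (x + y)) by move=> h'; apply: (nv (x + y)); [right|].
lia.
Qed.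
(** For a fraction of value 0 the residue is the quotient of the leading coefficients. *)
Lemma residue x : vge 0 x -> exists a, vge 1 (x - iota a).
Proof.
have [->|x0] := eqVneq x 0; first by exists 0; rewrite rmorph0 subr0; left.
move=> [/eqP|]; first by rewrite (negPf x0).
have [n [m [u [w [hu hw -> ->]]]]] := oval_is x0; have wu := degU hw => nm.
have [lt|le] := ltnP n m.
  exists 0; rewrite rmorph0 subr0; right; rewrite (ovalP (r := m%:Z - n%:Z)); first lia.
  by exists n, m, u, w.
have enm : n = m by lia.
subst m; case: (hu) (hw) => a a0 [u' hu' eu] [b b0 [w' hw' ew]].
exists (a * b^-1).
have -> : u / w - iota (a * b^-1) = (u - iota (a * b^-1) * w) / w by rewrite mulrBl mulrK.
have : ore_lt n (u - iota (a * b^-1) * w).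
  rewrite eu ew mulrDr mulrA -rmorphM /= mulrVK ?kdiv // opprD addrACA subrr add0r.
  by apply: ore_lt_sub => //; apply: ore_lt_scale.
case/ore_lt_deg=> [->|[i lt hi]]; first by rewrite mul0r; left.
by right; rewrite (ovalP (r := n%:Z - i%:Z)); [lia | exists i, n, (u - iota (a * b^-1) * w), w].
Qed.

(** Denominators stand on the right, so a common one is a common right multiple, provided by
    [ore_cond]. *)
Lemma common_den (x : nat -> K) m : exists M w u, w != 0 /\
  forall i, (i < m)%N -> ore_lt M (u i) /\ x i = u i * w^-1.
Proof.
suff [M [n [w [u [hw h]]]]] : exists M n w u, ore_deg n w /\
    forall i, (i < m)%N -> ore_lt M (u i) /\ x i = u i * w^-1.
  by exists M, w, u; split=> //; apply: ore_deg_neq0 hw.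
elim: m => [|m [M [n [w [u [hw h]]]]]].
  by exists 0%N, 0%N, 1, (fun=> 0); split=> //; apply: ore_deg1.
have [x0|xn] := eqVneq (x m) 0.
  exists M, n, w, (fun i => if (i < m)%N then u i else 0); split=> // i.
  by rewrite ltnS leq_eqVlt => /predU1P[->|lt]; [rewrite ltnn mul0r x0; split=> //; apply: ore_lt0 | rewrite lt; apply: h].
have [a [b [v [z [hv hz ex]]]]] := ore_frac xn.
have [n' [m' [f [g [hf hg e dg]]]]] := ore_cond hw hz.
have wgu : w * g \is a GRing.unit by exact: degU (ore_deg_mul hw hg).
exists (maxn (M + m') (a + n').+1), (n + m')%N, (w * g), (fun i => if (i < m)%N then u i * g else v * f).
split=> [|i]; first exact: ore_deg_mul.
rewrite ltnS leq_eqVlt => /predU1P[->|lt].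
  rewrite ltnn; split; last first.
    rewrite ex -mulrA; congr (_ * _); apply: (mulrI (degU hz)).
    by rewrite mulrV ?(degU hz) // mulrA -e mulrV.
  by apply: ore_lt_widen (leq_maxr _ _) _; case: (ore_deg_mul hv hf) => c _ /ore_lead_lt.
rewrite lt; have [hu ->] := h _ lt; split.
  apply: ore_lt_widen (leq_maxl _ _) _; apply: ore_lt_mul => //.
  by case: hg => c _ /ore_lead_lt.
rewrite -mulrA; congr (_ * _); apply: (mulrI (degU hw)).
by rewrite mulrV ?(degU hw) // mulrA mulrV.
Qed.
End OreValuation.

(** * Quotients by two-sided ideals and left linear dependence *)

Record ideal2 (R : nzRingType) := Ideal2 {
  id_in :> R -> Prop;
  id_0 : id_in 0;
  id_sub : forall a b, id_in a -> id_in b -> id_in (a - b);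
  id_mull : forall a b, id_in b -> id_in (a * b);
  id_mulr : forall a b, id_in a -> id_in (a * b);
  id_1 : ~ id_in 1 }.

Section QuotientRing.
Variables (R : nzRingType) (I : ideal2 R).
Definition id_pred : {pred R} := fun x => `[< I x >].
Lemma id_closed : zmod_closed id_pred.
Proof.
split=> [|a b /asboolP ha /asboolP hb]; apply/asboolP; [exact: id_0 | exact: id_sub].
Qed.
HB.instance Definition _ := GRing.isZmodClosed.Build R id_pred id_closed.
Definition quo := Quotient.quot id_pred.
HB.instance Definition _ := GRing.Zmodule.on quo.
Definition cls (x : R) : quo := (\pi_(Quotient.quot id_pred) x)%qT.
Definition rep (z : quo) : R := generic_quotient.repr (z : Quotient.quot id_pred).
Lemma repK z : cls (rep z) = z. Proof. exact: reprK. Qed.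
Lemma cls_eq x y : cls x = cls y <-> I (x - y).
Proof.
have := Quotient.idealrBE id_pred x y; rewrite /cls => h; split.
  by move/eqP; rewrite -h => /asboolP.
by move=> hI; apply/eqP; rewrite -h; apply/asboolP.
Qed.
Lemma cls_zmod : zmod_morphism cls.
Proof. exact: pi_is_zmod_morphism. Qed.
Lemma cls_nmod : nmod_morphism cls.
Proof.
have cls0 : cls 0 = 0 by rewrite -[X in cls X](subrr 0) cls_zmod subrr.
by split=> // x y; rewrite -[y in LHS]opprK -[- y]sub0r !cls_zmod cls0 sub0r opprK.
Qed.
HB.instance Definition _ := GRing.isNmodMorphism.Build R quo cls cls_nmod.
Definition quo_mul (x y : quo) : quo := cls (rep x * rep y).
Lemma quo_mulE x y : quo_mul (cls x) (cls y) = cls (x * y).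
Proof.
apply/cls_eq; have ex : I (rep (cls x) - x) by apply/cls_eq/repK.
have ey : I (rep (cls y) - y) by apply/cls_eq/repK.
have -> : rep (cls x) * rep (cls y) - x * y =
    (rep (cls x) - x) * rep (cls y) - x * - (rep (cls y) - y).
  by rewrite mulrN opprK mulrBl mulrBr addrA subrK.
apply: id_sub; first exact: id_mulr.
by apply: id_mull; rewrite -sub0r; apply: id_sub => //; apply: id_0.
Qed.
Lemma quo_mulA : associative quo_mul.
Proof. by move=> x y z; rewrite -[x]repK -[y]repK -[z]repK !quo_mulE mulrA. Qed.
Lemma quo_mul1 : left_id (cls 1) quo_mul.
Proof. by move=> x; rewrite -[x]repK quo_mulE mul1r. Qed.
Lemma quo_mulr1 : right_id (cls 1) quo_mul.
Proof. by move=> x; rewrite -[x]repK quo_mulE mulr1. Qed.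
Lemma quo_mulDl : left_distributive quo_mul +%R.
Proof. by move=> x y z; rewrite -[x]repK -[y]repK -[z]repK -raddfD !quo_mulE -raddfD mulrDl. Qed.
Lemma quo_mulDr : right_distributive quo_mul +%R.
Proof. by move=> x y z; rewrite -[x]repK -[y]repK -[z]repK -raddfD !quo_mulE -raddfD mulrDr. Qed.
Lemma quo_10 : cls 1 != 0.
Proof. by rewrite -(raddf0 cls); apply/eqP => /cls_eq; rewrite subr0; apply: id_1. Qed.
HB.instance Definition _ := GRing.Zmodule_isNzRing.Build quo
  quo_mulA quo_mul1 quo_mulr1 quo_mulDl quo_mulDr quo_10.
Lemma cls_mon : monoid_morphism cls.
Proof. by split=> // x y; rewrite -quo_mulE. Qed.
HB.instance Definition _ := GRing.isMonoidMorphism.Build R quo cls cls_mon.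
HB.instance Definition _ :=
  GRing.NzRing_hasMulInverse.Build quo (@cl_mulVr _) (@cl_mulrV _) (@cl_unitP _) (@cl_inv_out _).
End QuotientRing.

(** Gaussian elimination on m + 1 rows: left multiples of a row p with nonzero last entry are
    subtracted from the others, and its own coefficient [ap] is recovered at the end. *)
Lemma divring_dep (K : unitRingType) (m : nat) (v : nat -> nat -> K) : is_divring K ->
  exists a : nat -> K, (exists2 i, (i <= m)%N & a i != 0) /\
    forall j, (j < m)%N -> \sum_(i < m.+1) a i * v i j = 0.
Proof.
move=> div; elim: m v => [|m IH] v.
  by exists (fun=> 1); split=> //; exists 0%N => //; apply: oner_neq0.
have [[p pm vp]|no] := pselect (exists2 p, (p <= m.+1)%N & v p m != 0); last first.
  have [a [[i im ai] h]] := IH v; exists (fun i => if (i <= m)%N then a i else 0); split.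
    by exists i; [exact: ltnW | rewrite im].
  have v0 i' : (i' <= m.+1)%N -> v i' m = 0.
    by move=> le; have [//|nz] := eqVneq (v i' m) 0; case: no; exists i'.
  move=> j; rewrite ltnS leq_eqVlt => /predU1P[->|lt].
    by rewrite big1 // => i' _; rewrite v0 ?mulr0 // -ltnS.
  rewrite big_ord_recr /= ltnn mul0r addr0 -[RHS](h _ lt); apply: eq_bigr => i' _.
  by rewrite -ltnS ltn_ord.
have vpu := div _ vp.
have bp l : (bump p l == p) = false by rewrite eq_sym (negPf (neq_bump _ _)).
pose u i j := v (bump p i) j - v (bump p i) m * (v p m)^-1 * v p j.
have [b [[i im bi] h]] := IH u.
pose ap := - \sum_(i < m.+1) b i * (v (bump p i) m * (v p m)^-1).
exists (fun i => if i == p then ap else b (unbump p i)); split.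
  exists (bump p i); first by rewrite /bump; lia.
  by rewrite bp bumpK.
have eqs j : \sum_(i < m.+2) (if nat_of_ord i == p then ap else b (unbump p i)) * v i j = \sum_(i < m.+1) b i * u i j.
  rewrite (bigD1_ord (Ordinal (pm : p < m.+2)%N)) //= eqxx /ap mulNr mulr_suml addrC -sumrB.
  apply: eq_bigr => l _; rewrite /= bp bumpK /u mulrBr.
  by rewrite !mulrA.
move=> j; rewrite eqs ltnS leq_eqVlt => /predU1P[->|lt]; last exact: h.
by rewrite big1 // => l _; rewrite /u mulrVK // subrr mulr0.
Qed.

(** * Cauchy sequences in place of the completion of K *)

Section Sequences.
Variables (k K : unitRingType) (s d : k -> k) (iota : {rmorphism k -> K}) (t : K).
Hypotheses (kdiv : is_divring k) (saut : ring_aut s) (ofK : is_ore_fraction_field s d iota t).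
Notation vge := (vge iota t).
Notation oval := (oval iota t).
Let Kdiv : is_divring K. Proof. by case: ofK. Qed.
Let vD := @vgeD _ _ _ _ _ _ kdiv saut ofK.
Let vN := @vgeN _ _ _ _ _ _ kdiv saut ofK.
Let vM := @vgeM _ _ _ _ _ _ kdiv saut ofK.

Definition sbdd (f : nat -> K) := exists B, forall N, vge B (f N).
(** Convergence to 0 at the rate that truncation at order N provides; fixing the rate leaves a
    single constant B in place of a modulus of convergence. *)
Definition nul (f : nat -> K) := exists B, forall N : nat, vge (N%:Z + B) (f N).
Definition cau f := sbdd f /\ nul (fun N => f N.+1 - f N).
Definition evt r f := exists N0, forall N, (N0 <= N)%N -> f N != 0 /\ oval (f N) = r.

Lemma nul_ext f g : f =1 g -> nul f -> nul g. Proof. by move=> /funext ->. Qed.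
Lemma nul0 : nul (fun=> 0). Proof. by exists 0 => N; left. Qed.
Lemma nul_bdd f : nul f -> sbdd f.
Proof. by move=> [B h]; exists B => N; apply: vgeW (h N); lia. Qed.
Lemma nulD f g : nul f -> nul g -> nul (fun N => f N + g N).
Proof.
move=> [B hf] [B' hg]; exists (Num.min B B') => N.
by apply: vD; [apply: vgeW (hf N) | apply: vgeW (hg N)]; lia.
Qed.
Lemma nulN f : nul f -> nul (fun N => - f N).
Proof. by move=> [B hf]; exists B => N; apply: vN. Qed.
Lemma nulB f g : nul f -> nul g -> nul (fun N => f N - g N).
Proof. by move=> hf hg; apply: nulD => //; apply: nulN. Qed.
Lemma nul_mull f g : sbdd f -> nul g -> nul (fun N => f N * g N).
Proof.
move=> [B hf] [B' hg]; exists (B + B') => N; apply: vgeW (vM (hf N) (hg N)); lia.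
Qed.
Lemma nul_mulr f g : nul f -> sbdd g -> nul (fun N => f N * g N).
Proof.
move=> [B hf] [B' hg]; exists (B + B') => N; apply: vgeW (vM (hf N) (hg N)); lia.
Qed.
Lemma sbddD f g : sbdd f -> sbdd g -> sbdd (fun N => f N + g N).
Proof.
move=> [B hf] [B' hg]; exists (Num.min B B') => N.
by apply: vD; [apply: vgeW (hf N) | apply: vgeW (hg N)]; lia.
Qed.
Lemma sbddM f g : sbdd f -> sbdd g -> sbdd (fun N => f N * g N).
Proof. by move=> [B hf] [B' hg]; exists (B + B') => N; apply: vM. Qed.
Lemma bdd_const x : sbdd (fun=> x).
Proof. by exists (oval x) => N; right. Qed.
Lemma cau_bdd f : cau f -> sbdd f. Proof. by case. Qed.
Lemma nul_sum (I : Type) (rs : seq I) (f : I -> nat -> K) :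
  (forall i, nul (f i)) -> nul (fun N => \sum_(i <- rs) f i N).
Proof.
move=> h; elim: rs => [|i rs IH]; first by apply: nul_ext nul0 => N; rewrite big_nil.
by apply: nul_ext (nulD (h i) IH) => N; rewrite big_cons.
Qed.
Lemma cau_const x : cau (fun=> x).
Proof. by split; [exact: bdd_const | apply: nul_ext nul0 => N; rewrite subrr]. Qed.
Lemma cauD f g : cau f -> cau g -> cau (fun N => f N + g N).
Proof.
move=> [bf cf] [bg cg]; split; first exact: sbddD.
by apply: nul_ext (nulD cf cg) => N; rewrite opprD addrACA.
Qed.
Lemma cauM f g : cau f -> cau g -> cau (fun N => f N * g N).
Proof.
move=> [bf cf] [bg cg]; split; first exact: sbddM.
have bf' : sbdd (fun N => f N.+1) by case: bf => B h; exists B.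
apply: nul_ext (nulD (nul_mull bf' cg) (nul_mulr cf bg)) => N.
by rewrite mulrBr mulrBl addrA subrK.
Qed.
Lemma cauX f i : cau f -> cau (fun N => f N ^+ i).
Proof.
move=> h; elim: i => [|i IH]; first exact: cau_const.
by have := cauM h IH; congr cau; apply: funext => N; rewrite exprS.
Qed.
Lemma cau_horner (P : {poly K}) f : cau f -> cau (fun N => P.[f N]).
Proof.
move=> hf; under eq_fun do rewrite horner_coef.
elim: (size P) => [|i IH].
  by have := cau_const 0; congr cau; apply: funext => N; rewrite big_ord0.
have := cauD IH (cauM (cau_const P`_i) (cauX i hf)); congr cau.
by apply: funext => N; rewrite big_ord_recr.
Qed.
Lemma cau_step f : cau f -> exists B, forall N M : nat, (N <= M)%N -> vge (N%:Z + B) (f M - f N).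
Proof.
move=> [_ [B hB]]; exists B => N; elim=> [|M IH].
  by rewrite leqn0 => /eqP ->; rewrite subrr; left.
rewrite leq_eqVlt => /predU1P[->|le]; first by rewrite subrr; left.
have -> : f M.+1 - f N = (f M.+1 - f M) + (f M - f N) by rewrite addrA subrK.
by apply: vD; [apply: vgeW (hB M); lia | apply: IH].
Qed.
(** A term whose valuation is below the bound for its distance to later terms fixes the valuation of
    all of them. *)
Lemma cau_dich f : cau f -> nul f \/ exists r, evt r f.
Proof.
move=> /cau_step[B step].
have [[N nv]|no] := pselect (exists N : nat, ~ vge (N%:Z + B) (f N)); last first.
  by left; exists B => N; apply: contrapT => h; apply: no; exists N.
have f0 : f N != 0 by apply/eqP => h; apply: nv; left.
have lt : oval (f N) + 1 <= N%:Z + B.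
  by have : ~ (N%:Z + B <= oval (f N)) by [move=> h; apply: nv; right]; lia.
right; exists (oval (f N)), N => M le; rewrite -[f M](subrK (f N)) addrC.
by apply: (vge_val kdiv saut ofK) => //; apply: vgeW (step _ _ le).
Qed.
Lemma evt_nul r f : evt r f -> ~ nul f.
Proof.
move=> [N0 h] [B hB]; have [] := h (N0 + `|r - B|.+1)%N (leq_addr _ _).
have := hB (N0 + `|r - B|.+1)%N; case=> [->|]; first by rewrite eqxx.
by move=> le _ e; rewrite e in le; lia.
Qed.
Lemma evtM r r' f g : evt r f -> evt r' g -> evt (r + r') (fun N => f N * g N).
Proof.
move=> [N0 hf] [N1 hg]; exists (maxn N0 N1) => N; rewrite geq_max => /andP[/hf[f0 <-] /hg[g0 <-]].
by split; [exact: divring_mul_neq0 | exact: (ovalM kdiv saut ofK)].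
Qed.
Lemma evt_uniq r r' f : evt r f -> evt r' f -> r = r'.
Proof.
move=> [N0 h] [N1 h']; have [_ <-] := h (maxn N0 N1) (leq_maxl _ _).
by have [_ <-] := h' (maxn N0 N1) (leq_maxr _ _).
Qed.
Lemma nul_cancel r f g : evt r f -> cau g -> nul (fun N => f N * g N) -> nul g.
Proof. by move=> ef /cau_dich[//|[r' eg]] h; case: (evt_nul (evtM ef eg) h). Qed.
Lemma evt_near r f g : evt r f -> nul g -> evt r (fun N => f N + g N).
Proof.
move=> [N0 hf] [B hg]; exists (N0 + `|r - B|.+1)%N => N le.
have [f0 <-] := hf _ (leq_trans (leq_addr _ _) le).
apply: (vge_val kdiv saut ofK) => //; apply: vgeW (hg N).
have [_ e] := hf _ (leq_trans (leq_addr _ _) le); rewrite e; lia.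
Qed.

Variables (n : nat).
Hypotheses (n_gt0 : (0 < n)%N) (tn_central : forall x, t ^+ n * x = x * t ^+ n).
Variables (F : fieldType) (jF : {rmorphism F -> k}).
Hypothesis jF_c0 : forall a, in_c0 s d (jF a).

Definition central (x : K) := forall y, x * y = y * x.
Lemma centralD x y : central x -> central y -> central (x + y).
Proof. by move=> hx hy z; rewrite mulrDl mulrDr hx hy. Qed.
Lemma centralM x y : central x -> central y -> central (x * y).
Proof. by move=> hx hy z; rewrite -mulrA hy mulrA hx mulrA. Qed.
Lemma centralV x : central x -> central x^-1.
Proof.
move=> hx y; have [x0|x0] := eqVneq x 0; first by rewrite x0 invr0 mul0r mulr0.
have xu := Kdiv x0; apply: (mulrI xu); apply: (mulIr xu).
by rewrite mulVKr // mulrA mulrVK // hx.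
Qed.
Lemma centralX x i : central x -> central (x ^+ i).
Proof.
move=> hx; elim: i => [|i IH]; first by move=> y; rewrite mul1r mulr1.
by rewrite exprS; apply: centralM.
Qed.

Definition tau : K := (t ^+ n)^-1.
Lemma tau_central : central tau. Proof. exact: centralV. Qed.
Lemma tn_neq0 : t ^+ n != 0.
Proof. by case: (ovalX kdiv saut ofK n (t_neq0 ofK)). Qed.
Lemma tau_neq0 : tau != 0. Proof. by rewrite divring_inv_neq0 // tn_neq0. Qed.
Lemma oval_tau : oval tau = n%:Z.
Proof.
rewrite (ovalV kdiv saut ofK) ?tn_neq0 //.
by have [_ ->] := ovalX kdiv saut ofK n (t_neq0 ofK); rewrite (oval_t kdiv saut ofK); lia.
Qed.
Lemma tau_tn q : tau ^+ q * t ^+ (n * q) = 1.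
Proof.
rewrite exprM /tau; elim: q => [|q IH]; first by rewrite mulr1.
by rewrite exprSr exprS -mulrA [(t ^+ n)^-1 * _]mulrA mulVr ?Kdiv ?tn_neq0 // mul1r.
Qed.

Lemma iota_central a : central (iota (jF a)).
Proof.
have [ca [da sa]] := jF_c0 a; have [_ tE _ frac] := ofK.
have ct : t * iota (jF a) = iota (jF a) * t by rewrite tE sa da rmorph0 addr0.
have ctX i : t ^+ i * iota (jF a) = iota (jF a) * t ^+ i.
  elim: i => [|i IH]; first by rewrite mul1r mulr1.
  by rewrite exprS -mulrA IH mulrA ct mulrA.
have ce (p : {poly k}) : iota (jF a) * ore_eval iota t p = ore_eval iota t p * iota (jF a).
  rewrite /ore_eval mulr_sumr mulr_suml; apply: eq_bigr => i _.
  by rewrite mulrA -rmorphM ca rmorphM -!mulrA ctX.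
move=> y; have [p [q [q0 ->]]] := frac y.
have qu : ore_eval iota t q \is a GRing.unit by apply: (degU ofK (ore_deg_eval iota t q0)).
rewrite mulrA ce -!mulrA; congr (_ * _); apply: (mulrI qu); apply: (mulIr qu).
by rewrite mulVKr // !mulrA -ce mulrK // mulVKr.
Qed.

Definition iF : F -> K := iota \o jF.
HB.instance Definition _ := GRing.RMorphism.on iF.
Lemma iF_comm : commr_rmorph iF tau.
Proof. by move=> a; rewrite /GRing.comm tau_central. Qed.
Definition piF : {poly F} -> K := horner_morph iF_comm.
HB.instance Definition _ := GRing.RMorphism.on piF.
Lemma piX : piF 'X = tau. Proof. exact: horner_morphX. Qed.
Lemma piC a : piF a%:P = iF a. Proof. exact: horner_morphC. Qed.
Lemma piE m (P : {poly F}) : (size P <= m)%N -> piF P = \sum_(j < m) iF P`_j * tau ^+ j.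
Proof.
move=> le; rewrite /piF /horner_morph (@horner_coef_wide _ m); last first.
  by rewrite (leq_trans (size_poly _ _)).
by apply: eq_bigr => j _; rewrite coef_map.
Qed.
Lemma pi_central P : central (piF P).
Proof.
elim/poly_ind: P => [|P a IH]; first by move=> y; rewrite rmorph0 mul0r mulr0.
rewrite rmorphD rmorphM /= piX piC; apply: centralD; last exact: iota_central.
by apply: centralM => //; apply: tau_central.
Qed.
Lemma vge_pi P : vge 0 (piF P).
Proof.
elim/poly_ind: P => [|P a IH]; first by rewrite rmorph0; left.
rewrite rmorphD rmorphM /= piX piC; apply: vD; last exact: (vge_iota kdiv saut ofK).
by rewrite -(addr0 0); apply: vM => //; right; rewrite oval_tau.
Qed.
Lemma vge_tauX N : vge N%:Z (tau ^+ N).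
Proof.
by right; have [_ ->] := ovalX kdiv saut ofK N tau_neq0; rewrite oval_tau; nia.
Qed.
Lemma vge_pi_coef N (P : {poly F}) : (forall i, (i < N)%N -> P`_i = 0) -> vge N%:Z (piF P).
Proof.
move=> h; rewrite -[P](poly_take_drop N) (_ : take_poly N P = 0); last first.
  by apply/polyP => i; rewrite coef_take_poly coef0; case: ltnP => // /h.
rewrite add0r rmorphM rmorphXn /= piX -[N%:Z]add0r; apply: vM; [exact: vge_pi | exact: vge_tauX].
Qed.

(** The partial sums of f at T = t^-n: additive exactly, multiplicative up to a null sequence. *)
Definition sq (f : fps F) N : K := piF (trunc N f).
Lemma sqE f N : sq f N = \sum_(j < N) iF (cf f j) * tau ^+ j.
Proof.
rewrite /sq (@piE N) ?size_poly //; apply: eq_bigr => j _; by rewrite coef_trunc.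
Qed.
Lemma sq_central f N : central (sq f N). Proof. exact: pi_central. Qed.
Lemma sq_cau f : cau (sq f).
Proof.
split; first by exists 0 => N; apply: vge_pi.
exists 0 => N; rewrite addr0 /sq -rmorphB; apply: vge_pi_coef => i lt.
by rewrite coefB !coef_trunc ?subrr // ltnW.
Qed.
Lemma sq_bdd f : sbdd (sq f). Proof. by case: (sq_cau f). Qed.
Lemma sqD f g N : sq (f + g) N = sq f N + sq g N.
Proof. by rewrite !sqE -big_split; apply: eq_bigr => j _; rewrite cfD rmorphD mulrDl. Qed.
Lemma sqM f g : nul (fun N => sq (f * g) N - sq f N * sq g N).
Proof.
exists 0 => N; rewrite addr0 /sq -rmorphM -rmorphB; apply: vge_pi_coef => i lt.
rewrite coefB coef_trunc // cfM coefM; apply/eqP; rewrite subr_eq0; apply/eqP.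
by apply: eq_bigr => l _; rewrite !coef_trunc //; [apply: leq_ltn_trans lt; apply: leq_subr | apply: leq_trans lt].
Qed.
Lemma sq_p2s P : nul (fun N => sq (p2s P) N - piF P).
Proof.
exists 0 => N; rewrite addr0 /sq -rmorphB; apply: vge_pi_coef => i lt.
by rewrite coefB coef_trunc // cf_p2s subrr.
Qed.

Lemma sq0 N : sq 0 N = 0.
Proof. by rewrite sqE big1 // => j _; rewrite cf0 rmorph0 mul0r. Qed.
Lemma evt_hd f : hd f != 0 -> evt 0 (sq f).
Proof.
move=> f0; exists 1%N => -[//|N] _; rewrite sqE big_ord_recl expr0 mulr1.
have i0 : jF (hd f) != 0 by rewrite fmorph_eq0.
apply: (vge_val kdiv saut ofK); last first.
- apply: (vge_sum kdiv saut ofK) => i _; rewrite add0r -[1]add0r; apply: vM.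
    exact: (vge_iota kdiv saut ofK).
  by apply: vgeW (vge_tauX _); rewrite /= /bump; lia.
- exact: (oval_iota kdiv saut ofK).
by apply: contraTneq (rmorph_unit iota (kdiv i0)) => h; rewrite [iota _]h unitr0.
Qed.
Lemma sq_ev f r : nul (fun N => sq (ev f r) N - (map_poly piF r).[sq f N]).
Proof.
elim/poly_ind: r => [|r c IH].
  by apply: nul_ext nul0 => N; rewrite !rmorph0 horner0 sq0 subrr.
have := nulD (sq_p2s c) (nulD (sqM (ev f r) f) (nul_mulr IH (sq_bdd f))).
apply: nul_ext => N; rewrite rmorphD rmorphM /= evX evC sqD rmorphD rmorphM /= map_polyX map_polyC.
rewrite hornerMXaddC mulrBl opprD [RHS]addrACA [in RHS]addrC; congr (_ + _).
by rewrite addrA subrK.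
Qed.

(* The terms [c r j t^r tau^j] have pairwise distinct valuations [n j - r]. *)
Lemma skew_nul (c : nat -> nat -> k) :
  nul (fun N => \sum_(j < N) \sum_(r < n) iota (c r j) * t ^+ r * tau ^+ j) ->
  forall r j, (r < n)%N -> c r j = 0.
Proof.
move=> hnul; suff h j : forall r, (r < n)%N -> c r j = 0 by move=> r j; apply: h.
elim/ltn_ind: j => j IHj r0 lt0; apply: contrapT => c0.
(* At the least j with a nonzero coefficient, the largest r gives the least valuation; e = n - 1 - r
   makes it a minimum. *)
have ex : exists e, (e < n)%N && `[< c (n.-1 - e)%N j <> 0 >].
  by exists (n.-1 - r0)%N; rewrite (_ : n.-1 - (n.-1 - r0) = r0)%N; [apply/andP; split; [lia | exact/asboolP] | lia].
case: (ex_minnP ex) => e /andP[en /asboolP ce] emin.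
pose r := (n.-1 - e)%N; have rn : (r < n)%N by rewrite /r; lia.
have above r' : (r < r')%N -> (r' < n)%N -> c r' j = 0.
  move=> lt ltn; apply: contrapT => nz; have := emin (n.-1 - r')%N.
  rewrite (_ : n.-1 - (n.-1 - r') = r')%N; last lia.
  have -> : (n.-1 - r' < n)%N by lia.
  by move/(_ (introT (asboolP _) nz)); rewrite /r in lt; lia.
pose w : int := n%:Z * j%:Z - r%:Z.
have vterm r' j' : vge (n%:Z * j'%:Z - r'%:Z) (iota (c r' j') * t ^+ r' * tau ^+ j').
  rewrite addrC; apply: vM.
    rewrite -[X in vge X]add0r; apply: vM; first exact: (vge_iota kdiv saut ofK).
    by right; have [_ ->] := ovalX kdiv saut ofK r' (t_neq0 ofK); rewrite (oval_t kdiv saut ofK); lia.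
  by right; have [_ ->] := ovalX kdiv saut ofK j' tau_neq0; rewrite oval_tau; lia.
have [t0 vt0] : iota (c r j) * t ^+ r * tau ^+ j != 0 /\ oval (iota (c r j) * t ^+ r * tau ^+ j) = w.
  have [t0 vt] := ovalX kdiv saut ofK r (t_neq0 ofK).
  have [u0 vu] := ovalX kdiv saut ofK j tau_neq0.
  have i0 : iota (c r j) != 0.
    have cu : c r j \is a GRing.unit by apply: kdiv; apply/eqP.
    by apply: contraTneq (rmorph_unit iota cu) => ->; rewrite unitr0.
  have it0 := divring_mul_neq0 Kdiv i0 t0.
  split; first exact: divring_mul_neq0.
  rewrite (ovalM kdiv saut ofK) // (ovalM kdiv saut ofK) // (oval_iota kdiv saut ofK); last first.
    by apply/eqP.
  by rewrite vt vu (oval_t kdiv saut ofK) oval_tau /w; lia.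
apply: (@evt_nul w _ _ hnul); exists j.+1 => N ltN.
pose rest := \sum_(j' < N | j' != Ordinal ltN) \sum_(r' < n) iota (c r' j') * t ^+ r' * tau ^+ j'
  + \sum_(r' < n | r' != Ordinal rn) iota (c r' j) * t ^+ r' * tau ^+ j.
rewrite (bigD1 (Ordinal ltN)) //= (bigD1 (Ordinal rn)) //= -addrA [X in _ + X]addrC.
apply: (vge_val kdiv saut ofK t0 vt0); apply: vD; apply: (vge_sum kdiv saut ofK).
  move=> j' ne; apply: (vge_sum kdiv saut ofK) => r' _.
  case: (ltngtP j' j) => [lt|gt|e']; last by case/eqP: ne; apply: val_inj.
    by rewrite IHj // rmorph0 !mul0r; left.
  by apply: vgeW (vterm r' j'); have := ltn_ord r'; rewrite /w; nia.
move=> r' ne; case: (ltngtP r' r) => [lt|gt|e']; last by case/eqP: ne; apply: val_inj.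
  by apply: vgeW (vterm r' j); rewrite /w; lia.
by rewrite above // rmorph0 !mul0r; left.
Qed.

(** The identity t^e tau^M = t^(e mod n) tau^(M - e/n) rewrites a polynomial in t as one in the
    central [tau] over the span of the t^r with r < n. *)
Lemma ore_lt_tau M u : ore_lt iota t M u -> exists A : nat -> nat -> k,
  u * tau ^+ M = \sum_(r < n) \sum_(j < M.+1) iota (A r j) * t ^+ r * tau ^+ j.
Proof.
move=> /ore_ltP[b ->].
exists (fun r j => \sum_(e < M | ((e %% n)%N == r) && ((M - e %/ n)%N == j)) b e).
transitivity (\sum_(r < n) \sum_(j < M.+1) \sum_(e < M)
    (if ((e %% n)%N == r) && ((M - e %/ n)%N == j) then iota (b e) * t ^+ r * tau ^+ j else 0)); last first.
  apply: eq_bigr => r _; apply: eq_bigr => j _.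
  by rewrite rmorph_sum !mulr_suml [RHS]big_mkcond.
under [RHS]eq_bigr do rewrite exchange_big.
rewrite [RHS]exchange_big mulr_suml; apply: eq_bigr => e _ /=.
have rn : (e %% n < n)%N by rewrite ltn_pmod.
have jM : (M - e %/ n < M.+1)%N by rewrite ltnS leq_subr.
rewrite (bigD1 (Ordinal rn)) //= (bigD1 (Ordinal jM)) //= !eqxx /= big1; last first.
  by move=> j ne; case: eqP => // e'; case/eqP: ne; apply: val_inj.
rewrite big1; last first.
  move=> r ne; rewrite big1 // => j _; case: eqP => // e'; case/eqP: ne; exact: val_inj.
rewrite !addr0 -!mulrA; congr (_ * _).
have le : (e %/ n <= M)%N by rewrite (leq_trans (leq_div _ _)) // ltnW.
rewrite {1}(divn_eq e n) addnC exprD -mulrA; congr (_ * _).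
rewrite -[X in tau ^+ X](subnKC le) exprD mulrA [t ^+ _ * _](_ : _ = 1) ?mul1r //.
by rewrite mulnC -(centralX _ tau_central) tau_tn.
Qed.

(** A right denominator and a power of [tau] bring the relation into the sum of the k t^r, r < n,
    with coefficients polynomial in [tau]. [skew_nul] separates the pairs (r, j) and the
    F-independent family [bs] separates k from F, leaving relations of the same degree over F[T]. *)
Lemma series_indep m (y : fps F) (P : {poly K}) :
  (forall r : {poly {poly F}}, (size r <= m)%N -> ev y r = 0 -> r = 0) ->
  (size P <= m)%N -> nul (fun N => P.[sq y N]) -> P = 0.
Proof.
move=> dom szP hP.
have [M [w [u [w0 hu]]]] := common_den kdiv saut ofK (fun i => P`_i) m.
have [A hA] : exists A : nat -> nat -> nat -> k, forall i, (i < m)%N ->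
    u i * tau ^+ M = \sum_(r < n) \sum_(j < M.+1) iota (A i r j) * t ^+ r * tau ^+ j.
  have H i : exists A : nat -> nat -> k, (i < m)%N ->
      u i * tau ^+ M = \sum_(r < n) \sum_(j < M.+1) iota (A r j) * t ^+ r * tau ^+ j.
    case: (ltnP i m) => [lt|_]; last by exists (fun=> fun=> 0).
    by have [/ore_lt_tau[A hA] _] := hu _ lt; exists A.
  by have [A hA] := choice H; exists A.
have nulA : nul (fun N => \sum_(i < m) (u i * tau ^+ M) * sq y N ^+ i).
  apply: nul_ext (nul_mulr hP (bdd_const (w * tau ^+ M))) => N.
  rewrite (horner_coef_wide _ szP) mulr_suml; apply: eq_bigr => i _.
  have [_ ->] := hu _ (ltn_ord i); rewrite -!mulrA; congr (_ * _).
  have cX := centralX i (sq_central y N); rewrite mulrA.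
  by rewrite [_^-1 * _ * _](_ : _ = sq y N ^+ i * tau ^+ M) ?cX // -mulrA cX !mulrA mulVr ?mul1r ?Kdiv // -cX.
pose cs := codom (fun x : 'I_m * 'I_n * 'I_M.+1 => A x.1.1 x.1.2 x.2).
have [bs [co [ind hco co0]]] := indep_basis jF cs.
have Ac i r j : (i < m)%N -> (r < n)%N -> (j < M.+1)%N -> A i r j = comb jF (co (A i r j)) bs.
  move=> im rn jM; apply: hco; apply/codomP.
  by exists (Ordinal im, Ordinal rn, Ordinal jM).
pose B l r : {poly {poly F}} := \poly_(i < m) \poly_(j < M.+1) co (A i r j) l.
pose f l r := ev y (B l r).
have sqf l r : nul (fun N => sq (f l r) N - \sum_(i < m) piF (B l r)`_i * sq y N ^+ i).
  apply: nul_ext (sq_ev y (B l r)) => N; rewrite (@horner_coef_wide _ m).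
    by congr (_ - _); apply: eq_bigr => i _; rewrite coef_map.
  by rewrite (leq_trans (size_poly _ _)) ?size_poly.
pose c r j := comb jF (fun l => cf (f l r) j) bs.
have cnul : nul (fun N => \sum_(j < N) \sum_(r < n) iota (c r j) * t ^+ r * tau ^+ j).
  have E N : \sum_(j < N) \sum_(r < n) iota (c r j) * t ^+ r * tau ^+ j =
      \sum_(r < n) \sum_(l < size bs) iota bs`_l * t ^+ r * sq (f l r) N.
    rewrite exchange_big; apply: eq_bigr => r _; rewrite /c /comb.
    under eq_bigr do rewrite rmorph_sum !mulr_suml.
    rewrite exchange_big; apply: eq_bigr => l _; rewrite sqE mulr_sumr; apply: eq_bigr => j _.
    rewrite rmorphM /= (iota_central (cf (f l r) j)) -!mulrA; congr (_ * _).
    by rewrite mulrA (iota_central (cf (f l r) j)) -mulrA; congr (_ * _).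
  have E2 N : \sum_(i < m) (u i * tau ^+ M) * sq y N ^+ i =
      \sum_(r < n) \sum_(l < size bs) iota bs`_l * t ^+ r * (\sum_(i < m) piF (B l r)`_i * sq y N ^+ i).
    under [RHS]eq_bigr do under eq_bigr do rewrite mulr_sumr.
    under [RHS]eq_bigr do rewrite exchange_big.
    rewrite [RHS]exchange_big; apply: eq_bigr => i _ /=; rewrite hA // mulr_suml.
    apply: eq_bigr => r _; under [RHS]eq_bigr do rewrite mulrA; rewrite -mulr_suml; congr (_ * _).
    transitivity (\sum_(j < M.+1) \sum_(l < size bs) iota bs`_l * t ^+ r * (iF (co (A i r j) l) * tau ^+ j)).
      apply: eq_bigr => j _; rewrite (Ac i r j) // {1}/comb rmorph_sum !mulr_suml.
      rewrite -(Ac i r j) //; apply: eq_bigr => l _.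
      rewrite rmorphM /= (iota_central (co (A i r j) l)) -!mulrA; congr (_ * _).
      by rewrite mulrA (iota_central (co (A i r j) l)) -mulrA.
    rewrite exchange_big; apply: eq_bigr => l _; rewrite -mulr_sumr; congr (_ * _).
    rewrite /B coef_poly ltn_ord (@piE M.+1) ?size_poly //; apply: eq_bigr => j _.
    by rewrite coef_poly ltn_ord.
  have E3 : nul (fun N => \sum_(r < n) \sum_(l < size bs) iota bs`_l * t ^+ r *
      (sq (f l r) N - \sum_(i < m) piF (B l r)`_i * sq y N ^+ i)).
    apply: nul_sum => r; apply: nul_sum => l; apply: nul_mull; [exact: bdd_const | exact: sqf].
  apply: nul_ext (nulD E3 nulA) => N; rewrite E E2 -big_split; apply: eq_bigr => r _.
  by rewrite -big_split; apply: eq_bigr => l _ /=; rewrite -mulrDr subrK.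
have c0 := skew_nul cnul.
have f0 l r : (l < size bs)%N -> (r < n)%N -> f l r = 0.
  move=> lb rn; apply: fpsP => j; rewrite cf0.
  exact: (ind (fun l => cf (f l r) j) (c0 r j rn) l lb).
have B0 l r : (l < size bs)%N -> (r < n)%N -> B l r = 0.
  by move=> lb rn; apply: dom; [rewrite size_poly | apply: f0].
have A0 i r j : (i < m)%N -> (r < n)%N -> (j < M.+1)%N -> A i r j = 0.
  move=> im rn jM; rewrite Ac // /comb big1 // => l _.
  have := congr1 (fun P : {poly {poly F}} => (P`_i)`_j) (B0 l r (ltn_ord l) rn).
  by rewrite !coef0 coef_poly im coef_poly jM => ->; rewrite rmorph0 mul0r.
apply/polyP => i; rewrite coef0; case: (ltnP i m) => [im|le]; last by rewrite nth_default // (leq_trans szP).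
have [_ ->] := hu _ im; have : u i * tau ^+ M = 0.
  rewrite hA // big1 // => r _; rewrite big1 // => j _.
  by rewrite A0 ?ltn_ord // rmorph0 !mul0r.
case/(divring_mulf_eq0 Kdiv) => [->|/eqP]; first by rewrite mul0r.
by have [/negPf -> _] := ovalX kdiv saut ofK M tau_neq0.
Qed.

(** * The Galois extension of the Ore field of fractions *)

Variables (gT : finGroupType) (y : gT -> fps F) (p : {poly {poly F}}).
Hypothesis py : map_poly (@p2s F) p = \prod_(g in [set: gT]%G) ('X - (y g)%:P).
Hypothesis ydist : forall g h, g \in [set: gT]%G -> h \in [set: gT]%G -> g != h ->
  hd (y g) - hd (y h) \is a GRing.unit.
Variables (e : {poly F}) (Q : gT -> {poly {poly F}}).
Hypothesis e0 : e`_0 = 1.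
Hypothesis hQ : forall u g, p2s e * y (u * g)%g * ev (y g) p^`() = ev (y g) (Q u).
Hypothesis dom : forall r : {poly {poly F}}, (size r <= #|[set: gT]|)%N -> ev (y 1%g) r = 0 -> r = 0.

Let sc g N : central (sq (y g) N) := @sq_central (y g) N.
Let cy g : cau (sq (y g)) := sq_cau (y g).
Let bh (P : {poly K}) g : sbdd (fun N => P.[sq (y g) N]) := cau_bdd (cau_horner P (cy g)).

Lemma horner_sqM (P R : {poly K}) f N : (P * R).[sq f N] = P.[sq f N] * R.[sq f N].
Proof. by apply: hornerM_comm; rewrite /comm_poly sq_central. Qed.

(** X commutes with K in {poly K} and the partial sums of y are central: evaluation is
    multiplicative, and its kernel is two-sided. *)
Definition cover_ideal : ideal2 {poly K}.
Proof.
apply: (@Ideal2 _ (fun P : {poly K} => nul (fun N => P.[sq (y 1%g) N]))).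
- by apply: nul_ext nul0 => N; rewrite horner0.
- by move=> a b ha hb; apply: nul_ext (nulB ha hb) => N; rewrite hornerD hornerN.
- by move=> a b hb; apply: nul_ext (nul_mull (bh a 1%g) hb) => N; rewrite horner_sqM.
- by move=> a b ha; apply: nul_ext (nul_mulr ha (bh b 1%g)) => N; rewrite horner_sqM.
move=> h; apply: (@evt_nul 0 (fun=> 1)).
  by exists 0%N => N _; rewrite oner_neq0 (oval1 kdiv saut ofK).
by apply: nul_ext h => N; rewrite hornerC.
Defined.

Notation L := (quo cover_ideal).
Notation cl := (cls cover_ideal).
Definition jL : K -> L := cls cover_ideal \o polyC.
HB.instance Definition _ := GRing.RMorphism.on jL.

(** [f] converges to the image of z in the completion under X -> y(1). A sequence represents at most
    one z, so identities in L can be checked on sequences. *)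
Definition Rp (z : L) (f : nat -> K) :=
  exists2 P, z = cl P & nul (fun N => f N - P.[sq (y 1%g) N]).
Lemma cl0 (P : {poly K}) : cl P = 0 <-> nul (fun N => P.[sq (y 1%g) N]).
Proof.
rewrite -[0](rmorph0 (cls cover_ideal)) cls_eq subr0; exact: iff_refl.
Qed.
Lemma Rp_cl P : Rp (cl P) (fun N => P.[sq (y 1%g) N]).
Proof. by exists P => //; apply: nul_ext nul0 => N; rewrite subrr. Qed.
Lemma Rp_ex z : exists2 f, Rp z f & cau f.
Proof.
rewrite -[z]repK; exists (fun N => (rep z).[sq (y 1%g) N]); first exact: Rp_cl.
exact: cau_horner.
Qed.
Lemma Rp_near z f g : Rp z f -> nul (fun N => g N - f N) -> Rp z g.
Proof.
move=> [P -> h] h'; exists P => //; apply: nul_ext (nulD h' h) => N.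
by rewrite addrA subrK.
Qed.
Lemma Rp_bdd z f : Rp z f -> sbdd f.
Proof.
move=> [P _ h]; have := sbddD (nul_bdd h) (bh P 1%g); congr sbdd.
by apply: funext => N; rewrite subrK.
Qed.
Lemma RpD z z' f f' : Rp z f -> Rp z' f' -> Rp (z + z') (fun N => f N + f' N).
Proof.
move=> [P -> h] [P' -> h']; exists (P + P'); first by rewrite rmorphD.
by apply: nul_ext (nulD h h') => N; rewrite hornerD opprD addrACA.
Qed.
Lemma RpM z z' f f' : Rp z f -> Rp z' f' -> Rp (z * z') (fun N => f N * f' N).
Proof.
move=> hz hz'; have bf := Rp_bdd hz; move: hz hz' => [P -> h] [P' -> h'].
exists (P * P'); first by rewrite rmorphM.
apply: nul_ext (nulD (nul_mull bf h') (nul_mulr h (bh P' 1%g))) => N.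
by rewrite horner_sqM mulrBr mulrBl addrA subrK.
Qed.
Lemma Rp_j x : Rp (jL x) (fun=> x).
Proof. by exists x%:P => //; apply: nul_ext nul0 => N; rewrite hornerC subrr. Qed.
Lemma Rp_nul z f : Rp z f -> nul f -> z = 0.
Proof.
move=> [P -> h] hf; apply/cl0; apply: nul_ext (nulB hf h) => N.
by rewrite opprB addrC subrK.
Qed.
Lemma Rp0 f : Rp 0 f -> nul f.
Proof.
by move=> [P /esym/cl0 h] h'; apply: nul_ext (nulD h' h) => N; rewrite subrK.
Qed.
Lemma Rp_opp z f : Rp z f -> Rp (- z) (fun N => - f N).
Proof.
move=> [P -> h]; exists (- P); first by rewrite rmorphN.
by apply: nul_ext (nulN h) => N; rewrite hornerN opprB opprK addrC.
Qed.
Lemma Rp_uniq z z' f : Rp z f -> Rp z' f -> z = z'.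
Proof.
move=> h h'; apply/eqP; rewrite -subr_eq0; apply/eqP.
by apply: (Rp_nul (RpD h (Rp_opp h'))); apply: nul_ext nul0 => N; rewrite subrr.
Qed.
Lemma Rp_evt z f : Rp z f -> cau f -> z != 0 -> exists r, evt r f.
Proof. by move=> h cf z0; case: (cau_dich cf) => // hn; rewrite (Rp_nul h hn) eqxx in z0. Qed.

Lemma L_domain (z z' : L) : z * z' = 0 -> z = 0 \/ z' = 0.
Proof.
move=> zz; have [f hf cf] := Rp_ex z; have [f' hf' cf'] := Rp_ex z'.
have [->|z0] := eqVneq z 0; first by left.
have [->|z0'] := eqVneq z' 0; first by right.
have [r ef] := Rp_evt hf cf z0; have [r' ef'] := Rp_evt hf' cf' z0'.
by case: (evt_nul (evtM ef ef')); apply: Rp0; rewrite -zz; apply: RpM.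
Qed.

Notation mp := (map_poly piF).
Notation mj := (map_poly jL).
Let c0 : L := cl 'X.

Lemma clE (P : {poly K}) : cl P = (mj P).[c0].
Proof.
elim/poly_ind: P => [|P a IH]; first by rewrite !rmorph0 horner0.
by rewrite [in RHS]rmorphD rmorphM /= map_polyX map_polyC hornerMXaddC -IH rmorphD rmorphM.
Qed.
Lemma Rp_horner c f (P : {poly K}) : Rp c f -> Rp (mj P).[c] (fun N => P.[f N]).
Proof.
move=> hc; elim/poly_ind: P => [|P a IH].
  rewrite rmorph0 horner0 -(rmorph0 jL); have := Rp_j 0; congr Rp.
  by apply: funext => N; rewrite horner0.
rewrite rmorphD rmorphM /= map_polyX map_polyC hornerMXaddC.
have := RpD (RpM IH hc) (Rp_j a); congr Rp; apply: funext => N.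
by rewrite hornerMXaddC.
Qed.
Lemma Rp_c0 : Rp c0 (sq (y 1%g)).
Proof. by have := Rp_cl 'X; congr Rp; apply: funext => N; rewrite hornerX. Qed.
Lemma Rp_ev c f r : Rp c (sq f) -> Rp (mj (mp r)).[c] (sq (ev f r)).
Proof. by move=> hc; apply: Rp_near (Rp_horner _ hc) _; apply: sq_ev. Qed.
Lemma Rp_central c f z : Rp c (sq f) -> c * z = z * c.
Proof.
move=> hc; have [g hg _] := Rp_ex z; apply: (Rp_uniq (RpM hc hg)).
have := RpM hg hc; congr Rp; apply: funext => N; by rewrite sq_central.
Qed.
Lemma pK_monic : mp p \is monic. Proof. by rewrite monic_map // (p_monic py). Qed.
Lemma size_pK : size (mp p) = #|gT|.+1.
Proof. by rewrite size_map_poly_id0 ?(monicP (p_monic py)) ?rmorph1 ?oner_neq0 // (size_p py) cardsT. Qed.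
Lemma pK_root c g : Rp c (sq (y g)) -> (mj (mp p)).[c] = 0.
Proof.
move=> hc; apply: (Rp_nul (Rp_ev p hc)); rewrite (ev_p py) ?in_setT //.
by apply: nul_ext nul0 => N; rewrite sq0.
Qed.
Lemma cl_rem P : exists2 R : {poly K}, (size R <= #|gT|)%N & exists q, P = q * mp p + R.
Proof.
exists (Pdiv.CommonRing.rmodp P (mp p)); last first.
  by exists (Pdiv.CommonRing.rdivp P (mp p)); apply: Pdiv.RingMonic.rdivp_eq pK_monic _.
by rewrite -ltnS -size_pK Pdiv.CommonRing.ltn_rmodpN0 // monic_neq0 // pK_monic.
Qed.
Lemma horner_central c f (P R : {poly K}) : Rp c (sq f) ->
  (mj (P * R)).[c] = (mj P).[c] * (mj R).[c].
Proof.
by move=> hc; rewrite rmorphM; apply: hornerM_comm; rewrite /comm_poly (Rp_central _ hc).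
Qed.
Lemma cl_small P : exists2 R : {poly K}, (size R <= #|gT|)%N & cl P = cl R.
Proof.
have [R szR [q ->]] := cl_rem P; exists R => //.
by rewrite rmorphD rmorphM /= (clE (mp p)) (pK_root Rp_c0) mulr0 add0r.
Qed.
(** After division by the monic [p] the remainder has degree below |G|, so it is zero by linear
    disjointness: the ideal is generated by [p], which also vanishes at every conjugate. *)
Lemma cl_ker P g c : Rp c (sq (y g)) -> cl P = 0 -> (mj P).[c] = 0.
Proof.
move=> hc P0; have [R szR [q eP]] := cl_rem P.
have R0 : R = 0.
  apply: (@series_indep #|gT| (y 1%g) R _ szR).
    by move=> r szr; apply: dom; rewrite cardsT.
  apply/cl0; move: P0; rewrite eP rmorphD rmorphM /= (clE (mp p)) (pK_root Rp_c0).
  by rewrite mulr0 add0r.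
by rewrite eP R0 addr0 (horner_central _ _ hc) (pK_root hc) mulr0.
Qed.

(** Powers of z are cancelled until the constant term is nonzero; the relation then exhibits a left
    inverse. *)
Lemma left_inverse_dep (z : L) q (a : nat -> K) : z != 0 -> (exists2 i, (i < q)%N & a i != 0) ->
  \sum_(i < q) jL (a i) * z ^+ i = 0 -> exists w, w * z = 1.
Proof.
move=> z0; elim: q a => [|q IH] a [i iq ai]; first by [].
rewrite big_ord_recl expr0 mulr1; under eq_bigr do rewrite /= /bump /= add1n exprSr mulrA.
rewrite -mulr_suml; set W := \sum_(_ < q) _ => h.
have [a0|a0] := eqVneq (a 0%N) 0; last first.
  exists (- jL (a 0%N)^-1 * W); rewrite -mulrA mulNr -mulrN.
  have -> : - (W * z) = jL (a 0%N) by apply/eqP; rewrite eq_sym -subr_eq0 opprK h.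
  by rewrite -rmorphM mulVr ?Kdiv // rmorph1.
move: h; rewrite a0 rmorph0 add0r => /L_domain[h|/eqP]; last by rewrite (negPf z0).
apply: (IH (fun i => a i.+1)) h; case: i iq ai => [|i] iq ai; first by rewrite a0 eqxx in ai.
by exists i.
Qed.

Lemma L_divring : is_divring L.
Proof.
move=> z z0; have [w wz] : exists w, w * z = 1.
  have H i : exists v : nat -> K, z ^+ i = \sum_(l < #|gT|) jL (v l) * c0 ^+ l.
    have [R szR e1] := cl_small (rep (z ^+ i)); exists (fun l => R`_l).
    rewrite -[LHS]repK e1 clE (@horner_coef_wide _ #|gT|); last first.
      by rewrite (leq_trans (size_poly _ _)).
    by apply: eq_bigr => l _; rewrite coef_map.
  have [v hv] := choice H; have [a [[i im ai] h]] := divring_dep #|gT| v Kdiv.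
  apply: (@left_inverse_dep z #|gT|.+1 a z0); first by exists i.
  under eq_bigr do rewrite hv mulr_sumr; rewrite exchange_big big1 // => l _ /=.
  under eq_bigr do rewrite mulrA -rmorphM.
  by rewrite -mulr_suml -rmorph_sum h // rmorph0 mul0r.
apply/unitrP; exists w; split=> //; apply/eqP; rewrite -subr_eq0; apply/eqP.
have /L_domain[//|/eqP] : (z * w - 1) * z = 0 by rewrite mulrBl -mulrA wz mulr1 mul1r subrr.
by rewrite (negPf z0).
Qed.

(** The factor e p'(y g) has nonzero residue, so it can be cancelled from the identity [hQ] in the
    limit. *)
Lemma conj_solve g u c X : Rp c (sq (y g)) ->
  jL (piF e) * (mj (mp p^`())).[c] * X = (mj (mp (Q u))).[c] -> Rp X (sq (y (u * g)%g)).
Proof.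
move=> hc eX; have [f hf cf] := Rp_ex X.
have hpe : Rp (jL (piF e)) (sq (p2s e)) by apply: Rp_near (Rp_j _) (sq_p2s e).
set A := p2s e * ev (y g) p^`().
have hA : Rp (jL (piF e) * (mj (mp p^`())).[c]) (sq A).
  by apply: Rp_near (RpM hpe (Rp_ev _ hc)) (sqM _ _).
have evA : evt 0 (sq A).
  apply: evt_hd; rewrite rmorphM /= hd_p2s e0 mul1r -unitfE.
  by apply: (hd_ev_deriv_unit ydist py); rewrite in_setT.
have hAy : Rp (mj (mp (Q u))).[c] (fun N => sq A N * sq (y (u * g)%g) N).
  apply: (Rp_near (Rp_ev (Q u) hc)); rewrite -hQ mulrAC -/A.
  by apply: nul_ext (nulN (sqM A (y (u * g)%g))) => N; rewrite opprB.
have h0 : nul (fun N => sq A N * (sq (y (u * g)%g) N - f N)).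
  apply: nul_ext (Rp0 (_ : Rp 0 (fun N => sq A N * sq (y (u * g)%g) N - sq A N * f N))) => [N|].
    by rewrite mulrBr.
  by rewrite -(subrr (mj (mp (Q u))).[c]) -{2}eX; apply: RpD hAy (Rp_opp (RpM hA hf)).
apply: (Rp_near hf); apply: nul_cancel evA _ h0; apply: cauD (cy _) _.
have := cauM (cau_const (-1)) cf; congr cau; apply: funext => N; by rewrite mulN1r.
Qed.

Lemma conj_ex u : exists c, Rp c (sq (y u)) /\
  jL (piF e) * (mj (mp p^`())).[c0] * c = (mj (mp (Q u))).[c0].
Proof.
set a := jL (piF e) * _; have a0 : a != 0.
  apply/eqP => a0.
  have hpe : Rp (jL (piF e)) (sq (p2s e)) by apply: Rp_near (Rp_j _) (sq_p2s e).
  have hA : Rp a (sq (p2s e * ev (y 1%g) p^`())).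
    by apply: Rp_near (RpM hpe (Rp_ev _ Rp_c0)) (sqM _ _).
  rewrite a0 in hA; apply: (evt_nul (evt_hd _)) (Rp0 hA).
  rewrite rmorphM /= hd_p2s e0 mul1r -unitfE.
  by apply: (hd_ev_deriv_unit ydist py); rewrite in_setT.
exists (a^-1 * (mj (mp (Q u))).[c0]).
have eX : a * (a^-1 * (mj (mp (Q u))).[c0]) = (mj (mp (Q u))).[c0] by rewrite mulVKr // L_divring.
by split=> //; have := conj_solve Rp_c0 eX; rewrite mulg1.
Qed.
Definition cj u : L := projT1 (cid (conj_ex u)).
Lemma cjP u : Rp (cj u) (sq (y u)). Proof. by rewrite /cj; case: cid => c []. Qed.
Lemma cjE u : jL (piF e) * (mj (mp p^`())).[c0] * cj u = (mj (mp (Q u))).[c0].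
Proof. by rewrite /cj; case: cid => c []. Qed.
Lemma cj1 : cj 1%g = c0. Proof. exact: Rp_uniq (cjP _) Rp_c0. Qed.
Lemma cj_central u z : cj u * z = z * cj u. Proof. exact: Rp_central (cjP u). Qed.
Lemma cj_inj : injective cj.
Proof.
move=> u v euv; apply/eqP/negP => /negP ne.
have nz : hd (y u - y v) != 0.
  by rewrite rmorphB -unitfE /=; apply: ydist; rewrite ?in_setT.
have := RpD (cjP u) (Rp_opp (cjP v)); rewrite euv subrr => /Rp0 h.
apply: (evt_nul (evt_hd nz)); apply: nul_ext h => N.
by apply/eqP; rewrite subr_eq -sqD subrK.
Qed.

Definition act u (z : L) : L := (mj (rep z)).[cj u].
Lemma actE u P : act u (cl P) = (mj P).[cj u].
Proof.
apply/eqP; rewrite -subr_eq0 /act -hornerN -hornerD -!rmorphB; apply/eqP.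
by apply: (cl_ker (cjP u)); rewrite rmorphB /= repK subrr.
Qed.
Lemma actD u x z : act u (x + z) = act u x + act u z.
Proof.
by rewrite -[x]repK -[z]repK -rmorphD !actE rmorphD hornerD.
Qed.
Lemma actM u x z : act u (x * z) = act u x * act u z.
Proof.
by rewrite -[x]repK -[z]repK -rmorphM !actE (horner_central _ _ (cjP u)).
Qed.
Lemma act_j u x : act u (jL x) = jL x.
Proof. by rewrite [jL x]/(cl x%:P) actE map_polyC hornerC. Qed.
Lemma act_c0 u : act u c0 = cj u. Proof. by rewrite actE map_polyX hornerX. Qed.
Lemma hom_horner (psi : L -> L) c (P : {poly K}) : (forall x z, psi (x + z) = psi x + psi z) ->
  (forall x z, psi (x * z) = psi x * psi z) -> (forall x, psi (jL x) = jL x) ->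
  psi (mj P).[c] = (mj P).[psi c].
Proof.
move=> hD hM hj; elim/poly_ind: P => [|P a IH].
  by rewrite rmorph0 !horner0 -(rmorph0 jL) hj.
by rewrite rmorphD rmorphM /= map_polyX map_polyC !hornerMXaddC hD hM IH hj.
Qed.
Lemma act_ext (psi : L -> L) u : (forall x z, psi (x + z) = psi x + psi z) ->
  (forall x z, psi (x * z) = psi x * psi z) -> (forall x, psi (jL x) = jL x) ->
  psi c0 = cj u -> psi =1 act u.
Proof.
by move=> hD hM hj h z; rewrite -[z]repK actE clE (hom_horner _ _ hD hM hj) h.
Qed.
Lemma act_cj u v : act u (cj v) = cj (v * u).
Proof.
apply: Rp_uniq (cjP _); apply: (conj_solve (cjP u)).
have := congr1 (act u) (cjE v); rewrite !actM act_j.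
by rewrite !(hom_horner _ _ (actD u) (actM u) (act_j u)) act_c0.
Qed.
Lemma act_comp u v z : act u (act v z) = act (v * u) z.
Proof.
apply: (@act_ext (fun z => act u (act v z)) (v * u)%g) => [x x'|x x'|x|].
- by rewrite !actD.
- by rewrite !actM.
- by rewrite !act_j.
by rewrite act_c0 act_cj.
Qed.
Lemma act1 z : act 1 z = z.
Proof. by apply/esym; apply: (@act_ext id) => //; rewrite cj1. Qed.

Lemma act_gal u : in_Gal jL (act u).
Proof.
split; last exact: act_j; split; [exact: actD | exact: actM | by rewrite -(rmorph1 jL) act_j |].
by exists (act u^-1) => z; rewrite act_comp ?mulgV ?mulVg act1.
Qed.
Lemma conj_uniq_roots (rs : seq L) : {in rs &, forall x z, x * z = z * x} -> uniq rs -> uniq_roots rs.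
Proof.
elim: rs => [//|x rs IH] com /= /andP[xn urs]; apply/andP; split; last first.
  by apply: IH => // a b ha hb; apply: com; rewrite inE ?ha ?hb orbT.
apply/allP => z zr; apply/andP; split; first by rewrite com ?inE ?eqxx ?zr ?orbT.
by apply: L_divring; rewrite subr_eq0; apply: contraNneq xn => <-.
Qed.
Lemma cj_uniq : uniq [seq cj g | g <- enum gT].
Proof. by rewrite map_inj_uniq ?enum_uniq //; apply: cj_inj. Qed.

(** [f c0] is a root of [p] commuting with the |G| roots [cj g]; in a division ring a polynomial has
    no more pairwise commuting roots than its degree. *)
Lemma act_surj f : in_Gal jL f -> exists g, f =1 act g.
Proof.
move=> [[fD fM f1 _] fj].
suff [g hg] : exists g, f c0 = cj g by exists g; apply: act_ext.
apply: contrapT => no; pose rs := f c0 :: [seq cj g | g <- enum gT].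
have : (size rs < size (mj (mp p)))%N.
  apply: max_ring_poly_roots.
  - by rewrite monic_neq0 // monic_map // pK_monic.
  - apply/andP; split; last first.
      by apply/allP => _ /mapP[g _ ->]; rewrite /root (pK_root (cjP g)).
    rewrite /root -(hom_horner _ _ fD fM fj) (pK_root Rp_c0); apply/eqP.
    by have := fj 0; rewrite rmorph0.
  apply: conj_uniq_roots.
    move=> x z; rewrite !inE => /predU1P[->|/mapP[g _ ->]]; last by rewrite cj_central.
    by case/predU1P=> [->|/mapP[g _ ->]] //; rewrite cj_central.
  rewrite /= cj_uniq andbT; apply/negP => /mapP[g _ h]; apply: no; by exists g.
rewrite size_map_poly_id0 ?(monicP pK_monic) ?rmorph1 ?oner_neq0 // size_pK /= size_map -cardE.
by rewrite ltnn.
Qed.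

(** If x = R(c0) is fixed and R has degree below |G|, then R - x vanishes at all |G| conjugates, so
    R is constant. *)
Lemma L_galois : galois_ext jL.
Proof.
move=> x fx; have [R szR e1] := cl_small (rep x).
have ex : x = cl R by rewrite -e1 repK.
exists R`_0; pose D := mj R - x%:P.
have gt0 : (0 < #|gT|)%N by apply/card_gt0P; exists 1%g.
have szD : (size D <= #|gT|)%N.
  rewrite (leq_trans (size_polyD _ _)) // geq_max size_polyN.
  by rewrite (leq_trans (size_poly _ _)) // (leq_trans (size_polyC_leq1 _)).
have [D0|D0] := eqVneq D 0.
  have := congr1 (fun P : {poly L} => P`_0) D0.
  by rewrite coefB coef_map coefC coef0 /= => /eqP; rewrite subr_eq0 => /eqP.
have : (size [seq cj g | g <- enum gT] < size D)%N.
  apply: max_ring_poly_roots => //.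
    apply/allP => _ /mapP[g _ ->]; rewrite /root hornerD hornerN hornerC.
    by rewrite -actE -ex fx ?subrr //; apply: act_gal.
  apply: conj_uniq_roots; last exact: cj_uniq.
  by move=> _ z /mapP[g _ ->] _; rewrite cj_central.
by rewrite size_map -cardE ltnNge szD.
Qed.

Lemma L_outer : outer_ext jL.
Proof.
move=> u uu hu x; suff -> : u * x = x * u by rewrite mulrK.
have uj a : u * jL a = jL a * u by rewrite -{2}(hu a) mulrVK.
rewrite -[x]repK clE; elim/poly_ind: (rep x) => [|P a IH].
  by rewrite rmorph0 horner0 mulr0 mul0r.
rewrite rmorphD rmorphM /= map_polyX map_polyC hornerMXaddC mulrDr mulrDl uj mulrA IH -!mulrA.
by rewrite -cj1 cj_central.
Qed.

Lemma L_gal_isom : Gal_isom gT jL.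
Proof.
(* [act] reverses products by [act_comp]; the inverse repairs this. *)
exists (fun g => act g^-1); split=> [g|g h x|g h gh|f /act_surj[g hg]].
- exact: act_gal.
- by rewrite act_comp invMg.
- by apply: invg_inj; apply: cj_inj; rewrite -!act_c0 gh.
by exists g^-1%g => x; rewrite invgK hg.
Qed.

(** Once powers of w are cancelled, the constant term of the relation has value 0 while all other
    terms would have positive value. *)
Lemma alg_evt q (a : nat -> k) (w : L) f r : (exists2 i, (i < q)%N & a i != 0) ->
  \sum_(i < q) jL (iota (a i)) * w ^+ i = 0 -> w != 0 -> Rp w f -> evt r f -> ~ 0 < r.
Proof.
elim: q a => [|q IH] a [i iq ai] h w0 hf ef r0; first by [].
move: h; rewrite big_ord_recl expr0 mulr1; under eq_bigr do rewrite /= /bump /= add1n exprSr mulrA.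
rewrite -mulr_suml; set W := \sum_(_ < q) _ => h.
have [a0|a0] := eqVneq (a 0%N) 0.
  move: h; rewrite a0 !rmorph0 add0r => /L_domain[h|/eqP]; last by rewrite (negPf w0).
  apply: (IH (fun i => a i.+1)) h w0 hf ef r0; case: i iq ai => [|i] iq ai; first by rewrite a0 eqxx in ai.
  by exists i.
have [N0 hN] := ef.
have ge0 N : (N0 <= N)%N -> vge 0 (\sum_(i < q) iota (a i.+1) * f N ^+ i).
  move=> le; apply: (vge_sum kdiv saut ofK) => l _; rewrite -[0]addr0; apply: vM.
    exact: (vge_iota kdiv saut ofK).
  have [f0 vf] := hN _ le; right; have [_ ->] := ovalX kdiv saut ofK l f0; rewrite vf; nia.
have hW : Rp W (fun N => \sum_(i < q) iota (a i.+1) * f N ^+ i).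
  have hX l : Rp (w ^+ l) (fun N => f N ^+ l).
    elim: l => [|l IHl].
      by have := Rp_j 1; rewrite rmorph1.
    by have := RpM hf IHl; rewrite -exprS; congr Rp; apply: funext => N; rewrite exprS.
  rewrite /W; elim: (q) => [|l IHl].
    by rewrite big_ord0 -(rmorph0 jL); have := Rp_j 0; congr Rp; apply: funext => N; rewrite big_ord0.
  rewrite big_ord_recr /=; have := RpD IHl (RpM (Rp_j (iota (a l.+1))) (hX l)); congr Rp.
  by apply: funext => N; rewrite big_ord_recr.
have := RpD (Rp_j (iota (a 0%N))) (RpM hW hf); rewrite h => /Rp0; apply: (@evt_nul 0).
exists N0 => N le; apply: (vge_val kdiv saut ofK).
- by apply: contraTneq (rmorph_unit iota (kdiv a0)) => h'; rewrite [GRing.RMorphism.sort _ _]h' unitr0.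
- exact: (oval_iota kdiv saut ofK).
apply: vM (ge0 _ le) _; have [f0 vf] := hN _ le; right; rewrite vf; lia.
Qed.

(** A nonzero element of k(x) and its inverse are both left dependent over k, so both have value 0.
    The difference of x and its residue lies in k(x) and would have positive value, so it is
    zero. *)
Lemma L_regular : regular_ext (jL \o iota).
Proof.
move=> x [[ss [_ hs]] _]; pose S w := in_subfield_gen (jL \o iota) x w.
have Sj a : S (jL (iota a)) by move=> T h _ _ _ _ _; apply: h.
have Sx : S x by move=> T _ h _ _ _ _.
have SD u v : S u -> S v -> S (u + v).
  by move=> su sv T h1 h2 h3 h4 h5 h6; exact: (h3 _ _ (su T h1 h2 h3 h4 h5 h6) (sv T h1 h2 h3 h4 h5 h6)).
have SN u : S u -> S (- u) by move=> su T h1 h2 h3 h4 h5 h6; exact: (h4 _ (su T h1 h2 h3 h4 h5 h6)).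
have SM u v : S u -> S v -> S (u * v).
  by move=> su sv T h1 h2 h3 h4 h5 h6; exact: (h5 _ _ (su T h1 h2 h3 h4 h5 h6) (sv T h1 h2 h3 h4 h5 h6)).
have SV u : S u -> u != 0 -> S u^-1.
  by move=> su u0 T h1 h2 h3 h4 h5 h6; exact: (h6 _ (su T h1 h2 h3 h4 h5 h6) u0).
have SX w i : S w -> S (w ^+ i).
  move=> sw; elim: i => [|i IH]; last by rewrite exprS; apply: SM.
  by have := Sj 1; rewrite !rmorph1.
have dep w : S w -> exists2 a : nat -> k, (exists2 i, (i < (size ss).+1)%N & a i != 0) &
    \sum_(i < (size ss).+1) jL (iota (a i)) * w ^+ i = 0.
  move=> sw; have H i : exists v : nat -> k, w ^+ i = \sum_(l < size ss) jL (iota (v l)) * ss`_l.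
    have [c hc] := hs _ (SX w i sw).
    exists (fun l => if insub l is Some l' then c l' else 0); rewrite hc.
    by apply: eq_bigr => l _; rewrite valK.
  have [v hv] := choice H; have [a [ha h]] := divring_dep (size ss) v kdiv.
  exists a => //; under eq_bigr do rewrite hv mulr_sumr; rewrite exchange_big big1 // => l _ /=.
  under eq_bigr do rewrite mulrA -!rmorphM.
  by rewrite -mulr_suml -!rmorph_sum h // !rmorph0 mul0r.
have npos w f r : S w -> w != 0 -> Rp w f -> evt r f -> ~ 0 < r.
  by move=> /dep[a ha h] w0 hf ef; apply: alg_evt ha h w0 hf ef.
have ev0 w f : S w -> w != 0 -> Rp w f -> cau f -> evt 0 f.
  move=> sw w0 hf cf; have [r ef] := Rp_evt hf cf w0.
  suff -> : 0 = r by [].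
  have [f' hf' cf'] := Rp_ex w^-1; have wu := L_divring w0.
  have w0' : w^-1 != 0 by apply: divring_inv_neq0.
  have [r' ef'] := Rp_evt hf' cf' w0'.
  have h1 : Rp (1 : L) (fun=> 1) by have := Rp_j 1; rewrite rmorph1.
  have := RpD (RpM hf hf') (Rp_opp h1); rewrite mulrV // subrr => /Rp0 hn.
  have e1 : evt 0 (fun=> 1) by exists 0%N => N _; rewrite oner_neq0 (oval1 kdiv saut ofK).
  have e2 : evt (r + r') (fun=> 1).
    have := evt_near (evtM ef ef') (nulN hn); congr evt; apply: funext => N.
    by rewrite opprB addrC subrK.
  have := evt_uniq e1 e2; have := npos _ _ _ sw w0 hf ef; have := npos _ _ _ (SV _ sw w0) w0' hf' ef'.
  lia.
have [->|x0] := eqVneq x 0; first by exists 0; rewrite /= !rmorph0.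
have [f hf cf] := Rp_ex x; have [N0 hN] := ev0 _ _ Sx x0 hf cf.
(* From index [N1] on, the terms differ from f N1 by value at least 1, so they share its residue. *)
have [B hB] := cau_step cf; pose N1 := (N0 + `|1 - B|)%N.
have le1 : (N0 <= N1)%N by exact: leq_addr.
have [a ha] : exists a, vge 1 (f N1 - iota a).
  by apply: (residue kdiv saut ofK); right; have [_ ->] := hN _ le1.
exists a; apply/eqP; rewrite -subr_eq0; apply/negP => /negP w0.
have Sw : S (x - jL (iota a)) by apply: SD => //; apply: SN.
have hw : Rp (x - jL (iota a)) (fun N => f N - iota a) := RpD hf (Rp_opp (Rp_j _)).
have cw : cau (fun N => f N - iota a) by apply: cauD => //; apply: cau_const.
have [N2 h2] := ev0 _ _ Sw w0 hw cw; pose N3 := maxn N1 N2.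
have [nz v0] := h2 N3 (leq_maxr _ _).
have : vge 1 (f N3 - iota a).
  rewrite -[f N3](subrK (f N1)) -addrA; apply: vD => //.
  by apply: vgeW (hB _ _ (leq_maxl N1 N2)); rewrite /N1; lia.
by case=> [/eqP|]; [rewrite (negPf nz) | rewrite v0].
Qed.
End Sequences.

Theorem theorem4 (k : unitRingType) (s d : k -> k)
    (K : unitRingType) (iota : {rmorphism k -> K}) (t : K) :
  is_divring k ->
  ring_aut s ->
  sigma_derivation s d ->
  is_ore_fraction_field s d iota t ->
  (exists n : nat, (1 <= n)%N /\ forall x : K, t ^+ n * x = x * t ^+ n) ->
  (exists (F : fieldType) (jF : {rmorphism F -> k}),
      ample F /\ forall a : F, in_c0 s d (jF a)) ->
  RIGP iota.
Proof.
move=> kdiv saut _ ofK [n [n0 tn]] [F [jF [amp c0]]] gT.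
have [y [p [py ydist [e e0 hQ'] dom]]] := ample_split_gen amp [set: gT]%G.
have [Q hQ] := choice (fun u => hQ' u (in_setT u)).
have hQ1 u g : p2s e * y (u * g)%g * ev (y g) p^`() = ev (y g) (Q u) by apply: hQ; rewrite in_setT.
pose I := cover_ideal kdiv saut ofK n0 tn c0 y.
exists (quo I), (jL kdiv saut ofK n0 tn c0 y); split.
- exact: (L_divring py).
- exact: (L_outer py ydist e0 hQ1).
- exact: (L_galois py ydist e0 hQ1 dom).
- exact: (L_regular py).
- exact: (L_gal_isom kdiv saut ofK n0 tn c0 py ydist e0 hQ1 dom).
Qed.
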